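(* Let $k\geq 2$ be an even integer. For a complex number $q$ with $|q|<1$ we have $$\sum_{n=0}^\infty \frac{2^{2k-1}q^{2n+1}\,P^e_{2k-2}(q^{2n+1})}{(1-q^{2n+1})^{2k}}-T_{2k}(\tau/2)=q^{k/2}\,d_k\prod_{n=1}^\infty\frac{(1-q^{2n})^{4k}}{(1-q^{2n-1})^{4k}},$$ where $$P^e_{2k-2}(z)=\sum_{l=1}^{2k-1}(-1)^l b_k(l)z^{l-1}$$ is a polynomial of degree $2k-2$ with integer coefficients $$b_k(l)=\sum_{m=0}^{2k-1}(-1)^m a_k(m)\binom{2k-m-1}{l},$$ where the $a_k(m)$ are defined by $$a_k(m)=\sum_{j=0}^{2k-1}j!\,(-1)^j S(2k-1,j)\binom{j}{m},$$ and $T_{2k}(\tau)\in\mathcal{S}_{2k}(\Gamma_0(4))$; thus $T_{2k}(\tau/2)\to 0$ as $q\to 1$, where the limit is taken from inside the unit disk. In other words, this result gives a $q$-analogue of Euler's formula $$\zeta(2k)=\frac{(-1)^{k+1}2^{2k}B_{2k}\pi^{2k}}{2(2k)!}$$ for $\zeta(2k)$ with $k$ even.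
   Context: Here $q=e^{2\pi i\tau}$ with $\tau$ in the complex upper half-plane. $S(n,j)$ denotes the Stirling number of the second kind, the number of ways of partitioning a set of $n$ objects into $j$ non-empty subsets. Binomial coefficients $\binom{a}{b}$ with integers $0\le a<b$ are $0$. $B_{2k}$ is the $2k$-th Bernoulli number, $\zeta$ is the Riemann zeta function, and $$d_k=-\frac{(-16)^k B_{2k}(4^k-1)}{8k}\in\mathbb{Q}.$$ $\Gamma_0(4)$ is the subgroup of $SL_2(\mathbb{Z})$ of matrices $\begin{pmatrix}a&b\\c&d\end{pmatrix}$ with $c\equiv 0\pmod 4$, and $\mathcal{S}_{2k}(\Gamma_0(4))$ is the space of weight $2k$ cusp forms on $\Gamma_0(4)$. The function $T_{2k}(\tau)$ is uniquely determined as the difference of a $q$-series and a $q$-product: for $k$ even, $$T_{2k}(\tau)=\sum_{n=0}^\infty \frac{2^{2k-1}q^{4n+2}\,P^e_{2k-2}(q^{4n+2})}{(1-q^{4n+2})^{2k}}-q^{k}d_k\prod_{n=1}^\infty\frac{(1-q^{4n})^{4k}}{(1-q^{4n-2})^{4k}}.$$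
   Formalization: The limit T_{2k}(τ/2)→0 as q→1, and the limits giving Euler's formula, are taken non-tangentially (in every region |1-q| ≤ M(1-|q|) inside the disk); the unrestricted limit fails for k≥4, since a non-zero cusp form is unbounded along horocycles at the cusp 0. *)

(* Defs.v *)
From HB Require Import structures.
From mathcomp Require Import all_boot all_order all_algebra.
From mathcomp Require Import all_classical all_reals all_analysis.
From mathcomp Require Import complex.

Set Implicit Arguments.
Unset Strict Implicit.
Unset Printing Implicit Defensive.

Import Order.TTheory GRing.Theory Num.Theory.
Import numFieldNormedType.Exports.

Definition stirling2 (n j : nat) : nat :=
  #|[set P : {set {set 'I_n}} | finset.partition P [set: 'I_n] & #|P| == j]|.

Local Open Scope classical_set_scope.
Local Open Scope ring_scope.
Local Open Scope complex_scope.

(* [:: B_0; ...; B_n], from B_0 = 1 and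
   \sum_(j <= m) 'C(m + 1, j) * B_j = 0 for m >= 1; thus B_1 = - 1 / 2. *)
Fixpoint bernoulli_seq (n : nat) : seq rat :=
  if n is m.+1 then
    let s := bernoulli_seq m in
    rcons s (- (\sum_(j < m.+1) 'C(m.+2, j)%:R * s`_j) / m.+2%:R)
  else [:: 1].

Definition bernoulli (n : nat) : rat := (bernoulli_seq n)`_n.

Definition coef_a (k m : nat) : int :=
  \sum_(0 <= j < 2 * k)
    j`!%:Z * (-1) ^+ j * (stirling2 (2 * k - 1) j)%:Z * 'C(j, m)%:Z.

Definition coef_b (k l : nat) : int :=
  \sum_(0 <= m < 2 * k) (-1) ^+ m * coef_a k m * 'C(2 * k - m - 1, l)%:Z.

Definition Pe (k : nat) : {poly int} :=
  \sum_(1 <= l < 2 * k) ((-1) ^+ l * coef_b k l) *: 'X^(l - 1).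

Definition coef_d (k : nat) : rat :=
  - ((- 16) ^+ k * bernoulli (2 * k) * (4 ^+ k - 1) / (8 * k%:R)).

Definition zeta {R : realType} (s : nat) : R :=
  limn (series (fun n => (n.+1%:R ^+ s)^-1 : R)).

Section ComplexFunctions.
Context {R : realType}.
(* The regular module [R[i]^o] carries the library's topology on [R[i]]. *)
Local Notation C := (R[i]^o).

Definition expC (z : C) : C :=
  (expR (complex.Re z) * cos (complex.Im z))
  +i* (expR (complex.Re z) * sin (complex.Im z)).

Definition upper_half_plane : set C := [set tau | 0 < complex.Im tau].

Definition nome (tau : C) : C := expC ((2 * pi)%:C * 'i%C * tau).

Definition summand (k : nat) (z : C) : C :=
  2 ^+ (2 * k - 1) * z * (map_poly intr (Pe k)).[z] / (1 - z) ^+ (2 * k).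

Definition odd_series (k : nat) (q : C) : nat -> C :=
  series (fun n => summand k (q ^+ (2 * n + 1))).

Definition odd_product (k : nat) (q : C) : nat -> C := fun N =>
  \prod_(1 <= n < N) ((1 - q ^+ (2 * n)) ^+ (4 * k) /
                      (1 - q ^+ (2 * n - 1)) ^+ (4 * k)).

Definition T_series (k : nat) (q : C) : nat -> C :=
  series (fun n => summand k (q ^+ (4 * n + 2))).

Definition T_product (k : nat) (q : C) : nat -> C := fun N =>
  \prod_(1 <= n < N) ((1 - q ^+ (4 * n)) ^+ (4 * k) /
                      (1 - q ^+ (4 * n - 2)) ^+ (4 * k)).

(* T as a function of the nome; k is even, so T_nome is even in q and
   T(tau / 2) depends only on nome tau. *)
Definition T_nome (k : nat) (q : C) : C :=
  limn (T_series k q) - q ^+ k * ratr (coef_d k) * limn (T_product k q).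

Definition T (k : nat) (tau : C) : C := T_nome k (nome tau).

Definition SL2Z : set 'M[int]_2 := [set g | \det g = 1].

Definition Gamma0 (N : nat) : set 'M[int]_2 :=
  [set g | SL2Z g /\ (N%:Z %| g 1%R 0%R)%Z].

Definition autfactor (g : 'M[int]_2) (tau : C) : C :=
  (g 1 0)%:~R * tau + (g 1 1)%:~R.

Definition mobius (g : 'M[int]_2) (tau : C) : C :=
  ((g 0 0)%:~R * tau + (g 0 1)%:~R) / autfactor g tau.

Definition slash (w : nat) (g : 'M[int]_2) (f : C -> C) (tau : C) : C :=
  (autfactor g tau) ^- w * f (mobius g tau).

Definition vanishes_at_infty (f : C -> C) : Prop :=
  forall e : R, 0 < e ->
    \forall A \near +oo, forall tau : C, A < complex.Im tau -> `|f tau| < e%:C.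

(* Every cusp is g(oo) for some g in SL_2(Z), and f vanishes at g(oo) when
   (f | g)(tau) tends to 0 as Im tau tends to +oo, i.e. when the Fourier
   expansion of f | g has only positive exponents. *)
Definition cusp_forms (w N : nat) : set (C -> C) := [set f |
  [/\ forall tau, upper_half_plane tau -> derivable f tau 1,
      forall g, Gamma0 N g ->
        forall tau, upper_half_plane tau -> slash w g f tau = f tau
    & forall g, SL2Z g -> vanishes_at_infty (slash w g f)]].

(* Non-tangential approach to 1 from inside the unit disk (Stolz region of
   aperture M; M = 1 is the radial approach). *)
Definition stolz (M : R) : set_system C :=
  within [set q : C | `|q| < 1 /\ `|1 - q| <= M%:C * (1 - `|q|)]
         (nbhs (1 : C)).

(* The factor by which the identity is multiplied to turn its limit at q = 1
   into Euler's formula. *)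
Definition normalization (k : nat) (q : C) : C :=
  (1 - q) ^+ (2 * k) /
  (2 ^+ (2 * k - 1) * (2 * k - 1)`!%:R * (1 - (2 ^+ (2 * k))^-1)).

End ComplexFunctions.

(* Main.v *)
(* The Stirling numbers turn the summand into 2^(2k-1) \sum_m m^(2k-1) z^m, so
   the q-series O_k is a Lambert series.  Let L = \sum a q^(a x) over odd a, x.
   Liouville's elementary substitutions on the solutions of a x + b y = n give
   L(q)^2 = \sum_(x odd) a^3 q^(2 a x) = O_2(q^2) / 8 and the logarithmic
   derivative of L, whence L(q) / q is the infinite product (for k = 1, at q^2)
   and the right-hand side equals d_k (O_2(q) / 8)^(k/2); the identity is then
   the definition of T.

   Herglotz' trick evaluates \sum_r (s + r)^-2, and expanding in s gives
   Lipschitz' formula, which rewrites O_k as a sum of (c tau + d)^-2k over the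
   rows with c = 2 mod 4.  Hence T is holomorphic, SL_2(Z) only permutes the
   classes of rows modulo 4, and at each cusp T is a constant plus an
   exponentially small term.  The constants cancel by Euler's formula, which
   follows by comparing the expansions of \sum_(r != 0) (i t + r)^-2 and of
   e^-t / (1 - e^-t)^2 at t = 0.  The decay at the cusp 0, transported by
   tau -> -1 / tau, gives the limit of T(tau / 2) in a Stolz region, and
   dominated convergence gives that of the q-series. *)
Require Import Defs.
From HB Require Import structures.
From mathcomp Require Import all_boot all_order all_algebra.
From mathcomp Require Import all_classical all_reals all_analysis.
From mathcomp Require Import complex.
From mathcomp Require Import ring lra zify.

Set Implicit Arguments.
Unset Strict Implicit.
Unset Printing Implicit Defensive.

Import Order.TTheory GRing.Theory Num.Theory.
Import numFieldNormedType.Exports.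

(** * Stirling numbers *)

Section Stirling.
Local Open Scope nat_scope.
Import mathcomp.boot.finset.

(** All series are treated as unordered sums, because nearly every step is a change of index set:
    Liouville's substitutions, the passage from Lambert series to power series and the action of
    [SL_2(Z)] on rows are all bijections under a sum. Limits of partial sums enter only to meet the
    statement.

    The obstacle is the infinite product, which by itself would call for the transformation law of
    an eta quotient. Since [k] is even, the product is a power of [L^2], hence of a weight 4 series,
    so that [T] is a polynomial in two lattice sums, of weights [2 * k] and 4. Both converge
    absolutely; weight 2 occurs only in single rows.

    The product at [Q] is read off from [L] at a square root of [Q], whose choice an even exponent
    makes harmless. The only Bernoulli number computed is [B_4 = - 1 / 30]: it makes the weight 4
    constant term at a cusp equal to [16^-2], up to a power of 2, and this is what the [(- 16)^k] in
    [d_k] compensates. The same cancellation of constants, freed from powers of [2 pi i], shows that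
    both sides of the identity have the same limit at [q = 1]. *)

Lemma preim_partition_eq (T : finType) (S S' : eqType) (f : T -> S) (g : T -> S') (D : {set T}) :
  {in D &, forall x y, (f x == f y) = (g x == g y)} ->
  preim_partition f D = preim_partition g D.
Proof.
move=> fg; apply/setP => B; apply/imsetP/imsetP => -[x xD ->]; exists x => //;
by apply/setP => y; rewrite !inE; have [yD|//] := boolP (y \in D); rewrite /= fg.
Qed.

(* Functions with kernel [P] are the injections of the set of blocks. *)
Lemma card_kernel (T : finType) m (P : {set {set T}}) : partition P [set: T] ->
  #|[set f : {ffun T -> 'I_m} | preim_partition f [set: T] == P]| = m ^_ #|P|.
Proof.
move=> pP; have [/eqP covP tP P0] := and3P pP.
have pbP x : pblock P x \in P by rewrite pblock_mem// covP inE.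
pose rk x : 'I_#|P| := enum_rank_in (pbP x) (pblock P x).
have rkE x : enum_val (rk x) = pblock P x by rewrite enum_rankK_in.
have rk_eq x y : (rk x == rk y) = (pblock P x == pblock P y).
  by apply/eqP/eqP => [e|e]; [rewrite -!rkE e|apply: enum_val_inj; rewrite !rkE e].
have rk_surj i : exists x, rk x == i.
  have iP : enum_val i \in P by exact: enum_valP.
  have /set0Pn[x xi] : enum_val i != set0 by apply: contraNneq P0 => <-.
  by exists x; apply/eqP/enum_val_inj; rewrite rkE (def_pblock tP iP xi).
pose F (g : {ffun 'I_#|P| -> 'I_m}) : {ffun T -> 'I_m} := [ffun x => g (rk x)].
have Finj : injective F.
  move=> g h /ffunP e; apply/ffunP => i; have [x /eqP <-] := rk_surj i.
  by have := e x; rewrite !ffunE.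
have PE : preim_partition (pblock P) [set: T] = P by exact: preim_partition_pblock.
rewrite -[in RHS](card_ord m) -[in RHS](card_ord #|P|) -card_inj_ffuns -(card_imset _ Finj).
apply: eq_card => f; rewrite inE; apply/eqP/imsetP => [fP|[g]]; last first.
  rewrite inE => /injectiveP ginj ->; rewrite -[RHS]PE; apply: preim_partition_eq => x y _ _.
  by rewrite !ffunE (inj_eq ginj) rk_eq.
have f_eq x y : (f x == f y) = (pblock P x == pblock P y).
  have tf := preim_partitionP f [set: T]; have /and3P[_ tf' _] := tf.
  transitivity (y \in pblock P x).
    rewrite -fP pblock_equivalence_partition ?inE//.
    by split => // /eqP->.
  rewrite -eq_pblock ?covP ?inE//.
pose g : {ffun 'I_#|P| -> 'I_m} := [ffun i => f (xchoose (rk_surj i))].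
have gE x : g (rk x) = f x.
  by rewrite ffunE; apply/eqP; rewrite f_eq -rk_eq (xchooseP (rk_surj _)).
exists g; last by apply/ffunP => x; rewrite ffunE gE.
rewrite inE; apply/injectiveP => i j; have [x /eqP <-] := rk_surj i; have [y /eqP <-] := rk_surj j.
by rewrite !gE => /eqP; rewrite f_eq -rk_eq => /eqP.
Qed.

(** Functions are sorted by their kernel, a partition of ['I_n]; by [card_kernel] a partition with
    [j] blocks is the kernel of [m ^_ j] functions. *)
Lemma expn_stirling2 m n : m ^ n = \sum_(j < n.+1) stirling2 n j * m ^_ j.
Proof.
pose K (f : {ffun 'I_n -> 'I_m}) := preim_partition f [set: 'I_n].
transitivity (\sum_(f : {ffun 'I_n -> 'I_m}) 1).
  by rewrite sum1_card card_ffun !card_ord.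
rewrite (partition_big K (fun P => partition P [set: 'I_n])) /=; last first.
  by move=> f _; exact: preim_partitionP.
transitivity (\sum_(P : {set {set 'I_n}} | partition P [set: 'I_n]) m ^_ #|P|).
  apply: eq_bigr => P pP; rewrite sum1_card -(card_kernel _ pP).
  by apply: eq_card => f; rewrite inE.
(* Blocks are nonempty and disjoint, so there are at most [n] of them and [inord] below does not
   truncate their number. *)
have Pn P : partition P [set: 'I_n] -> #|P| < n.+1.
  move=> pP; have [/eqP covP tP P0] := and3P pP.
  rewrite ltnS -[leqRHS]card_ord -[leqRHS]cardsT (card_partition pP) -[leqLHS]muln1.
  rewrite -sum_nat_const; apply: leq_sum => B BP; rewrite card_gt0.
  by apply: contraNneq P0 => <-.
rewrite (partition_big (fun P : {set {set 'I_n}} => inord #|P| : 'I_n.+1) xpredT) //=.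
apply: eq_bigr => j _; rewrite /stirling2 -sum1_card big_distrl /=.
apply: eq_big => [P|P]; rewrite ?inE; last first.
  by move=> /andP[pP /eqP<-]; rewrite mul1n inordK ?Pn.
have [pP|//] := boolP (partition P _) => /=.
by rewrite -val_eqE /= inordK ?Pn.
Qed.

End Stirling.

Local Open Scope classical_set_scope.
Local Open Scope ring_scope.
Local Open Scope complex_scope.

(** * Unordered sums *)

Section RealSums.
Context {R : realType}.
Implicit Types T : choiceType.

(** Stated through [\esum], so that reindexing and exchange of sums are inherited from nonnegative
    extended-real families. *)
Definition rsummable T (A : set T) (f : T -> R) : Prop :=
  (\esum_(i in A) (`|f i|)%:E < +oo)%E.

(* A junk value when the family is not summable. *)
Definition possum T (A : set T) (f : T -> R) : R :=
  fine (\esum_(i in A) (f i)%:E).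

Definition rsum T (A : set T) (f : T -> R) : R :=
  possum A (fun i => Num.max (f i) 0) - possum A (fun i => Num.max (- f i) 0).

Lemma rsummable_le T (A : set T) (f g : T -> R) :
  (forall i, A i -> `|f i| <= g i) -> rsummable A g -> rsummable A f.
Proof.
move=> fg; apply: le_lt_trans; apply: le_esum => i Ai; rewrite lee_fin.
exact: le_trans (fg _ Ai) (ler_norm _).
Qed.

Lemma rsummable0 T (A : set T) : rsummable A (fun=> 0).
Proof. by rewrite /rsummable esum1// => i _; rewrite normr0. Qed.

Lemma rsummableD T (A : set T) (f g : T -> R) :
  rsummable A f -> rsummable A g -> rsummable A (fun i => f i + g i).
Proof.
move=> sf sg; have := lte_add_pinfty sf sg; rewrite -esumD//.
apply: le_lt_trans; apply: le_esum => i Ai.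
by rewrite -EFinD lee_fin ler_normD.
Qed.

Lemma rsummableZ T (A : set T) (c : R) (f : T -> R) :
  rsummable A f -> rsummable A (fun i => c * f i).
Proof.
move=> sf; have H : (\esum_(i in A) (`|c * f i|)%:E <=
    (`|c|)%:E * \esum_(i in A) (`|f i|)%:E)%E.
  apply: ge_ereal_sup => _ [X [finX XA] <-].
  rewrite (eq_fsbigr (fun i => (`|c|)%:E * (`|f i|)%:E)%E); last first.
    by move=> i _; rewrite normrM EFinM.
  rewrite -ge0_mule_fsumr//; apply: lee_wpmul2l; first by rewrite lee_fin.
  by apply: ereal_sup_ubound; exists X.
apply: le_lt_trans H _; apply: lte_mul_pinfty => //.
Qed.

Lemma rsummableN T (A : set T) (f : T -> R) :
  rsummable A f -> rsummable A (fun i => - f i).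
Proof. by apply: le_lt_trans; apply: le_esum => i Ai; rewrite normrN. Qed.

Lemma rsummable_norm T (A : set T) (f : T -> R) :
  rsummable A f -> rsummable A (fun i => `|f i|).
Proof. by apply: le_lt_trans; apply: le_esum => i Ai; rewrite normr_id. Qed.

Lemma rsummable_sub T (A B : set T) (f : T -> R) :
  A `<=` B -> rsummable B f -> rsummable A f.
Proof.
move=> AB; apply: le_lt_trans; rewrite esum_mkcond [leRHS]esum_mkcond.
apply: le_esum => i _; case: ifPn => [/set_mem/AB/mem_set ->//|_].
by case: ifPn.
Qed.

Lemma possumE T (A : set T) (f : T -> R) :
  (forall i, 0 <= f i) -> rsummable A f ->
  (\esum_(i in A) (f i)%:E)%E = (possum A f)%:E.
Proof.
move=> f0 sf; rewrite /possum fineK// fin_numElt; apply/andP; split.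
  by apply: lt_le_trans (esum_ge0 _) => // i _; rewrite lee_fin.
apply: le_lt_trans sf; apply: le_esum => i Ai.
by rewrite lee_fin ler_norm.
Qed.

Lemma possum_ge0 T (A : set T) (f : T -> R) :
  (forall i, 0 <= f i) -> 0 <= possum A f.
Proof.
by move=> f0; apply: fine_ge0; apply: esum_ge0 => i _; rewrite lee_fin.
Qed.

Lemma eq_possum T (A : set T) (f g : T -> R) :
  (forall i, A i -> f i = g i) -> possum A f = possum A g.
Proof. by move=> fg; congr fine; apply: eq_esum => i Ai; rewrite fg. Qed.

Lemma possumD T (A : set T) (f g : T -> R) :
  (forall i, 0 <= f i) -> (forall i, 0 <= g i) ->
  rsummable A f -> rsummable A g ->
  possum A (fun i => f i + g i) = possum A f + possum A g.
Proof.
move=> f0 g0 sf sg; apply: EFin_inj.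
rewrite -possumE//; [|by move=> i; rewrite addr_ge0|exact: rsummableD].
by rewrite EFinD -!possumE// -esumD// => i Ai; rewrite lee_fin ?f0 ?g0.
Qed.

Lemma possumZ T (A : set T) (c : R) (f : T -> R) : 0 <= c ->
  (forall i, 0 <= f i) -> rsummable A f ->
  possum A (fun i => c * f i) = c * possum A f.
Proof.
(* One inequality for all scalars suffices: applied to [c^-1] and the family [c * f i], it gives the
   converse for [c]. *)
have H d g : 0 <= d -> (forall i, 0 <= g i) -> rsummable A g ->
    possum A (fun i => d * g i) <= d * possum A g.
  move=> d0 g0 sg; rewrite -lee_fin -possumE//;
    [|by move=> i; rewrite mulr_ge0|exact: rsummableZ].
  rewrite EFinM -possumE//; apply: ge_ereal_sup => _ [X [finX XA] <-].
  rewrite (eq_fsbigr (fun i => d%:E * (g i)%:E)%E)//.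
  rewrite -ge0_mule_fsumr//; apply: lee_wpmul2l => //.
  by apply: ereal_sup_ubound; exists X.
rewrite le_eqVlt => /predU1P[<- f0 sf|c0 f0 sf].
  rewrite mul0r /possum esum1// => i _; by rewrite mul0r.
apply/eqP; rewrite eq_le H//=; last exact: ltW.
rewrite -ler_pdivlMl//.
apply: le_trans (H c^-1 (fun i => c * f i) _ _ _); first last.
- exact: rsummableZ.
- by move=> i; rewrite mulr_ge0// ltW.
- by rewrite invr_ge0 ltW.
rewrite le_eqVlt; apply/orP; left; apply/eqP; apply: eq_possum => i _.
by rewrite mulrA mulVf ?mul1r// gt_eqF.
Qed.

Lemma possum_reindex T T' (P : set T) (Q : set T') (e : T -> T') (f : T' -> R) :
  set_bij P Q e -> possum Q f = possum P (f \o e).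
Proof. by move=> b; rewrite /possum (reindex_esum _ _ _ _ b). Qed.

Lemma rsummable_reindex T T' (P : set T) (Q : set T') (e : T -> T')
    (f : T' -> R) :
  set_bij P Q e -> rsummable Q f <-> rsummable P (f \o e).
Proof. by move=> b; rewrite /rsummable (reindex_esum _ _ _ _ b). Qed.

Lemma rsummable_pair T T' (A : set T) (B : T -> set T') (f : T -> T' -> R) g :
  (forall i, A i -> rsummable (B i) (f i)) ->
  (forall i, A i -> possum (B i) (fun j => `|f i j|) <= g i) ->
  rsummable A g -> rsummable (A `*`` B) (fun k => f k.1 k.2).
Proof.
move=> sf fg; rewrite /rsummable -(esum_esum (a := fun i j => `|f i j|%:E))//.
apply: le_lt_trans; apply: le_esum => i Ai.
rewrite possumE//; last exact/rsummable_norm/sf.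
by rewrite lee_fin; apply: le_trans (fg _ Ai) (ler_norm _).
Qed.

Lemma rsummable_pair1 T T' (A : set T) (B : T -> set T') (f : T -> T' -> R) i :
  rsummable (A `*`` B) (fun k => f k.1 k.2) -> A i -> rsummable (B i) (f i).
Proof.
move=> + Ai; rewrite /rsummable -(esum_esum (a := fun i j => `|f i j|%:E))//.
apply: le_lt_trans; rewrite (esumID [set i]); last first.
  by move=> j _; apply: esum_ge0.
rewrite setI1 mem_set// esum_set1; last exact: esum_ge0.
by rewrite leeDl//; apply: esum_ge0 => j _; apply: esum_ge0.
Qed.

Lemma rsummable_pair2 T T' (A : set T) (B : T -> set T') (f : T -> T' -> R) :
  rsummable (A `*`` B) (fun k => f k.1 k.2) ->
  rsummable A (fun i => possum (B i) (fun j => `|f i j|)).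
Proof.
move=> sf; have := sf.
rewrite /rsummable -(esum_esum (a := fun i j => `|f i j|%:E))//.
apply: le_lt_trans; apply: le_esum => i Ai.
rewrite possumE//; last exact/rsummable_norm/(rsummable_pair1 sf).
by rewrite lee_fin ger0_norm// possum_ge0.
Qed.

Lemma possum_pair T T' (A : set T) (B : T -> set T') (f : T -> T' -> R) :
  (forall i j, 0 <= f i j) ->
  rsummable (A `*`` B) (fun k => f k.1 k.2) ->
  possum (A `*`` B) (fun k => f k.1 k.2) = possum A (fun i => possum (B i) (f i)).
Proof.
move=> f0 sf; rewrite /possum; congr fine.
rewrite -(esum_esum (a := fun i j => (f i j)%:E)); last first.
  by move=> i j _ _; rewrite lee_fin.
apply: eq_esum => i Ai; rewrite fineK// possumE//.
exact: rsummable_pair1 sf _.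
Qed.

(** Independence of the decomposition: two ways of writing [f] as a difference of nonnegative
    summable families are compared through additivity of [possum]. Linearity and Fubini's theorem
    are reduced to this. *)
Lemma rsum_sub T (A : set T) (f u v : T -> R) :
  (forall i, 0 <= u i) -> (forall i, 0 <= v i) ->
  rsummable A u -> rsummable A v -> (forall i, A i -> f i = u i - v i) ->
  rsum A f = possum A u - possum A v.
Proof.
move=> u0 v0 su sv fE.
have m0 (g : T -> R) i : 0 <= Num.max (g i) 0 by rewrite le_max lexx orbT.
have sf : rsummable A f.
  apply: rsummable_le (rsummableD su sv) => i /fE ->.
  by apply: le_trans (ler_normB _ _) _; rewrite !ger0_norm.
have sm (g : T -> R) : rsummable A g -> rsummable A (fun i => Num.max (g i) 0).
  move=> sg; apply: rsummable_le (rsummable_norm sg) => i _.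
  by rewrite ger0_norm// ge_max ler_norm normr_ge0.
apply/eqP; rewrite /rsum subr_eq addrAC eq_sym subr_eq; apply/eqP.
have sN := sm _ (rsummableN sf); have sP := sm _ sf.
rewrite -(possumD u0 (m0 _) su sN) -(possumD (m0 _) v0 sP sv).
apply: eq_possum => i /fE ->.
by case: (leP (u i - v i) 0); case: (leP (- (u i - v i)) 0); lra.
Qed.

Lemma rsum_posneg T (A : set T) (f : T -> R) : rsummable A f ->
  exists u v, [/\ forall i, 0 <= u i, forall i, 0 <= v i,
    rsummable A u, rsummable A v & forall i, f i = u i - v i].
Proof.
move=> sf; exists (fun i => `|f i|), (fun i => `|f i| - f i); split=> //.
- by move=> i; rewrite subr_ge0 ler_norm.
- exact: rsummable_norm.
- by apply: rsummableD; [exact: rsummable_norm|exact: rsummableN].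
- by move=> i; lra.
Qed.

Lemma eq_rsum T (A : set T) (f g : T -> R) :
  (forall i, A i -> f i = g i) -> rsum A f = rsum A g.
Proof.
by move=> fg; rewrite /rsum; congr (_ - _); apply: eq_possum => i Ai; rewrite fg.
Qed.

Lemma rsumD T (A : set T) (f g : T -> R) : rsummable A f -> rsummable A g ->
  rsum A (fun i => f i + g i) = rsum A f + rsum A g.
Proof.
move=> /rsum_posneg[u [v [u0 v0 su sv fE]]] /rsum_posneg[u' [v' [u0' v0' su' sv' gE]]].
rewrite (rsum_sub (f := f) u0 v0 su sv)// (rsum_sub (f := g) u0' v0' su' sv')//.
rewrite (@rsum_sub _ _ _ (fun i => u i + u' i) (fun i => v i + v' i))//;
  rewrite ?possumD//; first by lra.
all: try by move=> i; rewrite addr_ge0.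
- exact: rsummableD.
- exact: rsummableD.
- by move=> i _; rewrite fE gE; lra.
Qed.

Lemma possum_rsum T (A : set T) (f : T -> R) : (forall i, 0 <= f i) ->
  rsummable A f -> rsum A f = possum A f.
Proof.
move=> f0 sf; rewrite (@rsum_sub _ _ f f (fun=> 0))//.
- by rewrite [X in _ - X](_ : _ = 0) ?subr0// /possum esum1.
- exact: rsummable0.
- by move=> i _; rewrite subr0.
Qed.

Lemma rsumN T (A : set T) (f : T -> R) :
  rsum A (fun i => - f i) = - rsum A f.
Proof.
rewrite /rsum opprB; congr (_ - _); apply: eq_possum => i _; by rewrite opprK.
Qed.

Lemma rsumZ T (A : set T) (c : R) (f : T -> R) : rsummable A f ->
  rsum A (fun i => c * f i) = c * rsum A f.
Proof.
wlog c0 : c / 0 <= c => [H sf|].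
  have [/H->//|/ltW c0] := leP 0 c.
  have /H : 0 <= - c by rewrite oppr_ge0.
  move=> /(_ sf); rewrite mulNr => /eqP; rewrite -eqr_oppLR => /eqP <-.
  by rewrite -rsumN; apply: eq_rsum => i _; rewrite mulNr opprK.
move=> /rsum_posneg[u [v [u0 v0 su sv fE]]].
rewrite (rsum_sub (f := f) u0 v0 su sv)//.
rewrite (@rsum_sub _ _ _ (fun i => c * u i) (fun i => c * v i)) ?possumZ//.
- by rewrite mulrBr.
- by move=> i; rewrite mulr_ge0.
- by move=> i; rewrite mulr_ge0.
- exact: rsummableZ.
- exact: rsummableZ.
- by move=> i _; rewrite fE mulrBr.
Qed.

Lemma le_rsum T (A : set T) (f g : T -> R) : rsummable A f -> rsummable A g ->
  (forall i, A i -> f i <= g i) -> rsum A f <= rsum A g.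
Proof.
move=> sf sg fg; rewrite -subr_ge0 -rsumN -rsumD//; last exact: rsummableN.
rewrite (@rsum_sub _ _ _ (fun i => Num.max (g i - f i) 0) (fun=> 0))//.
- rewrite [X in _ - X](_ : _ = 0) ?subr0; last by rewrite /possum esum1.
  by apply: possum_ge0 => i; rewrite le_max lexx orbT.
- by move=> i; rewrite le_max lexx orbT.
- have := rsummable_norm (rsummableD sg (rsummableN sf)).
  apply: rsummable_le => i _; rewrite ger0_norm ?le_max ?lexx ?orbT//.
  by rewrite ge_max ler_norm normr_ge0.
- exact: rsummable0.
- by move=> i /fg fgi; rewrite max_l ?subr0// subr_ge0.
Qed.

Lemma rsum_reindex T T' (P : set T) (Q : set T') (e : T -> T') (f : T' -> R) :
  set_bij P Q e -> rsum Q f = rsum P (f \o e).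
Proof. by move=> b; rewrite /rsum !(possum_reindex _ b). Qed.

(** Tonelli's theorem for [|f|] and for [|f| - f], both nonnegative. *)
Lemma rsum_pair T T' (A : set T) (B : T -> set T') (f : T -> T' -> R) :
  rsummable (A `*`` B) (fun k => f k.1 k.2) ->
  rsum (A `*`` B) (fun k => f k.1 k.2) = rsum A (fun i => rsum (B i) (f i)).
Proof.
move=> sf; pose u i j := `|f i j|; pose v i j := `|f i j| - f i j.
have u0 i j : 0 <= u i j by exact: normr_ge0.
have v0 i j : 0 <= v i j by rewrite subr_ge0 ler_norm.
have su : rsummable (A `*`` B) (fun k => u k.1 k.2) by exact: rsummable_norm.
have sv : rsummable (A `*`` B) (fun k => v k.1 k.2).
  by apply: rsummableD => //; exact: rsummableN.
rewrite (rsum_sub _ _ su sv); [|by []|by []|by move=> k _; rewrite /u /v; lra].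
rewrite !possum_pair//; apply/esym.
rewrite (@rsum_sub _ _ _ (fun i => possum (B i) (u i)) (fun i => possum (B i) (v i)))//.
- by move=> i; apply: possum_ge0.
- by move=> i; apply: possum_ge0.
- apply: rsummable_le (rsummable_pair2 su) => i Ai.
  rewrite ger0_norm ?possum_ge0// le_eqVlt; apply/orP; left; apply/eqP.
  by apply: eq_possum => j _; rewrite ger0_norm.
- apply: rsummable_le (rsummable_pair2 sv) => i Ai.
  rewrite ger0_norm ?possum_ge0// le_eqVlt; apply/orP; left; apply/eqP.
  by apply: eq_possum => j _; rewrite ger0_norm.
- move=> i Ai; rewrite (@rsum_sub _ _ _ (u i) (v i))//.
  + exact: rsummable_pair1 su Ai.
  + exact: rsummable_pair1 sv Ai.
  + by move=> j _; rewrite /u /v; lra.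
Qed.

Lemma rsumID T (B A : set T) (f : T -> R) : rsummable A f ->
  rsum A f = rsum (A `&` B) f + rsum (A `&` ~` B) f.
Proof.
move=> /rsum_posneg[u [v [u0 v0 su sv fE]]].
have sI (g : T -> R) : rsummable A g -> rsummable (A `&` B) g.
  by apply: rsummable_sub => i [].
have sD (g : T -> R) : rsummable A g -> rsummable (A `&` ~` B) g.
  by apply: rsummable_sub => i [].
have pD (g : T -> R) : (forall i, 0 <= g i) -> rsummable A g ->
    possum A g = possum (A `&` B) g + possum (A `&` ~` B) g.
  move=> g0 sg; apply: EFin_inj; rewrite EFinD -!possumE//; try by [apply: sI|apply: sD].
  by rewrite (esumID B)// => i _; rewrite lee_fin.
rewrite (rsum_sub u0 v0 su sv)//.
rewrite (rsum_sub (A := A `&` B) (f := f) u0 v0 (sI _ su) (sI _ sv))//.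
rewrite (rsum_sub (A := A `&` ~` B) (f := f) u0 v0 (sD _ su) (sD _ sv))//.
by rewrite (pD u)// (pD v)//; lra.
Qed.

Lemma rsum_set1 T (t : T) (f : T -> R) : rsum [set t] f = f t.
Proof.
rewrite /rsum /possum !esum_set1 ?lee_fin ?le_max ?lexx ?orbT//=.
by case: (leP (f t) 0); case: (leP (- f t) 0); lra.
Qed.

Lemma rsum0 T (A : set T) (f : T -> R) : (forall i, A i -> f i = 0) ->
  rsum A f = 0.
Proof.
move=> f0; rewrite /rsum /possum !esum1 ?subrr// => i /f0 ->;
  by rewrite ?oppr0 maxxx.
Qed.

Lemma cvg_series_rsum (f : nat -> R) : rsummable setT f ->
  series f @ \oo --> rsum setT f.
Proof.
have H (u : nat -> R) : (forall i, 0 <= u i) -> rsummable setT u ->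
    series u @ \oo --> possum setT u.
  move=> u0 su.
  have : (fun n => (\sum_(0 <= i < n) (u i)%:E)%E) @ \oo --> (possum setT u)%:E.
    rewrite -possumE// -nneseries_esumT; last by move=> n; rewrite lee_fin.
    by apply: is_cvg_nneseries => n _ _; rewrite lee_fin.
  rewrite (_ : series u = fine \o (fun n => \sum_(0 <= i < n) (u i)%:E)%E).
    by case/fine_cvgP.
  by apply/funext => n /=; rewrite sumEFin.
move=> /rsum_posneg[u [v [u0 v0 su sv fE]]].
rewrite (rsum_sub (f := f) u0 v0 su sv)//.
rewrite (_ : f = u \- v); last by apply/funext => i; rewrite fE.
have -> : series (u \- v) = series u \- series v.
  by apply/funext => n; rewrite /series/= sumrB.
by apply: cvgB; apply: H.
Qed.

End RealSums.

(** * Real-valued modulus of a complex number *)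

Section ComplexNorm.
Context {R : realType}.
Implicit Types z w : R[i].

(** The norm of [R[i]] takes its values in [R[i]], where the order is partial; estimates are made
    with this real version. *)
Definition nrm z : R := complex.Re `|z|.

Lemma nrmE z : `|z| = (nrm z)%:C.
Proof. by rewrite /nrm normc_def. Qed.

Lemma nrm_ge0 z : 0 <= nrm z.
Proof. by rewrite -(@ler0c R) -nrmE. Qed.

Lemma nrmM z w : nrm (z * w) = nrm z * nrm w.
Proof. by apply: complexI; rewrite rmorphM -!nrmE normrM. Qed.

Lemma nrmX z n : nrm (z ^+ n) = nrm z ^+ n.
Proof. by apply: complexI; rewrite rmorphXn -!nrmE normrX. Qed.

Lemma nrmN z : nrm (- z) = nrm z.
Proof. by rewrite /nrm normrN. Qed.

Lemma nrm_dist z w : nrm (z - w) = nrm (w - z).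
Proof. by rewrite /nrm distrC. Qed.

Lemma nrm0 : nrm 0 = 0. Proof. by rewrite /nrm normr0. Qed.
Lemma nrm1 : nrm 1 = 1. Proof. by rewrite /nrm normr1. Qed.

Lemma nrmV z : nrm z^-1 = (nrm z)^-1.
Proof. by apply: complexI; rewrite fmorphV -!nrmE normfV. Qed.

Lemma ler_nrmD z w : nrm (z + w) <= nrm z + nrm w.
Proof. by rewrite -lecR rmorphD -!nrmE ler_normD. Qed.

Lemma ler_nrmB z w : nrm (z - w) <= nrm z + nrm w.
Proof. by rewrite -lecR rmorphD -!nrmE ler_normB. Qed.

Lemma ler_dist_nrm z w : `|nrm z - nrm w| <= nrm (z - w).
Proof.
have H a b : nrm a - nrm b <= nrm (a - b).
  by rewrite lerBlDr; apply: le_trans (ler_nrmD _ _); rewrite subrK.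
by rewrite ler_norml H lerNl opprB nrm_dist H.
Qed.

Lemma nrm_real (x : R) : nrm x%:C = `|x|.
Proof. by rewrite /nrm normc_def/= expr0n addr0 sqrtr_sqr. Qed.

Lemma nrm_nat n : nrm n%:R = n%:R.
Proof. by rewrite -(rmorph_nat (real_complex R)) nrm_real ger0_norm. Qed.

Lemma nrm_eq0 z : (nrm z == 0) = (z == 0).
Proof. by rewrite -(inj_eq (@complexI R)) -nrmE normr_eq0. Qed.

Lemma nrm_gt0 z : (0 < nrm z) = (z != 0).
Proof. by rewrite lt_def nrm_ge0 andbT nrm_eq0. Qed.

Lemma nrm_sqr z : nrm z ^+ 2 = complex.Re z ^+ 2 + complex.Im z ^+ 2.
Proof. by rewrite /nrm normc_def sqr_sqrtr// addr_ge0// sqr_ge0. Qed.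

Lemma Re_le_nrm z : `|complex.Re z| <= nrm z.
Proof. by rewrite -lecR -nrmE normc_ge_Re. Qed.

Lemma Im_le_nrm z : `|complex.Im z| <= nrm z.
Proof.
rewrite -(@ler_pXn2r _ 2) ?nnegrE ?nrm_ge0//.
by rewrite real_normK ?num_real// nrm_sqr lerDr sqr_ge0.
Qed.

Lemma nrm_le_ReIm z : nrm z <= `|complex.Re z| + `|complex.Im z|.
Proof.
rewrite -(@ler_pXn2r _ 2) ?nnegrE ?nrm_ge0// ?addr_ge0//.
rewrite nrm_sqr sqrrD !real_normK ?num_real//.
by rewrite addrAC lerDl mulrn_wge0// mulr_ge0.
Qed.

Lemma normc_lt (e : R) z : (`|z| < e%:C) = (nrm z < e).
Proof. by rewrite nrmE ltcR. Qed.

(** A positive element of [R[i]] has imaginary part 0, so real radii define the same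
    neighbourhoods. *)
Lemma cvgC_nrm (T : Type) (F : set_system T) (FF : Filter F) (f : T -> R[i]^o)
    (l : R[i]^o) :
  (forall e : R, 0 < e -> \forall x \near F, nrm (f x - l) < e) <->
  f x @[x --> F] --> l.
Proof.
split=> [H|/cvgrPdist_lt H e e0].
  apply/cvgrPdist_lt => e; rewrite ltcE/= => /andP[/eqP ei er].
  have eE : e = (complex.Re e)%:C by case: e ei er => a b /= ->.
  by apply: filterS (H _ er) => x; rewrite eE distrC normc_lt.
have := H e%:C; rewrite ltcR => /(_ e0); apply: filterS => x.
by rewrite distrC normc_lt.
Qed.

End ComplexNorm.

(** * Unordered sums of complex families *)

Section ComplexSums.
Context {R : realType}.
Implicit Types T : choiceType.
Local Notation C := R[i].

Definition csummable T (A : set T) (f : T -> C) : Prop :=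
  rsummable A (fun i => nrm (f i)).

Definition csum T (A : set T) (f : T -> C) : C :=
  rsum A (fun i => complex.Re (f i)) +i* rsum A (fun i => complex.Im (f i)).

Lemma csummable_le T (A : set T) (f : T -> C) (g : T -> R) :
  (forall i, A i -> nrm (f i) <= g i) -> rsummable A g -> csummable A f.
Proof.
by move=> fg; apply: rsummable_le => i Ai; rewrite ger0_norm ?nrm_ge0// fg.
Qed.

Lemma csummable_Re T (A : set T) (f : T -> C) : csummable A f ->
  rsummable A (fun i => complex.Re (f i)).
Proof. by apply: rsummable_le => i _; exact: Re_le_nrm. Qed.

Lemma csummable_Im T (A : set T) (f : T -> C) : csummable A f ->
  rsummable A (fun i => complex.Im (f i)).
Proof. by apply: rsummable_le => i _; exact: Im_le_nrm. Qed.
#[local] Hint Resolve csummable_Re csummable_Im : core.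

Lemma csummable_sub T (A B : set T) (f : T -> C) :
  A `<=` B -> csummable B f -> csummable A f.
Proof. exact: rsummable_sub. Qed.

Lemma csummable0 T (A : set T) : csummable A (fun=> 0).
Proof. by apply: rsummable_le (rsummable0 A) => i _; rewrite nrm0 normr0. Qed.

Lemma eq_csummable T (A : set T) (f g : T -> C) :
  (forall i, A i -> f i = g i) -> csummable A f -> csummable A g.
Proof. by move=> fg; apply: csummable_le => i Ai; rewrite -fg. Qed.

Lemma csummableD T (A : set T) (f g : T -> C) : csummable A f -> csummable A g ->
  csummable A (fun i => f i + g i).
Proof.
move=> sf sg; apply: csummable_le (rsummableD sf sg) => i _; exact: ler_nrmD.
Qed.

Lemma csummableZ T (A : set T) c (f : T -> C) : csummable A f ->
  csummable A (fun i => c * f i).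
Proof.
move=> sf; apply: csummable_le (rsummableZ (nrm c) sf) => i _.
by rewrite nrmM.
Qed.

Lemma csummableN T (A : set T) (f : T -> C) : csummable A f ->
  csummable A (fun i => - f i).
Proof. by apply: csummable_le => i _; rewrite nrmN. Qed.

Lemma csummableB T (A : set T) (f g : T -> C) : csummable A f -> csummable A g ->
  csummable A (fun i => f i - g i).
Proof. by move=> sf sg; apply: csummableD => //; exact: csummableN. Qed.

Lemma eq_csum T (A : set T) (f g : T -> C) :
  (forall i, A i -> f i = g i) -> csum A f = csum A g.
Proof.
by move=> fg; rewrite /csum; congr (_ +i* _); apply: eq_rsum => i Ai; rewrite fg.
Qed.

Lemma csumD T (A : set T) (f g : T -> C) : csummable A f -> csummable A g ->
  csum A (fun i => f i + g i) = csum A f + csum A g.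
Proof.
move=> sf sg; rewrite /csum; simpc; rewrite -!rsumD; auto.
by congr (_ +i* _); apply: eq_rsum => i _; case: (f i) (g i) => [? ?] [? ?].
Qed.

Lemma csumN T (A : set T) (f : T -> C) : csum A (fun i => - f i) = - csum A f.
Proof.
rewrite /csum -[RHS]/((- _) +i* (- _)) -!rsumN.
by congr (_ +i* _); apply: eq_rsum => i _; case: (f i).
Qed.

Lemma csumB T (A : set T) (f g : T -> C) : csummable A f -> csummable A g ->
  csum A (fun i => f i - g i) = csum A f - csum A g.
Proof. by move=> sf sg; rewrite csumD ?csumN//; exact: csummableN. Qed.

Lemma csumZ T (A : set T) c (f : T -> C) : csummable A f ->
  csum A (fun i => c * f i) = c * csum A f.
Proof.
move=> sf; rewrite /csum; case: c => a b; simpc.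
rewrite -!rsumZ; auto; rewrite -rsumN -!rsumD; auto using @rsummableN, @rsummableZ.
congr (_ +i* _); apply: eq_rsum => i _; case: (f i) => x y//=; simpc => /=; lra.
Qed.

Lemma csumZr T (A : set T) c (f : T -> C) : csummable A f ->
  csum A (fun i => f i * c) = csum A f * c.
Proof.
by move=> sf; rewrite mulrC -csumZ//; apply: eq_csum => i _; rewrite mulrC.
Qed.

Lemma csum_real T (A : set T) (f : T -> R) :
  csum A (fun i => (f i)%:C) = (rsum A f)%:C.
Proof. by rewrite /csum/= (rsum0 (f := fun=> 0)). Qed.

Lemma csum0 T (A : set T) (f : T -> C) : (forall i, A i -> f i = 0) ->
  csum A f = 0.
Proof. by move=> f0; rewrite /csum !rsum0// => i /f0 ->. Qed.

Lemma csum_set1 T (t : T) (f : T -> C) : csum [set t] f = f t.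
Proof. by rewrite /csum !rsum_set1; case: (f t). Qed.

Lemma csumID T (B A : set T) (f : T -> C) : csummable A f ->
  csum A f = csum (A `&` B) f + csum (A `&` ~` B) f.
Proof.
by move=> sf; rewrite /csum; simpc; rewrite -!rsumID; auto.
Qed.

Lemma csum_reindex T T' (P : set T) (Q : set T') (e : T -> T') (f : T' -> C) :
  set_bij P Q e -> csum Q f = csum P (f \o e).
Proof. by move=> b; rewrite /csum !(rsum_reindex _ b). Qed.

Lemma csummable_reindex T T' (P : set T) (Q : set T') (e : T -> T')
    (f : T' -> C) :
  set_bij P Q e -> csummable Q f <-> csummable P (f \o e).
Proof. by move=> b; rewrite /csummable (rsummable_reindex _ b). Qed.

Lemma csummable_pair T T' (A : set T) (B : T -> set T') (f : T -> T' -> C) g :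
  (forall i, A i -> csummable (B i) (f i)) ->
  (forall i, A i -> rsum (B i) (fun j => nrm (f i j)) <= g i) ->
  rsummable A g -> csummable (A `*`` B) (fun k => f k.1 k.2).
Proof.
move=> sf fg; apply: (rsummable_pair (f := fun i j => nrm (f i j))) => // i Ai.
apply: le_trans (fg _ Ai); rewrite possum_rsum.
- rewrite le_eqVlt; apply/orP; left; apply/eqP.
  by apply: eq_possum => j _; rewrite ger0_norm ?nrm_ge0.
- by move=> j; exact: nrm_ge0.
- exact: sf.
Qed.

Lemma csum_pair T T' (A : set T) (B : T -> set T') (f : T -> T' -> C) :
  csummable (A `*`` B) (fun k => f k.1 k.2) ->
  csum (A `*`` B) (fun k => f k.1 k.2) = csum A (fun i => csum (B i) (f i)).
Proof.
move=> sf; rewrite /csum.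
have sR := csummable_Re sf; have sI := csummable_Im sf.
by rewrite (rsum_pair (f := fun i j => complex.Re (f i j)))//
   (rsum_pair (f := fun i j => complex.Im (f i j))).
Qed.

Lemma csummable_pair1 T T' (A : set T) (B : T -> set T') (f : T -> T' -> C) i :
  csummable (A `*`` B) (fun k => f k.1 k.2) -> A i -> csummable (B i) (f i).
Proof.
by move=> /(rsummable_pair1 (f := fun i j => nrm (f i j))); apply.
Qed.

(** Multiplying the family by the conjugate of its sum [S] turns the sum into [|S|^2]; taking real
    parts termwise bounds this by [|S|] times the sum of the moduli. *)
Lemma nrm_csum_le T (A : set T) (f : T -> C) : csummable A f ->
  nrm (csum A f) <= rsum A (fun i => nrm (f i)).
Proof.
move=> sf; set S := csum A f; have [->|S0] := eqVneq S 0.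
  rewrite nrm0 possum_rsum//; first by apply: possum_ge0 => i; exact: nrm_ge0.
  by move=> i; exact: nrm_ge0.
rewrite -(ler_pM2l (_ : 0 < nrm S)) ?nrm_gt0// -expr2 -rsumZ//.
have -> : nrm S ^+ 2 = complex.Re (csum A (fun i => S^*%C * f i)).
  rewrite csumZ// -/S nrm_sqr; case: S {S0} => a b /=; simpc => /=; lra.
clearbody S.
rewrite /csum/=; apply: le_rsum.
- by apply: csummable_Re; exact: csummableZ.
- exact: rsummableZ.
- move=> i _; apply: le_trans (ler_norm _) _; apply: le_trans (Re_le_nrm _) _.
  by rewrite nrmM /nrm normcJ.
Qed.

Lemma cvg_series_csum (f : nat -> C) : csummable setT f ->
  series (f : nat -> C^o) @ \oo --> (csum setT f : C^o).
Proof.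
move=> sf; apply/cvgC_nrm => e e0.
have /cvgrPdist_lt /(_ (e / 2)) HR := cvg_series_rsum (csummable_Re sf).
have /cvgrPdist_lt /(_ (e / 2)) HI := cvg_series_rsum (csummable_Im sf).
have e2 : 0 < e / 2 by rewrite divr_gt0.
have E n : \sum_(0 <= k < n) f k = (series (fun i => complex.Re (f i)) n +i*
    series (fun i => complex.Im (f i)) n : C).
  elim: n => [|n IH]; first by rewrite /series/= !big_nil.
  rewrite /series/= !big_nat_recr//= IH /series/=.
  by case: (f n).
near=> n.
rewrite E.
apply: le_lt_trans (nrm_le_ReIm _) _.
rewrite [e]splitr /=; apply: ltrD.
  by rewrite distrC; near: n; exact: HR.
by rewrite distrC; near: n; exact: HI.
Unshelve. all: by end_near. Qed.

Lemma csum_sum T (A : set T) (I : Type) (r : seq I) (P : pred I)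
    (f : I -> T -> C) : (forall j, P j -> csummable A (f j)) ->
  csummable A (fun i => \sum_(j <- r | P j) f j i) /\
  csum A (fun i => \sum_(j <- r | P j) f j i) = \sum_(j <- r | P j) csum A (f j).
Proof.
move=> sf; elim: r => [|j r [IH1 IH2]].
  split.
    by apply: eq_csummable (csummable0 A) => i _; rewrite big_nil.
  by rewrite big_nil csum0// => i _; rewrite big_nil.
rewrite big_cons; case: ifPn => Pj; split.
- apply: eq_csummable (csummableD (sf j Pj) IH1) => i _.
  by rewrite big_cons Pj.
- rewrite -IH2 -csumD//; last exact: sf.
  by apply: eq_csum => i _; rewrite big_cons Pj.
- by apply: eq_csummable IH1 => i _; rewrite big_cons (negPf Pj).
- by rewrite -IH2; apply: eq_csum => i _; rewrite big_cons (negPf Pj).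
Qed.

Lemma csummable_mul T T' (A : set T) (B : set T') (f : T -> C) (g : T' -> C) :
  csummable A f -> csummable B g ->
  csummable (A `*`` fun=> B) (fun k => f k.1 * g k.2).
Proof.
move=> sf sg; apply: (csummable_pair (f := fun i j => f i * g j)
  (g := fun i => nrm (f i) * rsum B (fun j => nrm (g j)))).
- by move=> i _; exact: csummableZ.
- move=> i _; rewrite -rsumZ//; apply: le_rsum => //.
  + by apply: csummableZ.
  + exact: rsummableZ.
  + by move=> j _; rewrite nrmM.
- apply: rsummable_le (rsummableZ (rsum B (fun j => nrm (g j))) sf) => i _.
  rewrite mulrC ger0_norm// mulr_ge0 ?nrm_ge0// possum_rsum//.
    by apply: possum_ge0 => j; exact: nrm_ge0.
  by move=> j; exact: nrm_ge0.
Qed.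

Lemma csum_mul T T' (A : set T) (B : set T') (f : T -> C) (g : T' -> C) :
  csummable A f -> csummable B g ->
  csum (A `*`` fun=> B) (fun k => f k.1 * g k.2) = csum A f * csum B g.
Proof.
move=> sf sg; rewrite (csum_pair (f := fun i j => f i * g j)); last first.
  exact: csummable_mul.
rewrite -csumZr//; apply: eq_csum => i _; exact: csumZ.
Qed.

End ComplexSums.

(** * Grouping and exchange of sums, geometric series, power series *)

Section MoreSums.
Context {R : realType}.
Implicit Types T : choiceType.
Local Notation C := R[i].

Lemma nrm_sum (I : Type) (r : seq I) (P : pred I) (f : I -> C) :
  nrm (\sum_(i <- r | P i) f i) <= \sum_(i <- r | P i) nrm (f i).
Proof.
elim/big_ind2 : _ => //; first by rewrite nrm0.
by move=> x a y b xa yb; apply: le_trans (ler_nrmD _ _) (lerD xa yb).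
Qed.

Lemma csummable_outer T T' (A : set T) (B : T -> set T') (f : T -> T' -> C) :
  csummable (A `*`` B) (fun k => f k.1 k.2) ->
  csummable A (fun i => csum (B i) (f i)).
Proof.
move=> sf; apply: csummable_le (rsummable_pair2 (f := fun i j => nrm (f i j)) sf).
move=> i Ai; have sfi := csummable_pair1 sf Ai.
apply: le_trans (nrm_csum_le sfi) _.
rewrite possum_rsum//; last by move=> j; exact: nrm_ge0.
rewrite le_eqVlt; apply/orP; left; apply/eqP; apply: eq_possum => j _.
by rewrite ger0_norm// nrm_ge0.
Qed.

Lemma csum_swap T T' (A : set T) (B : set T') (f : T -> T' -> C) :
  csummable (A `*`` fun=> B) (fun k => f k.1 k.2) ->
  csum A (fun i => csum B (f i)) = csum B (fun j => csum A (f^~ j)).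
Proof.
move=> sf; rewrite -csum_pair//.
have b : set_bij (B `*`` fun=> A) (A `*`` fun=> B) (fun k => (k.2, k.1)).
  split; [by move=> [? ?] []|by move=> [? ?] [? ?] _ _ [-> ->]|].
  by move=> [x y] [/= ? ?]; exists (y, x).
rewrite (csum_reindex _ b) -(csum_pair (f := fun j i => f i j))//.
by apply/(csummable_reindex (fun k => f k.1 k.2) b).
Qed.

(** Serves to collect the terms of a Lambert series that have the same exponent. *)
Lemma csum_fiber T (A : set T) (p : T -> nat) (f : T -> C) : csummable A f ->
  csummable setT (fun n => csum (A `&` [set x | p x = n]) f) /\
  csum A f = csum setT (fun n => csum (A `&` [set x | p x = n]) f).
Proof.
move=> sf; pose B n := A `&` [set x | p x = n].
have b : set_bij A (setT `*`` B) (fun x => (p x, x)).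
  split; [by move=> x Ax|by move=> x y _ _ []|].
  by move=> [n x] [_ [/= Ax pxn]]; exists x => //; rewrite pxn.
have sB : csummable (setT `*`` B) (fun k => f k.2).
  by apply/(csummable_reindex _ b).
split; first exact: (csummable_outer (f := fun=> f)).
by rewrite -(csum_pair (f := fun=> f))// (csum_reindex _ b).
Qed.

Lemma csumU T (A B : set T) (f : T -> C) : csummable (A `|` B) f ->
  A `&` B = set0 -> csum (A `|` B) f = csum A f + csum B f.
Proof.
move=> sf AB; rewrite (csumID A sf); congr (csum _ f + csum _ f).
  by rewrite setIC setIUr setIid setUIr setUid setIidl// => x; left.
rewrite setIUl setICr set0U; apply/seteqP; split => [x []//|x Bx]; split => //.
by move=> Ax; have : (A `&` B) x by []; rewrite AB.
Qed.

Lemma csum_set0 T (f : T -> C) : csum set0 f = 0.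
Proof. exact: csum0. Qed.

Lemma csummable_finite T (A : set T) (f : T -> C) : finite_set A -> csummable A f.
Proof.
move=> fA; rewrite /csummable /rsummable esum_fset//.
rewrite fsbig_finite//= sumEFin; exact: ltry.
Qed.

Lemma csum_II n (f : nat -> C) : csum `I_n f = \sum_(i < n) f i.
Proof.
elim: n => [|n IH]; first by rewrite II0 csum_set0 big_ord0.
rewrite IIS csumU ?csum_set1 ?IH ?big_ord_recr//.
  by apply: csummable_finite; rewrite finite_setU; split.
by apply/seteqP; split => // i [/= + E]; rewrite E ltnn.
Qed.

Lemma csum_mkcond T (A : set T) (f : T -> C) : csummable A f ->
  csum A f = csum setT (fun x => if x \in A then f x else 0).
Proof.
move=> sf; rewrite (csumID A (A := setT)); last first.
  rewrite /csummable /rsummable [in X in (X < _)%E](_ : (fun i : T => _) =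
    (fun i => if i \in A then `|nrm (f i)|%:E else 0%E)); last first.
    by apply/funext => i; case: ifP => //; rewrite nrm0 normr0.
  by rewrite -esum_mkcond.
rewrite !setTI [X in _ + X]csum0 ?addr0; last first.
  by move=> i nAi; rewrite memNset.
by apply: eq_csum => i Ai; rewrite mem_set.
Qed.

Lemma csummable_mkcond T (A : set T) (f : T -> C) : csummable A f <->
  csummable setT (fun x => if x \in A then f x else 0).
Proof.
rewrite /csummable /rsummable [in X in _ <-> is_true (X < _)%E](_ : (fun i : T => _) =
    (fun i => if i \in A then `|nrm (f i)|%:E else 0%E)); last first.
  by apply/funext => i; case: ifP => //; rewrite nrm0 normr0.
by rewrite -esum_mkcond.
Qed.

Lemma csum_support T (A B : set T) (f : T -> C) : A `<=` B ->
  (forall x, B x -> ~ A x -> f x = 0) -> csummable A f ->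
  csummable B f /\ csum B f = csum A f.
Proof.
move=> AB f0 sf.
have E : (fun x => if x \in B then f x else 0) = (fun x => if x \in A then f x else 0).
  apply/funext => x; case: ifPn => [/set_mem Bx|/negP nB]; case: ifPn => //.
    by move=> /negP nA; apply: f0 => // /mem_set.
  by move=> /set_mem/AB/mem_set.
have sB : csummable B f by apply/csummable_mkcond; rewrite E -csummable_mkcond.
by split=> //; rewrite csum_mkcond// E -csum_mkcond.
Qed.

Lemma csum_extend T (A B : set T) (f g : T -> C) : A `<=` B ->
  (forall x, A x -> f x = g x) -> (forall x, B x -> ~ A x -> g x = 0) ->
  csummable A f -> csum A f = csum B g.
Proof.
move=> AB fg g0 sf; rewrite (eq_csum fg); apply/esym.
by apply: (csum_support AB g0 _).2; apply: eq_csummable sf.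
Qed.

Lemma csum_nat_finite N (f : nat -> C) : (forall n, (N <= n)%N -> f n = 0) ->
  csummable setT f /\ csum setT f = \sum_(i < N) f i.
Proof.
move=> f0; rewrite -csum_II; apply: csum_support => //.
- by move=> x _ /= /negP; rewrite -leqNgt => /f0.
- exact: csummable_finite.
Qed.

Lemma csum_split_nat N (f : nat -> C) : csummable setT f ->
  csum setT f = \sum_(i < N) f i + csum setT (fun n => f (N + n)%N).
Proof.
move=> sf; rewrite (csumID `I_N)// setTI csum_II setTI; congr (_ + _).
apply: csum_reindex; split.
- by move=> n _ /=; apply/negP; rewrite -leqNgt leq_addr.
- by move=> m n _ _ /addnI.
- by move=> n /= /negP; rewrite -leqNgt => Nn; exists (n - N)%N; rewrite ?subnKC.
Qed.

Lemma csummable_shift N (f : nat -> C) : csummable setT f ->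
  csummable setT (fun n => f (N + n)%N).
Proof.
move=> sf; have b : set_bij setT (~` `I_N) (fun n => (N + n)%N).
  split.
  - by move=> n _ /=; apply/negP; rewrite -leqNgt leq_addr.
  - by move=> m n _ _ /addnI.
  - by move=> n /= /negP; rewrite -leqNgt => Nn; exists (n - N)%N; rewrite ?subnKC.
apply/(csummable_reindex f b); exact: csummable_sub sf.
Qed.

Lemma rsummable_bounded (u : nat -> R) (M : R) :
  (forall n, \sum_(0 <= i < n) `|u i| <= M) -> rsummable setT u.
Proof.
move=> uM; rewrite /rsummable -nneseries_esumT//.
apply: (@le_lt_trans _ _ M%:E); last exact: ltry.
apply: lime_le; first by apply: is_cvg_nneseries.
by apply: nearW => n; rewrite sumEFin lee_fin.
Qed.

Lemma rsummable_geo (r : R) : 0 <= r < 1 -> rsummable setT (fun n => r ^+ n).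
Proof.
move=> /andP[r0 r1]; apply: (@rsummable_bounded _ (1 - r)^-1) => n.
rewrite (eq_bigr (fun i => r ^+ i)); last by move=> i _; rewrite ger0_norm// exprn_ge0.
have r1' : 0 < 1 - r by rewrite subr_gt0.
rewrite -[leRHS]mul1r ler_pdivlMr// big_mkord mulrC -opprB mulNr -subrX1 opprB.
by rewrite gerBl exprn_ge0.
Qed.

(** The [n] powers [r ^+ i] with [i < n] are all at least [r ^+ n], and their sum is at most
    [(1 - r)^-1]. *)
Lemma natmul_geo_le (r : R) n : 0 <= r < 1 -> n%:R * r ^+ n <= (1 - r)^-1.
Proof.
move=> /andP[r0 r1]; have r1' : 0 < 1 - r by rewrite subr_gt0.
rewrite -[leRHS]mul1r ler_pdivlMr//.
apply: (@le_trans _ _ ((\sum_(i < n) r ^+ i) * (1 - r))).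
  rewrite ler_wpM2r// ?(ltW r1')// mulr_natl -[X in _ *+ X]card_ord -sumr_const.
  apply: ler_sum => i _; apply: ler_wiXn2l => //; first exact: ltW.
  exact: ltnW.
by rewrite mulrC -opprB mulNr -subrX1 opprB gerBl exprn_ge0.
Qed.

Lemma rsummable_polygeo j (r : R) : 0 <= r < 1 ->
  rsummable setT (fun n => n%:R ^+ j * r ^+ n).
Proof.
elim: j r => [|j IH] r r01.
  by apply: rsummable_le (rsummable_geo r01) => n _;
    rewrite mul1r ger0_norm// exprn_ge0//; case/andP: r01.
have /andP[r0 r1] := r01.
(* An intermediate ratio: [n * (r / s) ^+ n] is bounded, so one power of [n] is paid for by passing
   from [r] to [s]. *)
pose s := (1 + r) / 2; have s0 : 0 < s by rewrite /s; lra.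
have s1 : s < 1 by rewrite /s; lra.
have rs : 0 <= r / s < 1 by rewrite divr_ge0 ?(ltW s0)//= ltr_pdivrMr// /s; lra.
have := rsummableZ ((1 - r / s)^-1) (IH s _); rewrite (ltW s0) s1 => /(_ isT).
apply: rsummable_le => n _; rewrite ger0_norm; last first.
  by rewrite mulr_ge0 ?exprn_ge0.
rewrite exprSr -mulrA [leRHS]mulrCA; apply: ler_wpM2l; first exact: exprn_ge0.
have -> : n%:R * r ^+ n = (n%:R * (r / s) ^+ n) * s ^+ n.
  by rewrite -mulrA -exprMn divfK ?gt_eqF.
by rewrite ler_wpM2r ?exprn_ge0 ?(ltW s0)// natmul_geo_le.
Qed.

Lemma csummable_geo (z : C) : nrm z < 1 -> csummable setT (fun n => z ^+ n).
Proof.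
move=> z1; apply: csummable_le (rsummable_geo (r := nrm z) _).
  by move=> n _; rewrite nrmX.
by rewrite nrm_ge0.
Qed.

Lemma nrm_lt1_neq0 (z : C) : nrm z < 1 -> 1 - z != 0.
Proof.
by rewrite subr_eq0; apply: contraTneq => <-; rewrite nrm1 ltxx.
Qed.

Lemma csum_geo (z : C) : nrm z < 1 -> csum setT (fun n => z ^+ n) = (1 - z)^-1.
Proof.
move=> z1; have sz := csummable_geo z1; have z1' := nrm_lt1_neq0 z1.
apply: (mulIf z1'); rewrite mulVf// mulrBr mulr1 {1}(csum_split_nat 1 sz).
rewrite big_ord1 expr0 -csumZr//.
rewrite (eq_csum (g := fun i => z ^+ i * z)) ?addrK// => i _.
by rewrite add1n exprSr.
Qed.

Definition pser (a : nat -> C) (q : C) : C := csum setT (fun n => a n * q ^+ n).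
Definition pser_cv (a : nat -> C) (q : C) : Prop :=
  csummable setT (fun n => a n * q ^+ n).
(** The Cauchy product, i.e. multiplication of formal power series. *)
Definition cprod (a b : nat -> C) (n : nat) : C :=
  \sum_(i < n.+1) a i * b (n - i)%N.

Lemma pser_cv_le (a : nat -> C) (q p : C) : nrm q <= nrm p ->
  pser_cv a p -> pser_cv a q.
Proof.
move=> qp; apply: csummable_le => n _; rewrite !nrmM ler_wpM2l ?nrm_ge0//.
by rewrite !nrmX lerXn2r ?nnegrE ?nrm_ge0.
Qed.

Lemma pser_cv_poly (a : nat -> C) (q : C) M j :
  (forall n, nrm (a n) <= M * n%:R ^+ j) -> nrm q < 1 -> pser_cv a q.
Proof.
move=> aM q1; have q01 : 0 <= nrm q < 1 by rewrite nrm_ge0.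
apply: csummable_le (rsummableZ M (rsummable_polygeo j q01)) => n _.
by rewrite nrmM nrmX mulrA ler_wpM2r// exprn_ge0 ?nrm_ge0.
Qed.

Lemma pser_mul a b q : pser_cv a q -> pser_cv b q ->
  pser_cv (cprod a b) q /\ pser a q * pser b q = pser (cprod a b) q.
Proof.
move=> sa sb; rewrite /pser /pser_cv.
pose f i j := a i * q ^+ i * (b j * q ^+ j).
have b1 : set_bij (setT `*`` fun n => `I_n.+1) (setT `*`` fun=> setT)
    (fun k : nat * nat => (k.2, k.1 - k.2)%N).
  split.
  - by move=> [n i] [].
  - move=> [n i] [m j] /set_mem[_ /= Hi] /set_mem[_ /= Hj] [ij H].
    move: Hi; rewrite {}ij in H * => Hi.
    by move: Hi Hj H; rewrite !ltnS => Hi Hj H; congr (_, _); rewrite -(subnK Hi) -(subnK Hj) H.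
  - move=> [i j] _; exists (i + j, i)%N; last by rewrite /= addKn.
    by split => //=; rewrite ltnS leq_addr.
have sf := csummable_mul sa sb.
have sf' : csummable (setT `*`` fun n => `I_n.+1)
    (fun k : nat * nat => f k.2 (k.1 - k.2)%N).
  exact/(csummable_reindex (fun k => f k.1 k.2) b1).
have E n : csum `I_n.+1 (fun i => f i (n - i)%N) = cprod a b n * q ^+ n.
  rewrite csum_II /cprod mulr_suml; apply: eq_bigr => i _.
  by rewrite /f mulrACA -exprD subnKC// -ltnS.
split.
  have := csummable_outer (f := fun n i => f i (n - i)%N) sf'.
  by apply: eq_csummable => n _; rewrite E.
rewrite -csum_mul// (csum_reindex (fun k => f k.1 k.2) b1).
rewrite (csum_pair (f := fun n i => f i (n - i)%N))//.
by apply: eq_csum => n _; rewrite E.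
Qed.

Lemma pser_head a q : pser_cv a q ->
  pser_cv (fun n => a n.+1) q /\ pser a q = a 0%N + q * pser (fun n => a n.+1) q.
Proof.
move=> sa; have s1 : pser_cv (fun n => a n.+1) q.
  have [->|q0] := eqVneq q 0.
    apply: (csum_nat_finite (N := 1) _).1 => -[//|n] _.
    by rewrite expr0n mulr0.
  apply: eq_csummable (csummableZ q^-1 (csummable_shift 1 sa)) => n _.
  by rewrite add1n exprS mulrCA mulKf.
split=> //; rewrite /pser (csum_split_nat 1 sa) big_ord1 expr0 mulr1.
congr (_ + _); rewrite -csumZ//; apply: eq_csum => n _.
by rewrite add1n exprS mulrCA.
Qed.

Lemma nrm_pser_le a (q : C) (d : R) : pser_cv a d%:C -> nrm q <= d ->
  nrm (pser a q) <= rsum setT (fun n => nrm (a n) * d ^+ n).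
Proof.
move=> sa qd; have d0 : 0 <= d by apply: le_trans qd; exact: nrm_ge0.
have dE : nrm d%:C = d by rewrite nrm_real ger0_norm.
have sq : pser_cv a q by apply: pser_cv_le sa; rewrite dE.
apply: le_trans (nrm_csum_le sq) _; apply: le_rsum => //.
  apply: rsummable_le sa => n _; rewrite nrmM nrmX dE ger0_norm//.
  by rewrite mulr_ge0 ?nrm_ge0 ?exprn_ge0.
by move=> n _; rewrite nrmM nrmX ler_wpM2l ?nrm_ge0// lerXn2r ?nnegrE ?nrm_ge0.
Qed.

Lemma pser_eq0 (c : nat -> C) (d : R) : 0 < d -> pser_cv c d%:C ->
  (forall x : R, 0 < x -> x < d -> pser c x%:C = 0) -> forall n, c n = 0.
Proof.
move: c => c' d0; have H c : pser_cv c d%:C ->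
    (forall x : R, 0 < x -> x < d -> pser c x%:C = 0) -> c 0%N = 0.
  move=> sc c0; apply/eqP; apply: contraT; rewrite -nrm_gt0 => cp.
  pose M := rsum setT (fun n => nrm (c n.+1) * d ^+ n).
  have M0 : 0 <= M.
    apply: le_trans (nrm_pser_le (q := 0) (pser_head sc).1 _).
      exact: nrm_ge0.
    by rewrite nrm0 ltW.
  have M1 : 0 < M + 1 by lra.
  (* As [M] bounds the remaining series, vanishing at [x] gives [nrm (c 0) <= x * M]; this
     contradicts [x * (M + 1) <= nrm (c 0)]. *)
  pose x := Num.min (d / 2) (nrm (c 0%N) / (M + 1)).
  have x0 : 0 < x by rewrite lt_min !divr_gt0.
  have xd : x < d by rewrite gt_min ltr_pdivrMr//; apply/orP; left; lra.
  have sx : pser_cv c x%:C.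
    by apply: pser_cv_le sc; rewrite !nrm_real !gtr0_norm// ltW.
  have := c0 x x0 xd; rewrite (pser_head sx).2 => /eqP; rewrite addr_eq0 => /eqP cE.
  have : nrm (c 0%N) <= x * M.
    rewrite cE nrmN nrmM nrm_real gtr0_norm// ler_wpM2l ?(ltW x0)//.
    by apply: nrm_pser_le (pser_head sc).1 _; rewrite nrm_real gtr0_norm// ltW.
  have : x * (M + 1) <= nrm (c 0%N).
    by rewrite -ler_pdivlMr// ge_min lexx orbT.
  by rewrite mulrDr mulr1; lra.
move=> + + n; elim: n c' => [|n IH] c sc c0; first exact: H.
  apply: (IH (fun n => c n.+1)); first exact: (pser_head sc).1.
  have c00 := H c sc c0.
  move=> x x0 xd; have := c0 x x0 xd.
  have sx : pser_cv c x%:C.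
    by apply: pser_cv_le sc; rewrite !nrm_real !gtr0_norm// ltW.
  rewrite (pser_head sx).2 c00 add0r => /eqP; rewrite mulf_eq0 => /orP[|/eqP//].
  by rewrite -nrm_eq0 nrm_real gtr0_norm// gt_eqF.
Qed.

(** Turns an identity of functions on a real segment into identities of Taylor coefficients;
    Lipschitz' and Euler's formulas are obtained in this way. *)
Lemma pser_uniq (a b : nat -> C) (d : R) : 0 < d ->
  pser_cv a d%:C -> pser_cv b d%:C ->
  (forall x : R, 0 < x -> x < d -> pser a x%:C = pser b x%:C) -> forall n, a n = b n.
Proof.
move=> d0 sa sb ab n; apply/eqP; rewrite -subr_eq0; apply/eqP.
have cvd (e : nat -> C) (x : R) : pser_cv e d%:C -> 0 < x -> x < d -> pser_cv e x%:C.
  by move=> se x0 xd; apply: pser_cv_le se; rewrite !nrm_real !gtr0_norm// ltW.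
apply: (@pser_eq0 (fun n => a n - b n) d d0).
  by apply: eq_csummable (csummableB sa sb) => m _; rewrite mulrBl.
move=> x x0 xd; rewrite /pser (eq_csum (g := fun n => a n * x%:C ^+ n - b n * x%:C ^+ n)).
  rewrite csumB; [|exact: cvd|exact: cvd].
  by apply/eqP; rewrite subr_eq0; apply/eqP; exact: ab.
by move=> m _; rewrite mulrBl.
Qed.

End MoreSums.

(** * Liouville's substitutions *)

Lemma can_set_bij (T T' : Type) (A : set T) (B : set T') (f : T -> T') (g : T' -> T) :
  (forall x, A x -> B (f x)) -> (forall y, B y -> A (g y)) ->
  (forall x, A x -> g (f x) = x) -> (forall y, B y -> f (g y) = y) ->
  set_bij A B f.
Proof.
move=> fB gA gf fg; split; first by move=> x /fB.
- by move=> x y /set_mem Ax /set_mem Ay fxy; rewrite -(gf x)// fxy gf.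
- by move=> y By; exists (g y); [exact: gA|exact: fg].
Qed.

Definition positive_pairs : set (nat * nat) := [set p | (0 < p.1)%N /\ (0 < p.2)%N].

Definition quadruple : Type := ((nat * nat) * (nat * nat))%type.

(* The two substitutions of Liouville's method on solutions of [a x + b y = n],
   with [k = ((a, x), (b, y))]. *)
Definition liouville_sub (k : quadruple) : quadruple :=
  let: ((a, x), (b, y)) := k in
  if (a < b)%N then ((a, x + y), (b - a, y))%N else ((b, x + y), (a - b, x))%N.

Definition liouville_add (k : quadruple) : quadruple :=
  let: ((a, x), (b, y)) := k in
  if (y < x)%N then ((a, x - y), (a + b, y))%N else ((b, y - x), (a + b, x))%N.

Definition quad_value (k : quadruple) : nat := (k.1.1 * k.1.2 + k.2.1 * k.2.2)%N.
Definition positive_quads : set quadruple := positive_pairs `*`` fun=> positive_pairs.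

Lemma quad_value_sub (k : quadruple) : k.1.1 != k.2.1 -> quad_value (liouville_sub k) = quad_value k.
Proof.
by case: k => [[a x] [b y]] /= ab; rewrite /quad_value; case: ifP => /= ?; nia.
Qed.

Lemma quad_value_add (k : quadruple) : quad_value (liouville_add k) = quad_value k.
Proof.
by case: k => [[a x] [b y]] /=; rewrite /quad_value; case: ifP => /= ?; nia.
Qed.

Definition parity_quads : set quadruple := [set k | [/\ positive_quads k, odd k.1.2 & ~~ odd k.2.2]].
Definition odd_left_quads : set quadruple := [set k | positive_quads k /\ odd k.1.2].

(** As [x] is odd and [y] even, the last entry of the image is even exactly when the branch [a < b]
    was taken: its parity selects the inverse branch. *)
Lemma bij_liouville_sub : set_bij (parity_quads `&` [set k | k.1.1 != k.2.1])
  (odd_left_quads `&` [set k | (k.2.2 < k.1.2)%N]) liouville_sub.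
Proof.
apply: (@can_set_bij _ _ _ _ _ (fun k : quadruple => let: ((A, X), (B, Y)) := k in
  if odd Y then ((A + B, Y), (A, X - Y))%N else ((A, X - Y), (A + B, Y))%N)).
- move=> [[a x] [b y]] [[[[/= ? ?] [/= ? ?]] ? ?] /= ?].
  by case: ifP => /= ?; (split; [split; [split; split => /=|]|]) => /=; lia.
- move=> [[a x] [b y]] [[[[/= ? ?] [/= ? ?]] ?] /= ?].
  by case: ifP => /= ?; (split; [split; [split; split => /=| |]|]) => /=; lia.
- move=> [[a x] [b y]] [[[[/= ? ?] [/= ? ?]] ? ?] /= ?].
  by case: ifP => /= ?; case: ifP => /= ?; (try by exfalso; lia); congr ((_, _), (_, _)); lia.
- move=> [[a x] [b y]] [[[[/= ? ?] [/= ? ?]] ?] /= ?].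
  by case: ifP => /= ?; case: ifP => /= ?; (try by exfalso; lia); congr ((_, _), (_, _)); lia.
Qed.

(** Opposite parities exclude [x = y], and again the parity of the last entry tells the branches
    apart. *)
Lemma bij_liouville_add : set_bij parity_quads (odd_left_quads `&` [set k | (k.1.1 < k.2.1)%N]) liouville_add.
Proof.
apply: (@can_set_bij _ _ _ _ _ (fun k : quadruple => let: ((A, X), (B, Y)) := k in
  if odd Y then ((B - A, Y), (A, X + Y))%N else ((A, X + Y), (B - A, Y))%N)).
- move=> [[a x] [b y]] [[[/= ? ?] [/= ? ?]] /= ? ?].
  by case: ifP => /= ?; (split; [split; [split; split => /=|]|]) => /=; lia.
- move=> [[a x] [b y]] [[[[/= ? ?] [/= ? ?]] ?] /= ?].
  by case: ifP => /= ?; (split; [split; split => /=| |]) => /=; lia.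
- move=> [[a x] [b y]] [[[/= ? ?] [/= ? ?]] /= ? ?].
  by case: ifP => /= ?; case: ifP => /= ?; (try by exfalso; lia); congr ((_, _), (_, _)); lia.
- move=> [[a x] [b y]] [[[[/= ? ?] [/= ? ?]] ?] /= ?].
  by case: ifP => /= ?; case: ifP => /= ?; (try by exfalso; lia); congr ((_, _), (_, _)); lia.
Qed.

Definition all_odd_quads : set quadruple :=
  [set k | positive_quads k /\ [/\ odd k.1.1, odd k.1.2, odd k.2.1 & odd k.2.2]].
Definition odd_even_quads : set quadruple :=
  [set k | positive_quads k /\ [/\ odd k.1.1, ~~ odd k.1.2, ~~ odd k.2.1 & odd k.2.2]].

Ltac quadruple_mem := split; [split; [split; split => /=|split => /=]|] => /=; lia.
Ltac quadruple_eq := case: ifP => /= ?; (try by exfalso; lia); congr ((_, _), (_, _)); lia.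

(** When all four entries are odd, the two branches of each substitution have the same image; hence
    one bijection for each branch. *)
Lemma bij_liouville_sub_left : set_bij (all_odd_quads `&` [set k | (k.1.1 < k.2.1)%N])
  (odd_even_quads `&` [set k | (k.2.2 < k.1.2)%N]) liouville_sub.
Proof.
apply: (@can_set_bij _ _ _ _ _ (fun k : quadruple => let: ((A, X), (B, Y)) := k in
  ((A, X - Y), (A + B, Y))%N)).
- by move=> [[a x] [b y]] [[[[/= ? ?] [/= ? ?]] [? ? ? ?]] /= ab]; rewrite ab; quadruple_mem.
- by move=> [[a x] [b y]] [[[[/= ? ?] [/= ? ?]] [? ? ? ?]] /= ?]; quadruple_mem.
- by move=> [[a x] [b y]] [[[[/= ? ?] [/= ? ?]] [? ? ? ?]] /= ab]; rewrite ab; congr ((_, _), (_, _)); lia.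
- by move=> [[a x] [b y]] [[[[/= ? ?] [/= ? ?]] [? ? ? ?]] /= ?]; quadruple_eq.
Qed.

Lemma bij_liouville_sub_right : set_bij (all_odd_quads `&` [set k | (k.2.1 < k.1.1)%N])
  (odd_even_quads `&` [set k | (k.2.2 < k.1.2)%N]) liouville_sub.
Proof.
apply: (@can_set_bij _ _ _ _ _ (fun k : quadruple => let: ((A, X), (B, Y)) := k in
  ((A + B, Y), (A, X - Y))%N)).
- by move=> [[a x] [b y]] [[[[/= ? ?] [/= ? ?]] [? ? ? ?]] /= ab]; rewrite ltnNge (ltnW ab); quadruple_mem.
- by move=> [[a x] [b y]] [[[[/= ? ?] [/= ? ?]] [? ? ? ?]] /= ?]; quadruple_mem.
- by move=> [[a x] [b y]] [[[[/= ? ?] [/= ? ?]] [? ? ? ?]] /= ab]; rewrite ltnNge (ltnW ab); congr ((_, _), (_, _)); lia.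
- by move=> [[a x] [b y]] [[[[/= ? ?] [/= ? ?]] [? ? ? ?]] /= ?]; quadruple_eq.
Qed.

Lemma bij_liouville_add_left : set_bij (all_odd_quads `&` [set k | (k.2.2 < k.1.2)%N])
  (odd_even_quads `&` [set k | (k.1.1 < k.2.1)%N]) liouville_add.
Proof.
apply: (@can_set_bij _ _ _ _ _ (fun k : quadruple => let: ((A, X), (B, Y)) := k in
  ((A, X + Y), (B - A, Y))%N)).
- by move=> [[a x] [b y]] [[[[/= ? ?] [/= ? ?]] [? ? ? ?]] /= ab]; rewrite ab; quadruple_mem.
- by move=> [[a x] [b y]] [[[[/= ? ?] [/= ? ?]] [? ? ? ?]] /= ?]; quadruple_mem.
- by move=> [[a x] [b y]] [[[[/= ? ?] [/= ? ?]] [? ? ? ?]] /= ab]; rewrite ab; congr ((_, _), (_, _)); lia.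
- by move=> [[a x] [b y]] [[[[/= ? ?] [/= ? ?]] [? ? ? ?]] /= ?]; quadruple_eq.
Qed.

Lemma bij_liouville_add_right : set_bij (all_odd_quads `&` [set k | (k.1.2 < k.2.2)%N])
  (odd_even_quads `&` [set k | (k.1.1 < k.2.1)%N]) liouville_add.
Proof.
apply: (@can_set_bij _ _ _ _ _ (fun k : quadruple => let: ((A, X), (B, Y)) := k in
  ((B - A, Y), (A, X + Y))%N)).
- by move=> [[a x] [b y]] [[[[/= ? ?] [/= ? ?]] [? ? ? ?]] /= ab]; rewrite ltnNge (ltnW ab); quadruple_mem.
- by move=> [[a x] [b y]] [[[[/= ? ?] [/= ? ?]] [? ? ? ?]] /= ?]; quadruple_mem.
- by move=> [[a x] [b y]] [[[[/= ? ?] [/= ? ?]] [? ? ? ?]] /= ab]; rewrite ltnNge (ltnW ab); congr ((_, _), (_, _)); lia.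
- by move=> [[a x] [b y]] [[[[/= ? ?] [/= ? ?]] [? ? ? ?]] /= ?]; quadruple_eq.
Qed.

(* Iterates the subtraction [A - B] until [A < B], as in Euclid's algorithm. *)
Definition liouville_mod (k : quadruple) : quadruple :=
  let: ((A, X), (B, Y)) := k in ((A %% B, X), (B, Y + X * (A %/ B)))%N.

Lemma quad_value_mod (k : quadruple) : quad_value (liouville_mod k) = quad_value k.
Proof.
case: k => [[A X] [B Y]]; rewrite /quad_value/= [in RHS](divn_eq A B); ring.
Qed.

(** The quotient [t] of [A] by [B] is not lost: as [Y < X], it is also the quotient of the new entry
    [Y + X * t] by [X]. The inverse is the same operation with the pair [(Y, X)] in the role of
    [(A, B)]. *)
Lemma bij_liouville_mod : set_bij (odd_even_quads `&` [set k | (k.2.2 < k.1.2)%N])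
  (odd_even_quads `&` [set k | (k.1.1 < k.2.1)%N]) liouville_mod.
Proof.
apply: (@can_set_bij _ _ _ _ _ (fun k : quadruple => let: ((A, X), (B, Y)) := k in
  ((A + B * (Y %/ X), X), (B, Y %% X))%N)).
- move=> [[A X] [B Y]] [[[[/= ? ?] [/= ? ?]] [? ? ? ?]] /= ?].
  have := divn_eq A B; have : (A %% B < B)%N by rewrite ltn_pmod.
  set r := (A %% B)%N; set t := (A %/ B)%N => rB AE.
  (* [B] is even, so the remainder has the parity of [A], which is odd. *)
  have ro : odd r by move: AE; lia.
  by quadruple_mem.
- move=> [[A X] [B Y]] [[[[/= ? ?] [/= ? ?]] [? ? ? ?]] /= ?].
  have := divn_eq Y X; have : (Y %% X < X)%N by rewrite ltn_pmod.
  set r := (Y %% X)%N; set t := (Y %/ X)%N => rB AE.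
  have ro : odd r by move: AE; lia.
  by quadruple_mem.
- move=> [[A X] [B Y]] [[[[/= ? X0] [/= ? ?]] [? ? ? ?]] /= YX].
  rewrite [(Y + _)%N]addnC [(X * _)%N]mulnC divnMDl// modnMDl (divn_small YX) (modn_small YX) addn0.
  by congr ((_, _), (_, _)); rewrite addnC mulnC -divn_eq.
- move=> [[A X] [B Y]] [[[[/= ? X0] [/= B0 ?]] [? ? ? ?]] /= AB].
  rewrite [(A + _)%N]addnC [(B * _)%N]mulnC divnMDl// modnMDl (divn_small AB) (modn_small AB) addn0.
  by congr ((_, _), (_, _)); rewrite addnC mulnC -divn_eq.
Qed.

(** * Lambert series and weighted sums over quadruples *)

Section Lambert.
Context {R : realType}.
Local Notation C := R[i].

Definition lambert (g : nat -> nat -> C) (q : C) : C :=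
  csum setT (fun p : nat * nat => g p.1 p.2 * q ^+ (p.1 * p.2)).
Definition lambert_coef (g : nat -> nat -> C) (n : nat) : C :=
  \sum_(d < n.+1 | (0 < n)%N && (d %| n)%N) g d (n %/ d)%N.
(** The exponent [j.+1] forces [g] to vanish as soon as one index is 0, so that a sum over all pairs
    of naturals is a sum over positive pairs. *)
Definition lambert_bound (g : nat -> nat -> C) : Prop :=
  exists M j, forall a x, nrm (g a x) <= M * (a%:R ^+ j.+1 * x%:R ^+ j.+1).

(** From [a * x >= a + x - 1]. It separates the variables, so the double series is dominated by a
    product of two single ones. *)
Lemma pow_mul_le (s : R) a x : 0 < s < 1 -> (0 < a)%N -> (0 < x)%N ->
  s ^+ (a * x) <= s^-1 * (s ^+ a * s ^+ x).
Proof.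
move=> /andP[s0 s1] a0 x0; rewrite -exprD.
have -> : (a + x = (a + x).-1.+1)%N by lia.
rewrite exprS mulKf ?gt_eqF//; apply: ler_wiXn2l; [exact: ltW|exact: ltW|].
by nia.
Qed.

Lemma csummable_lambert g q : lambert_bound g -> nrm q < 1 ->
  csummable setT (fun p : nat * nat => g p.1 p.2 * q ^+ (p.1 * p.2)).
Proof.
move=> [M [j gM]] q1; pose s := (1 + nrm q) / 2.
have s0 : 0 < s by rewrite /s divr_gt0// ltr_wpDr ?nrm_ge0.
have s1 : s < 1 by rewrite /s ltr_pdivrMr// mul1r; lra.
have qs : nrm q <= s by rewrite /s; lra.
pose h (n : nat) : C := (n%:R ^+ j.+1 * s ^+ n)%:C.
have sh : csummable setT h.
  have : rsummable setT (fun n => n%:R ^+ j.+1 * s ^+ n).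
    by apply: rsummable_polygeo; rewrite (ltW s0).
  by apply: csummable_le => n _; rewrite nrm_real ger0_norm// mulr_ge0// ?exprn_ge0// ltW.
have sT : (setT `*`` fun=> setT) = setT :> set (nat * nat).
  by apply/seteqP; split.
have hE n : nrm (h n) = n%:R ^+ j.+1 * s ^+ n.
  by rewrite nrm_real ger0_norm// mulr_ge0// ?exprn_ge0// ltW.
have s0' : 0 <= s by rewrite ltW.
have := rsummableZ (`|M| * s^-1) (csummable_mul sh sh); rewrite sT.
apply: csummable_le => -[a x] _ /=; rewrite !nrmM nrmX !hE.
have [->|a0] := posnP a.
  have := gM 0%N x; rewrite expr0n/= mul0r mulr0 => g0.
  by rewrite mul0n !mul0r mulr0 expr0 mulr1.
have [->|x0] := posnP x.
  have := gM a 0%N; rewrite expr0n/= !mulr0 => g0.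
  by rewrite muln0 !mul0r !mulr0 expr0 mulr1.
apply: (@le_trans _ _ (`|M| * (a%:R ^+ j.+1 * x%:R ^+ j.+1) * s ^+ (a * x))).
  apply: ler_pM; rewrite ?nrm_ge0 ?exprn_ge0 ?nrm_ge0//.
    by apply: le_trans (gM a x) _; rewrite ler_wpM2r ?ler_norm// mulr_ge0 ?exprn_ge0.
  by rewrite lerXn2r ?nnegrE ?nrm_ge0// ltW.
rewrite (_ : _ * _ * (_ * _) = `|M| * (a%:R ^+ j.+1 * x%:R ^+ j.+1) *
  (s^-1 * (s ^+ a * s ^+ x))); last by ring.
by apply: ler_wpM2l; [rewrite !mulr_ge0 ?exprn_ge0|apply: pow_mul_le; rewrite ?s0].
Qed.

Lemma lambert_pser g q : lambert_bound g -> nrm q < 1 ->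
  pser_cv (lambert_coef g) q /\ lambert g q = pser (lambert_coef g) q.
Proof.
move=> gb q1; have sg := csummable_lambert gb q1.
have [s1 s2] := csum_fiber (fun p => p.1 * p.2)%N sg.
suff E n : csum (setT `&` [set x : nat * nat | (x.1 * x.2)%N = n])
     (fun p : nat * nat => g p.1 p.2 * q ^+ (p.1 * p.2)) = lambert_coef g n * q ^+ n.
  split; first by apply: eq_csummable s1 => n _; rewrite E.
  by rewrite /lambert s2; apply: eq_csum => n _; rewrite E.
have [->|n0] := posnP n.
  rewrite /lambert_coef big_pred0 ?mul0r; last by move=> i; rewrite ltnn.
  apply: csum0 => -[a x] [_ /= /eqP]; rewrite muln_eq0 => ax0.
  have [M [j gM]] := gb; have := gM a x.
  rewrite (_ : M * _ = 0); last first.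
    by case/orP: ax0 => /eqP->; rewrite expr0n/= ?mul0r ?mulr0.
  by move=> H; rewrite (_ : g a x = 0) ?mul0r//; apply/eqP; rewrite -nrm_eq0 eq_le H nrm_ge0.
have b : set_bij (`I_n.+1 `&` [set d | d %| n]%N)
   (setT `&` [set x : nat * nat | (x.1 * x.2)%N = n]) (fun d => (d, n %/ d)%N).
  apply: (@can_set_bij _ _ _ _ _ fst) => //=.
  - by move=> d [/= _ dn]; split => //=; rewrite mulnC divnK.
  - move=> [a x] [_ /= axn]; split => /=; last by rewrite -axn dvdn_mulr.
    by rewrite ltnS -axn; apply: leq_pmulr; move: n0; rewrite -axn; lia.
  - move=> [a x] [_ /= axn]; congr (_, _); rewrite -axn mulKn//.
    by move: n0; rewrite -axn; lia.
rewrite (csum_reindex _ b) /comp/=.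
pose f' d := if (d %| n)%N then g d (n %/ d)%N * q ^+ n else 0.
have [|||_ E] := @csum_support _ _ (`I_n.+1 `&` [set d | d %| n]%N) `I_n.+1 f'.
- by move=> d [].
- by move=> d dI dn; rewrite /f' ifF//; apply/negP => dn'; apply: dn.
- by apply: csummable_finite; apply: finite_setIl; exact: finite_II.
rewrite (eq_csum (g := f')); last first.
  by move=> d [_ /= dn]; rewrite /f' dn mulnC divnK.
transitivity (csum `I_n.+1 f'); first exact/esym.
rewrite csum_II /lambert_coef mulr_suml [RHS]big_mkcond; apply: eq_bigr => i _.
by rewrite /f' n0.
Qed.

Lemma csum_geo1 (z : C) : nrm z < 1 ->
  csummable [set n | 0 < n]%N (fun n => z ^+ n) /\
  csum [set n | 0 < n]%N (fun n => z ^+ n) = z / (1 - z).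
Proof.
move=> z1; have sz := csummable_geo z1.
split; first exact: csummable_sub sz.
have b : set_bij setT [set n | 0 < n]%N S.
  by apply: (@can_set_bij _ _ _ _ _ predn) => // -[|n].
rewrite (csum_reindex _ b) -csum_geo// -csumZ//.
by apply: eq_csum => n _; rewrite /= exprS.
Qed.

Lemma csum_geo_finite (z : C) N : z != 1 -> (0 < N)%N ->
  csummable [set n | 0 < n < N]%N (fun n => z ^+ n) /\
  csum [set n | 0 < n < N]%N (fun n => z ^+ n) = (z - z ^+ N) / (1 - z).
Proof.
move=> z1 N0; have fs : finite_set [set n | 0 < n < N]%N.
  apply: (sub_finite_set (B := `I_N)) => [n /= /andP[]//|]; exact: finite_II.
split; first exact: csummable_finite.
case: N N0 fs => // N _ fs.
have b : set_bij `I_N [set n | 0 < n < N.+1]%N S.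
  apply: (@can_set_bij _ _ _ _ _ predn) => //=.
  by case.
  by case.
rewrite (csum_reindex _ b) csum_II.
have z1' : 1 - z != 0 by rewrite subr_eq0 eq_sym.
apply: (mulIf z1'); rewrite divfK// mulrC.
rewrite (eq_bigr (fun i : 'I_N => z * z ^+ i)); last by move=> i _; rewrite /= exprS.
by rewrite -mulr_sumr mulrCA -opprB mulNr -subrX1 opprB exprS mulrBr mulr1.
Qed.

Context (q : C) (q1 : nrm q < 1).

Definition quad_weight (F : nat -> C) (k : quadruple) : C := F k.2.1 * q ^+ quad_value k.

Lemma qX_lt1 n : (0 < n)%N -> nrm (q ^+ n) < 1.
Proof.
by move=> n0; rewrite nrmX exprn_ilt1 ?nrm_ge0// -lt0n.
Qed.

Lemma csummable_quadruple (G : quadruple -> C) :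
  (forall k, positive_quads k -> nrm (G k) <= 4 * (k.1.1%:R ^+ 2 * k.2.1%:R ^+ 2)) ->
  csummable positive_quads (fun k => G k * q ^+ quad_value k).
Proof.
move=> GM; pose g a x : C := a%:R ^+ 2 * x%:R ^+ 2.
have gE a x : nrm (g a x) = a%:R ^+ 2 * x%:R ^+ 2.
  by rewrite /g nrmM !nrmX !nrm_nat.
have gb : lambert_bound g by exists 1, 1%N => a x; rewrite mul1r gE.
have sg := csummable_sub (@subsetT _ positive_pairs) (csummable_lambert gb q1).
have := rsummableZ 4 (csummable_mul sg sg).
apply: csummable_le => -[[a x] [b y]] [[/= a0 x0] [/= b0 y0]].
rewrite nrmM /quad_value/= exprD [nrm (_ ^+ _ * _ ^+ _)]nrmM.
rewrite nrmM [nrm (g a x * _)]nrmM [nrm (g b y * _)]nrmM !gE !(@nrmX R q).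
have H := GM ((a, x), (b, y)) (conj (conj a0 x0) (conj b0 y0)).
apply: le_trans (ler_wpM2r _ H) _; first by rewrite mulr_ge0// exprn_ge0// nrm_ge0.
have x1 : 1 <= x%:R ^+ 2 :> R by rewrite exprn_ege1// ler1n.
have y1 : 1 <= y%:R ^+ 2 :> R by rewrite exprn_ege1// ler1n.
have xy1 : 1 <= x%:R ^+ 2 * y%:R ^+ 2 :> R.
  exact: mulr_ege1.
have aux (A B X Y Z W : R) : 0 <= A -> 0 <= B -> 0 <= Z -> 0 <= W ->
    1 <= X * Y -> 4 * (A * B) * (Z * W) <= 4 * (A * X * Z * (B * Y * W)).
  move=> A0 B0 Z0 W0 XY; rewrite (_ : 4 * (A * X * Z * (B * Y * W)) =
    4 * (A * B) * (Z * W) * (X * Y)); last by ring.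
  by rewrite ler_peMr// !mulr_ge0.
by apply: aux; rewrite ?exprn_ge0 ?nrm_ge0.
Qed.

Context (F : nat -> C) (F0 : F 0%N = 0).
Context (FM : forall n, nrm (F n) <= n%:R ^+ 2).

Definition dist_nat a b := (a - b + (b - a))%N.
(** The weights before the substitutions, which bring the argument of [F] into the single entry
    [k.2.1] of [quad_weight]. *)
Definition quad_weight_diff (k : quadruple) := F (dist_nat k.1.1 k.2.1) * q ^+ quad_value k.
Definition quad_weight_add (k : quadruple) := F (k.1.1 + k.2.1)%N * q ^+ quad_value k.

Lemma csummable_quad_weight_diff : csummable positive_quads quad_weight_diff.
Proof.
apply: csummable_quadruple => -[[a x] [b y]] [[/= a0 x0] [/= b0 y0]].
apply: le_trans (FM _) _; rewrite -!natrX -!natrM ler_nat /dist_nat; nia.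
Qed.

Lemma csummable_quad_weight_add : csummable positive_quads quad_weight_add.
Proof.
apply: csummable_quadruple => -[[a x] [b y]] [[/= a0 x0] [/= b0 y0]].
apply: le_trans (FM _) _; rewrite -!natrX -!natrM ler_nat; nia.
Qed.

Lemma csummable_quad_weight : csummable positive_quads (quad_weight F).
Proof.
apply: csummable_quadruple => -[[a x] [b y]] [[/= a0 x0] [/= b0 y0]].
apply: le_trans (FM _) _; rewrite -!natrX -!natrM ler_nat; nia.
Qed.

Lemma quad_weight_liouville_sub k : k.1.1 != k.2.1 -> quad_weight F (liouville_sub k) = quad_weight_diff k.
Proof.
move=> ab; rewrite /quad_weight /quad_weight_diff quad_value_sub//; congr (F _ * _).
by case: k ab => [[a x] [b y]] /= ab; rewrite /dist_nat; case: ifP => /= ?; lia.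
Qed.

Lemma quad_weight_liouville_add k : quad_weight F (liouville_add k) = quad_weight_add k.
Proof.
rewrite /quad_weight /quad_weight_add quad_value_add//; congr (F _ * _).
by case: k => [[a x] [b y]] /=; case: ifP => /= ?; lia.
Qed.

Lemma quad_weight_liouville_mod k : quad_weight F (liouville_mod k) = quad_weight F k.
Proof. by rewrite /quad_weight quad_value_mod; case: k => [[a x] [b y]]. Qed.

Lemma csum_liouville_sub : csum parity_quads quad_weight_diff = csum (odd_left_quads `&` [set k | (k.2.2 < k.1.2)%N]) (quad_weight F).
Proof.
have sD : csummable parity_quads quad_weight_diff by apply: csummable_sub csummable_quad_weight_diff => k [].
rewrite (csumID [set k | k.1.1 != k.2.1] sD) [X in _ + X]csum0 ?addr0; last first.
  move=> k [_ /= /negP]; rewrite negbK => /eqP ab.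
  by rewrite /quad_weight_diff /dist_nat ab subnn F0 mul0r.
rewrite (csum_reindex _ bij_liouville_sub); apply: eq_csum => k [_ /= ab].
by rewrite /= quad_weight_liouville_sub.
Qed.

Lemma csum_liouville_add : csum parity_quads quad_weight_add = csum (odd_left_quads `&` [set k | (k.1.1 < k.2.1)%N]) (quad_weight F).
Proof.
by rewrite (csum_reindex _ bij_liouville_add); apply: eq_csum => k _; rewrite /= quad_weight_liouville_add.
Qed.

(** Each sum splits into two triangles and a diagonal. Both triangles of the first are carried to
    the part [Y < X] of [odd_even_quads], both triangles of the second to the part [A < B], and
    [liouville_mod] identifies these parts. The diagonal [a = b] carries [F 0 = 0], so only the
    diagonal [x = y] of the second sum survives. *)
Lemma csum_liouville_all_odd :
  csum all_odd_quads quad_weight_diff - csum all_odd_quads quad_weight_add =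
  - csum (all_odd_quads `&` [set k | k.1.2 = k.2.2]) quad_weight_add.
Proof.
have sD : csummable all_odd_quads quad_weight_diff by apply: csummable_sub csummable_quad_weight_diff => k [].
have sA : csummable all_odd_quads quad_weight_add by apply: csummable_sub csummable_quad_weight_add => k [].
have sI (A B : set quadruple) f : csummable A f -> csummable (A `&` B) f.
  by apply: csummable_sub => k [].
rewrite (csumID [set k | (k.1.1 < k.2.1)%N] sD).
rewrite [X in _ + X - _](csumID [set k | (k.2.1 < k.1.1)%N]); last exact: sI.
rewrite [X in _ + (_ + X) - _]csum0 ?addr0; last first.
  move=> [[a x] [b y]] [[_ /= /negP H1] /= /negP H2].
  have ab : a = b by lia.
  by rewrite /quad_weight_diff /dist_nat/= ab subnn F0 mul0r.
rewrite (_ : all_odd_quads `&` _ `&` _ = all_odd_quads `&` [set k | (k.2.1 < k.1.1)%N]); last first.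
  apply/seteqP; split => -[[a x] [b y]]; first by move=> [[]].
  by move=> [? /= ?]; split => //; split => //=; apply/negP; lia.
rewrite (csumID [set k | (k.2.2 < k.1.2)%N] sA).
rewrite [X in _ - (_ + X)](csumID [set k | (k.1.2 < k.2.2)%N]); last exact: sI.
rewrite (_ : all_odd_quads `&` ~` [set k | (k.2.2 < k.1.2)%N] `&` [set k | (k.1.2 < k.2.2)%N] =
   all_odd_quads `&` [set k | (k.1.2 < k.2.2)%N]); last first.
  apply/seteqP; split => -[[a x] [b y]]; first by move=> [[]].
  by move=> [? /= ?]; split => //; split => //=; apply/negP; lia.
rewrite (_ : all_odd_quads `&` ~` [set k | (k.2.2 < k.1.2)%N] `&` ~` _ =
   all_odd_quads `&` [set k | (k.1.2 = k.2.2)%N]); last first.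
  apply/seteqP; split => -[[a x] [b y]].
    by move=> [[? /= /negP ?] /= /negP ?]; split => //=; lia.
  by move=> [? /= E]; split; first split; rewrite //= E ltnn.
have E1 : csum (all_odd_quads `&` [set k | (k.1.1 < k.2.1)%N]) quad_weight_diff =
    csum (odd_even_quads `&` [set k | (k.2.2 < k.1.2)%N]) (quad_weight F).
  rewrite (csum_reindex _ bij_liouville_sub_left); apply: eq_csum => k [_ /= ab].
  by rewrite /= quad_weight_liouville_sub// neq_ltn ab ?orbT.
have E2 : csum (all_odd_quads `&` [set k | (k.2.1 < k.1.1)%N]) quad_weight_diff =
    csum (odd_even_quads `&` [set k | (k.2.2 < k.1.2)%N]) (quad_weight F).
  rewrite (csum_reindex _ bij_liouville_sub_right); apply: eq_csum => k [_ /= ab].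
  by rewrite /= quad_weight_liouville_sub// neq_ltn ab ?orbT.
have E3 : csum (all_odd_quads `&` [set k | (k.2.2 < k.1.2)%N]) quad_weight_add =
    csum (odd_even_quads `&` [set k | (k.1.1 < k.2.1)%N]) (quad_weight F).
  by rewrite (csum_reindex _ bij_liouville_add_left); apply: eq_csum => k _; rewrite /= quad_weight_liouville_add.
have E4 : csum (all_odd_quads `&` [set k | (k.1.2 < k.2.2)%N]) quad_weight_add =
    csum (odd_even_quads `&` [set k | (k.1.1 < k.2.1)%N]) (quad_weight F).
  by rewrite (csum_reindex _ bij_liouville_add_right); apply: eq_csum => k _; rewrite /= quad_weight_liouville_add.
have E5 : csum (odd_even_quads `&` [set k | (k.1.1 < k.2.1)%N]) (quad_weight F) =
    csum (odd_even_quads `&` [set k | (k.2.2 < k.1.2)%N]) (quad_weight F).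
  by rewrite (csum_reindex _ bij_liouville_mod); apply: eq_csum => k _; rewrite /= quad_weight_liouville_mod.
rewrite E1 E2 E3 E4 E5; ring.
Qed.

End Lambert.

(** * Two quadratic identities between Lambert series *)

Section LambertIdentities.
Context {R : realType}.
Local Notation C := R[i].

Definition wt_odd (a x : nat) : C := if odd a && odd x then a%:R else 0.
Definition wt_cube (a x : nat) : C := if odd x then a%:R ^+ 3 else 0.
Definition wt_alt (a x : nat) : C := if odd x then (-1) ^+ a.+1 * a%:R else 0.
Definition wt_alt_even (a x : nat) : C :=
  if (0 < x)%N && ~~ odd x then (-1) ^+ a.+1 * a%:R else 0.
(** The factor [a * x] is the exponent, so this is [q d/dq] of the series with weight
    [(-1) ^+ a.+1 * a] at all positive [x]. *)
Definition wt_alt_sq (a x : nat) : C := (-1) ^+ a.+1 * a%:R ^+ 2 * x%:R.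

Lemma nrm_sgn n : nrm ((-1) ^+ n : C) = 1.
Proof. by rewrite nrmX nrmN nrm1 expr1n. Qed.

Lemma natX_le (m n j i : nat) : (i <= j)%N -> (0 < i)%N -> (m <= n)%N ->
  (m%:R ^+ i <= n%:R ^+ j :> R).
Proof.
move=> ij i0 mn; rewrite -!natrX ler_nat.
have [->|m0] := posnP m; first by rewrite exp0n.
apply: leq_trans (leq_pexp2l m0 ij) _.
by rewrite leq_exp2r//; lia.
Qed.

Lemma lambert_bound_le (g : nat -> nat -> C) (M : nat) j :
  (forall a x, nrm (g a x) <= M%:R * (a * x)%:R ^+ j.+1) -> lambert_bound g.
Proof. by move=> gM; exists M%:R, j => a x; rewrite -exprMn -natrM. Qed.

Lemma wt_odd_bound : lambert_bound wt_odd.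
Proof.
apply: (@lambert_bound_le _ 1 0) => a x; rewrite mul1r expr1 /wt_odd; case: ifP => [/andP[ao xo]|_].
  by rewrite nrm_nat ler_nat leq_pmulr// odd_gt0.
by rewrite nrm0.
Qed.

Lemma wt_cube_bound : lambert_bound wt_cube.
Proof.
apply: (@lambert_bound_le _ 1 2) => a x; rewrite mul1r /wt_cube; case: ifP => [xo|_].
  by rewrite nrmX nrm_nat natX_le// leq_pmulr// odd_gt0.
by rewrite nrm0 exprn_ge0.
Qed.

Lemma wt_alt_bound : lambert_bound wt_alt.
Proof.
apply: (@lambert_bound_le _ 1 0) => a x; rewrite mul1r expr1 /wt_alt; case: ifP => [xo|_].
  by rewrite nrmM nrm_sgn mul1r nrm_nat ler_nat leq_pmulr// odd_gt0.
by rewrite nrm0.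
Qed.

Lemma wt_alt_even_bound : lambert_bound wt_alt_even.
Proof.
apply: (@lambert_bound_le _ 1 0) => a x; rewrite mul1r expr1 /wt_alt_even; case: ifP => [/andP[x0 _]|_].
  by rewrite nrmM nrm_sgn mul1r nrm_nat ler_nat leq_pmulr.
by rewrite nrm0.
Qed.

Lemma wt_alt_sq_bound : lambert_bound wt_alt_sq.
Proof.
apply: (@lambert_bound_le _ 1 1) => a x.
rewrite mul1r /wt_alt_sq !nrmM nrm_sgn mul1r -nrmM -expr2 nrmX !nrm_nat natrM exprMn.
rewrite ler_wpM2l ?exprn_ge0// -natrX ler_nat; nia.
Qed.

Lemma lambert_boundZ c g : lambert_bound g -> lambert_bound (fun a x => c * g a x : C).
Proof.
move=> [M [i gM]]; exists (nrm c * M), i => a x.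
by rewrite nrmM -mulrA ler_wpM2l ?nrm_ge0.
Qed.

Lemma eq_lambert (g h : nat -> nat -> C) q : (forall a x, g a x = h a x) -> lambert g q = lambert h q.
Proof. by move=> gh; apply: eq_csum => p _; rewrite gh. Qed.

Context (q : C) (q1 : nrm q < 1).

Lemma lambertD g h : lambert_bound g -> lambert_bound h ->
  lambert (fun a x => g a x + h a x : C) q = lambert g q + lambert h q.
Proof.
move=> gb hb; rewrite /lambert -csumD; [|exact: csummable_lambert|exact: csummable_lambert].
by apply: eq_csum => p _; rewrite mulrDl.
Qed.

Lemma lambertZ c g : lambert_bound g -> lambert (fun a x => c * g a x : C) q = c * lambert g q.
Proof.
move=> gb; rewrite /lambert -csumZ; last exact: csummable_lambert.
by apply: eq_csum => p _; rewrite mulrA.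
Qed.

Lemma lambert_set q0 (q01 : nrm q0 < 1) g (A : set (nat * nat)) (f : nat * nat -> C) : lambert_bound g ->
  (forall p, A p -> g p.1 p.2 = f p) -> (forall p, ~ A p -> g p.1 p.2 = 0) ->
  csummable A (fun p => f p * q0 ^+ (p.1 * p.2)) /\
  lambert g q0 = csum A (fun p => f p * q0 ^+ (p.1 * p.2)).
Proof.
move=> gb wt_floor gN; have sg := csummable_lambert gb q01.
have sA := csummable_sub (@subsetT _ A) sg.
have E p : A p -> g p.1 p.2 * q0 ^+ (p.1 * p.2) = f p * q0 ^+ (p.1 * p.2).
  by move=> /wt_floor ->.
split; first by apply: eq_csummable sA.
rewrite -(eq_csum E) /lambert; apply: (csum_support _ _ sA).2 => // p _ /gN ->.
by rewrite mul0r.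
Qed.

(* The product of the two odd series is a sum over odd quadruples, with weight
   [a b = ((a + b)^2 - (a - b)^2) / 4]; Liouville's substitutions cancel
   everything but the diagonal [x = y]. *)
Lemma lambert_sq_identity : lambert wt_odd q ^+ 2 = lambert wt_cube (q ^+ 2).
Proof.
pose F n : C := n%:R ^+ 2.
have F0 : F 0%N = 0 by rewrite /F expr0n.
have FM n : nrm (F n) <= n%:R ^+ 2 by rewrite nrmX nrm_nat.
have := csum_liouville_all_odd q1 F0 FM.
have sD : csummable all_odd_quads (quad_weight_diff q F) by apply: csummable_sub (csummable_quad_weight_diff q1 FM) => k [].
have sA : csummable all_odd_quads (quad_weight_add q F) by apply: csummable_sub (csummable_quad_weight_add q1 FM) => k [].
pose O : set (nat * nat) := [set p | odd p.1 /\ odd p.2].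
have [sO LO] := @lambert_set q q1 wt_odd O (fun p => p.1%:R) wt_odd_bound
  (fun p => ltac:(by rewrite /wt_odd => -[-> ->]))
  (fun p => ltac:(by rewrite /wt_odd; case: ifP => // /andP[? ?] [])).
rewrite -csumB// (eq_csum (g := fun k : quadruple => (-4) *
   (k.1.1%:R * q ^+ (k.1.1 * k.1.2) * (k.2.1%:R * q ^+ (k.2.1 * k.2.2))))); last first.
  move=> [[a x] [b y]] _; rewrite /quad_weight_diff /quad_weight_add /quad_value /= exprD -mulrBl.
  have -> : F (dist_nat a b) - F (a + b)%N = - 4 * a%:R * b%:R.
    rewrite /F /dist_nat; case: (leqP a b) => ab.
      by rewrite (eqP ab) add0n natrB// natrD; ring.
    by rewrite (eqP (ltnW ab)) addn0 natrB ?(ltnW ab)// natrD; ring.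
  ring.
have -> : all_odd_quads = O `*`` fun=> O.
  apply/seteqP; split => -[[a x] [b y]].
    by move=> [_ [/= ? ? ? ?]].
  move=> [[/= ? ?] [/= ? ?]]; split; last by split.
  by split; split => //=; lia.
have sOO := csummable_mul sO sO.
have Z : csum (O `*`` fun=> O) (fun k : quadruple => (-4) *
   (k.1.1%:R * q ^+ (k.1.1 * k.1.2) * (k.2.1%:R * q ^+ (k.2.1 * k.2.2)))) =
   - 4 * lambert wt_odd q ^+ 2.
  by rewrite expr2 LO -(csum_mul sO sO) -csumZ.
rewrite {}Z.
pose V : set (nat * nat) := [set p | odd p.2].
have q21 : nrm (q ^+ 2) < 1 by apply: qX_lt1.
(* On the diagonal, [a + b = 2 * d] with [a] odd has [d] solutions, indexed by [i]. Each has weight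
   [F (2 * d) = 4 * d ^+ 2] and exponent [2 * d * x], whence the cube and the argument [q ^+ 2]. *)
have bb : set_bij (V `*`` fun p => `I_p.1) (O `*`` (fun=> O) `&` [set k | k.1.2 = k.2.2])
   (fun k => ((k.2.*2.+1, k.1.2), (k.1.1.*2 - k.2.*2.+1, k.1.2)))%N.
  apply: (@can_set_bij _ _ _ _ _ (fun k : quadruple => (((k.1.1 + k.2.1)./2, k.1.2), k.1.1./2))).
  - move=> [[d x] i] [/= xo id]; split => //=; split; split => //=; first by rewrite odd_double.
    by move: id => /=; lia.
  - by move=> [[a x] [b y]] [[[/= ? ?] [/= ? ?]] /= ?]; split => //=; lia.
  - move=> [[d x] i] [/= xo id]; congr ((_, _), _).
      by move: id => /=; lia.
    by lia.
  - by move=> [[a x] [b y]] [[[/= ? ?] [/= ? ?]] /= <-]; congr ((_, _), (_, _)); lia.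
have sI : csummable (O `*`` (fun=> O) `&` [set k | k.1.2 = k.2.2]) (quad_weight_add q F).
  apply: csummable_sub (csummable_quad_weight_add q1 FM) => -[[a x] [b y]] [[[/= ? ?] [/= ? ?]] _].
  by split; split => /=; lia.
rewrite (csum_reindex _ bb).
pose h (p : nat * nat) (i : nat) : C := 4 * (p.1%:R ^+ 2 * (q ^+ 2) ^+ (p.1 * p.2)).
have hE (k : nat * nat * nat) : (V `*`` fun p => `I_p.1) k ->
   (quad_weight_add q F \o (fun k => ((k.2.*2.+1, k.1.2), (k.1.1.*2 - k.2.*2.+1, k.1.2))%N)) k = h k.1 k.2.
  case: k => [[d x] i] [/= xo id]; rewrite /quad_weight_add /h /quad_value/=.
  have id' : (i < d)%N by [].
  rewrite -mulnDl (_ : (i.*2.+1 + (d.*2 - i.*2.+1) = 2 * d)%N); last by lia.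
  by rewrite -mulnA exprM /F natrM exprMn; ring.
rewrite (eq_csum hE) (csum_pair (f := h)); last first.
  apply: eq_csummable hE _; exact/(csummable_reindex _ bb).
rewrite (eq_csum (g := fun p => 4 * (p.1%:R ^+ 3 * (q ^+ 2) ^+ (p.1 * p.2)))); last first.
  move=> [d x] _; rewrite csum_II /h sumr_const card_ord -mulr_natl /=; ring.
have [sV EV] := @lambert_set (q ^+ 2) q21 wt_cube V (fun p => p.1%:R ^+ 3) wt_cube_bound
  (fun p => ltac:(by rewrite /wt_cube => ->)) (fun p => ltac:(by rewrite /wt_cube; case: ifP)).
rewrite csumZ// -EV mulNr => /oppr_inj; apply: mulfI.
by rewrite pnatr_eq0.
Qed.

Definition wt_floor (a x : nat) : C := (-1) ^+ a * a%:R ^+ 2 * ((x + odd x)./2)%:R.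
Definition wt_bin (a x : nat) : C :=
  if odd x then (-1) ^+ a * 'C(a.+1, 2)%:R else 0.

Lemma wt_floor_bound : lambert_bound wt_floor.
Proof.
apply: (@lambert_bound_le _ 1 1) => a x.
rewrite mul1r /wt_floor !nrmM nrm_sgn mul1r -nrmM -expr2 nrmX !nrm_nat natrM exprMn.
rewrite ler_wpM2l ?exprn_ge0// -natrX ler_nat; nia.
Qed.

Lemma wt_bin_bound : lambert_bound wt_bin.
Proof.
apply: (@lambert_bound_le _ 1 1) => a x; rewrite mul1r /wt_bin; case: ifP => [xo|_].
  rewrite nrmM nrm_sgn mul1r nrm_nat -natrX ler_nat bin2 /=.
  have x0 : (0 < x)%N by lia.
  apply: leq_trans (_ : a ^ 2 <= _)%N; last by rewrite leq_exp2r// leq_pmulr.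
  by case: a => // a; rewrite -divn2 leq_divLR ?dvdn2 ?oddM//=; [nia|lia].
by rewrite nrm0 exprn_ge0.
Qed.

Definition sgnsq (n : nat) : C := (-1) ^+ n * n%:R ^+ 2.

Lemma sum_sgnsq n : \sum_(i < n.+1) sgnsq i = (-1) ^+ n * 'C(n.+1, 2)%:R.
Proof.
elim: n => [|n IH]; first by rewrite big_ord1 /sgnsq expr0n !mulr0.
rewrite big_ord_recr /= IH /sgnsq exprS.
have -> : n.+1%:R ^+ 2 = ('C(n.+1, 2))%:R *+ 2 + (n.+1)%:R :> C.
  rewrite -natrX -mulrnA -natrD; congr (_%:R).
  rewrite muln2 bin2 /= -divn2; have := divnK (_ : 2 %| n.+1 * n)%N; rewrite muln2 => ->; first by nia.
  by rewrite dvdn2 oddM /=; lia.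
rewrite [in RHS](binS n.+1 1) bin1 natrD; ring.
Qed.

Lemma sum_odd n : \sum_(i < n.+1) (odd i)%:R = ((n + odd n)./2)%:R :> C.
Proof.
elim: n => [|n IH]; first by rewrite big_ord1.
rewrite big_ord_recr /= IH -natrD; congr (_%:R); lia.
Qed.

Lemma pser_sumE (a : nat -> C) (u : C) : nrm u < 1 -> pser_cv a u ->
  pser_cv (fun n => \sum_(i < n.+1) a i) u /\
  pser a u / (1 - u) = pser (fun n => \sum_(i < n.+1) a i) u.
Proof.
move=> u1 sa; have s1 : pser_cv (fun=> 1) u.
  by apply: eq_csummable (csummable_geo u1) => n _; rewrite mul1r.
have [sc E] := pser_mul sa s1.
have cE : cprod a (fun=> 1) = fun n => \sum_(i < n.+1) a i.
  by apply/funext => n; apply: eq_bigr => i _; rewrite mulr1.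
rewrite -cE; split=> //; rewrite -E; congr (_ * _).
rewrite -csum_geo//; by apply: eq_csum => n _; rewrite mul1r.
Qed.

Definition odd_pairs : set (nat * nat) := [set p | (0 < p.1)%N /\ odd p.2].

Lemma inv_1sub_le a : (0 < a)%N -> nrm (1 - q ^+ a)^-1 <= (1 - nrm q)^-1.
Proof.
move=> a0; have r1 : 0 < 1 - nrm q by rewrite subr_gt0.
rewrite nrmV; have H : 1 - nrm q <= nrm (1 - q ^+ a).
  have := ler_dist_nrm 1 (q ^+ a); rewrite nrm1 => /(le_trans (ler_norm _)).
  apply: le_trans; rewrite lerB// nrmX; case: a a0 => // a _.
  by rewrite exprS ler_piMr ?nrm_ge0// exprn_ile1 ?nrm_ge0// ltW.
by rewrite lef_pV2 ?posrE//; apply: lt_le_trans H.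
Qed.

Lemma csummable_odd_pairs : csummable odd_pairs (fun p => sgnsq p.1 * q ^+ (p.1 * p.2)).
Proof.
pose g a x := if odd x then sgnsq a else 0.
have gb : lambert_bound g.
  apply: (@lambert_bound_le _ 1 1) => a x; rewrite mul1r /g; case: ifP => [xo|_].
    by rewrite nrmM nrm_sgn mul1r nrmX nrm_nat natX_le// leq_pmulr// odd_gt0.
  by rewrite nrm0 exprn_ge0.
have sV := csummable_sub (@subsetT _ odd_pairs) (csummable_lambert gb q1).
by apply: eq_csummable sV => p [_ po]; rewrite /g po.
Qed.

Lemma csummable_odd_pairs_geo :
  csummable odd_pairs (fun p => sgnsq p.1 * q ^+ (p.1 * p.2) / (1 - q ^+ p.1)) /\
  csummable odd_pairs (fun p => sgnsq p.1 * q ^+ (p.1 * p.2) / (1 - q ^+ p.2)).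
Proof.
split; apply: csummable_le (rsummableZ (1 - nrm q)^-1 csummable_odd_pairs) => -[a x] [/= a0 xo];
  rewrite nrmM mulrC ler_wpM2r ?nrm_ge0// inv_1sub_le//.
exact: odd_gt0.
Qed.

Lemma odd_pairsE : odd_pairs = [set n | 0 < n]%N `*`` fun=> [set n | odd n].
Proof. by apply/seteqP; split. Qed.

(** For fixed [a], dividing by [1 - q ^+ a] replaces the indicator of odd [x] by its partial sums,
    the numbers of odd integers up to [x]. *)
Lemma csum_wt_floor :
  csum odd_pairs (fun p => sgnsq p.1 * q ^+ (p.1 * p.2) / (1 - q ^+ p.1)) = lambert wt_floor q.
Proof.
have [sV _] := csummable_odd_pairs_geo.
have [sA ->] := @lambert_set q q1 wt_floor ([set n | 0 < n]%N `*`` fun=> setT)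
  (fun p => wt_floor p.1 p.2) wt_floor_bound (fun p _ => erefl)
  (fun p => ltac:(by rewrite /wt_floor; case: p => [[|a] x]; [rewrite expr0n mulr0 mul0r|case])).
rewrite odd_pairsE in sV *.
rewrite (csum_pair (f := fun a x => sgnsq a * q ^+ (a * x) / (1 - q ^+ a)))//.
rewrite (csum_pair (f := fun a x => wt_floor a x * q ^+ (a * x)))//.
apply: eq_csum => a /= a0; have v1 := qX_lt1 q1 a0.
pose o (n : nat) : C := (odd n)%:R.
have so : pser_cv o (q ^+ a).
  apply: csummable_le (csummable_geo v1) => n _.
  by rewrite nrmM nrm_nat ler_piMl ?nrm_ge0//; case: odd.
have [ss E] := pser_sumE v1 so.
transitivity (sgnsq a * (pser o (q ^+ a) / (1 - q ^+ a))); last first.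
  rewrite E /pser -csumZ//; apply: eq_csum => x _.
  by rewrite sum_odd /wt_floor exprM mulrA.
rewrite /pser -csumZr// -csumZ; last first.
  have sr := csummableZ ((1 - q ^+ a)^-1) so.
  by apply: eq_csummable sr => x _; rewrite mulrC.
apply: csum_extend => //.
- by move=> x /= xo; rewrite /o xo mul1r exprM mulrA.
- by move=> x _ /negP /negbTE xo; rewrite /o xo mul0r mul0r mulr0.
- exact: (csummable_pair1 (f := fun a x => sgnsq a * q ^+ (a * x) / (1 - q ^+ a)) sV a0).
Qed.

(** For fixed [x], dividing by [1 - q ^+ x] replaces [sgnsq] by its partial sums, which are signed
    triangular numbers. *)
Lemma csum_wt_bin :
  csum odd_pairs (fun p => sgnsq p.1 * q ^+ (p.1 * p.2) / (1 - q ^+ p.2)) = lambert wt_bin q.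
Proof.
have [_ sV] := csummable_odd_pairs_geo.
have [sB ->] := @lambert_set q q1 wt_bin ([set n | 0 < n]%N `*`` fun=> [set n | odd n])
  (fun p => wt_bin p.1 p.2) wt_bin_bound (fun p _ => erefl)
  (fun p => ltac:(by rewrite /wt_bin; case: p => [[|a] x]; case: ifP => //; [rewrite bin_small// mulr0|move=> /= xo []])).
rewrite odd_pairsE in sV *.
rewrite (csum_pair (f := fun a x => sgnsq a * q ^+ (a * x) / (1 - q ^+ x)))//.
rewrite (csum_pair (f := fun a x => wt_bin a x * q ^+ (a * x)))//.
rewrite (csum_swap (f := fun a x => sgnsq a * q ^+ (a * x) / (1 - q ^+ x)))//.
rewrite (csum_swap (f := fun a x => wt_bin a x * q ^+ (a * x)))//.
apply: eq_csum => x /= xo.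
have v1 := qX_lt1 q1 (odd_gt0 xo).
have so : pser_cv sgnsq (q ^+ x).
  apply: (@pser_cv_poly _ _ _ 1 2) => // n.
  by rewrite mul1r nrmM nrm_sgn mul1r nrmX nrm_nat.
have [ss E] := pser_sumE v1 so.
transitivity (pser sgnsq (q ^+ x) / (1 - q ^+ x)).
  rewrite /pser -csumZr//; apply: csum_extend => //.
  - by move=> a _; rewrite mulnC exprM.
  - by move=> [|a] _ //= _; rewrite /sgnsq expr0n !mulr0 !mul0r.
  - have := csummable_sub (@subsetT _ [set n | 0 < n]%N) (csummableZ ((1 - q ^+ x)^-1) so).
    by apply: eq_csummable => a _; rewrite mulnC exprM mulrC.
rewrite E /pser; apply/esym; apply: csum_extend => //.
- by move=> a _; rewrite sum_sgnsq /wt_bin xo mulnC exprM.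
- by move=> [|a] _ //= _; rewrite sum_sgnsq bin_small// mulr0 mul0r.
- have := csummable_sub (@subsetT _ [set n | 0 < n]%N) ss.
  by apply: eq_csummable => a _; rewrite sum_sgnsq /wt_bin xo mulnC exprM.
Qed.

(** Groups the entry that carries the weight with the one that bounds the window: once these two are
    fixed, the sums over the other two are geometric. *)
Definition quad_swap (k : quadruple) : quadruple := ((k.2.1, k.1.2), (k.1.1, k.2.2)).

Lemma csum_window1 :
  csum (odd_left_quads `&` [set k | (k.2.2 < k.1.2)%N]) (quad_weight q sgnsq) =
  csum odd_pairs (fun p => sgnsq p.1 * (q ^+ p.2 / (1 - q ^+ p.2) *
     ((q ^+ p.1 - q ^+ (p.1 * p.2)) / (1 - q ^+ p.1)))) /\
  csummable odd_pairs (fun p => sgnsq p.1 * (q ^+ p.2 / (1 - q ^+ p.2) *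
     ((q ^+ p.1 - q ^+ (p.1 * p.2)) / (1 - q ^+ p.1)))).
Proof.
pose J (p : nat * nat) := [set n | 0 < n]%N `*`` fun=> [set n | 0 < n < p.2]%N.
pose h (p r : nat * nat) := sgnsq p.1 * ((q ^+ p.2) ^+ r.1 * (q ^+ p.1) ^+ r.2).
have bb : set_bij (odd_pairs `*`` J) (odd_left_quads `&` [set k | (k.2.2 < k.1.2)%N]) quad_swap.
  apply: (@can_set_bij _ _ _ _ _ quad_swap).
  - move=> [[b x] [a y]] [[/= ? ?] [/= ? /andP[? ?]]].
    by split; [split; [split; split => /=|]|] => //=; lia.
  - by move=> [[a x] [b y]] [[[[/= ? ?] [/= ? ?]] ?] /= ?]; split; split => //=; apply/andP.
  - by move=> [[a x] [b y]].
  - by move=> [[a x] [b y]].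
have sU : csummable (odd_left_quads `&` [set k | (k.2.2 < k.1.2)%N]) (quad_weight q sgnsq).
  have FM n : nrm (sgnsq n) <= n%:R ^+ 2 by rewrite nrmM nrm_sgn mul1r nrmX nrm_nat.
  by apply: csummable_sub (csummable_quad_weight q1 FM) => k [[]].
have hE k : quad_weight q sgnsq (quad_swap k) = h k.1 k.2.
  case: k => [[b x] [a y]]; rewrite /quad_weight /h /quad_value/= exprD.
  by rewrite [(a * x)%N]mulnC !exprM.
have sh : csummable (odd_pairs `*`` J) (fun k => h k.1 k.2).
  by apply: eq_csummable (fun k _ => hE k) _; apply/(csummable_reindex _ bb).
have E p : odd_pairs p -> csum (J p) (h p) = sgnsq p.1 * (q ^+ p.2 / (1 - q ^+ p.2) *
     ((q ^+ p.1 - q ^+ (p.1 * p.2)) / (1 - q ^+ p.1))).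
  case: p => [b x] [/= b0 xo]; have x0 := odd_gt0 xo.
  have [sx Ex] := csum_geo1 (qX_lt1 q1 x0).
  have v1 : q ^+ b != 1 by have := nrm_lt1_neq0 (qX_lt1 q1 b0); rewrite subr_eq0 eq_sym.
  have [sb Eb] := csum_geo_finite v1 x0.
  apply: etrans (csumZ (sgnsq b) (csummable_mul sx sb)) _; congr (_ * _).
  by apply: etrans (csum_mul sx sb) _; rewrite Ex Eb exprM.
split.
  rewrite (csum_reindex _ bb) (eq_csum (g := fun k => h k.1 k.2)); last first.
    by move=> k _; rewrite /= hE.
  by rewrite csum_pair//; exact: eq_csum.
by apply: eq_csummable E _; exact: csummable_outer.
Qed.

Lemma csum_window2 :
  csum (odd_left_quads `&` [set k | (k.1.1 < k.2.1)%N]) (quad_weight q sgnsq) =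
  csum odd_pairs (fun p => sgnsq p.1 * ((q ^+ p.2 - q ^+ (p.1 * p.2)) / (1 - q ^+ p.2) *
     (q ^+ p.1 / (1 - q ^+ p.1)))) /\
  csummable odd_pairs (fun p => sgnsq p.1 * ((q ^+ p.2 - q ^+ (p.1 * p.2)) / (1 - q ^+ p.2) *
     (q ^+ p.1 / (1 - q ^+ p.1)))).
Proof.
pose J (p : nat * nat) := [set n | 0 < n < p.1]%N `*`` fun=> [set n | 0 < n]%N.
pose h (p r : nat * nat) := sgnsq p.1 * ((q ^+ p.2) ^+ r.1 * (q ^+ p.1) ^+ r.2).
have bb : set_bij (odd_pairs `*`` J) (odd_left_quads `&` [set k | (k.1.1 < k.2.1)%N]) quad_swap.
  apply: (@can_set_bij _ _ _ _ _ quad_swap).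
  - move=> [[b x] [a y]] [[/= ? ?] [/= /andP[? ?] ?]].
    by split; [split; [split; split => /=|]|] => //=; lia.
  - by move=> [[a x] [b y]] [[[[/= ? ?] [/= ? ?]] ?] /= ?]; split; split => //=; apply/andP.
  - by move=> [[a x] [b y]].
  - by move=> [[a x] [b y]].
have sU : csummable (odd_left_quads `&` [set k | (k.1.1 < k.2.1)%N]) (quad_weight q sgnsq).
  have FM n : nrm (sgnsq n) <= n%:R ^+ 2 by rewrite nrmM nrm_sgn mul1r nrmX nrm_nat.
  by apply: csummable_sub (csummable_quad_weight q1 FM) => k [[]].
have hE k : quad_weight q sgnsq (quad_swap k) = h k.1 k.2.
  case: k => [[b x] [a y]]; rewrite /quad_weight /h /quad_value/= exprD.
  by rewrite [(a * x)%N]mulnC !exprM.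
have sh : csummable (odd_pairs `*`` J) (fun k => h k.1 k.2).
  by apply: eq_csummable (fun k _ => hE k) _; apply/(csummable_reindex _ bb).
have E p : odd_pairs p -> csum (J p) (h p) =
    sgnsq p.1 * ((q ^+ p.2 - q ^+ (p.1 * p.2)) / (1 - q ^+ p.2) *
     (q ^+ p.1 / (1 - q ^+ p.1))).
  case: p => [b x] [/= b0 xo]; have x0 := odd_gt0 xo.
  have [sx Ex] := csum_geo1 (qX_lt1 q1 b0).
  have v1 : q ^+ x != 1 by have := nrm_lt1_neq0 (qX_lt1 q1 x0); rewrite subr_eq0 eq_sym.
  have [sb Eb] := csum_geo_finite v1 b0.
  apply: etrans (csumZ (sgnsq b) (csummable_mul sb sx)) _; congr (_ * _).
  by apply: etrans (csum_mul sb sx) _; rewrite Ex Eb mulnC exprM.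
split.
  rewrite (csum_reindex _ bb) (eq_csum (g := fun k => h k.1 k.2)); last first.
    by move=> k _; rewrite /= hE.
  by rewrite csum_pair//; exact: eq_csum.
by apply: eq_csummable E _; exact: csummable_outer.
Qed.

(* This is the logarithmic derivative of [lambert wt_odd], since
   [lambert wt_odd] and [lambert wt_alt] have the same odd coefficients. *)
Lemma lambert_ode_identity : 8 * (lambert wt_alt q * lambert wt_alt_even q) = lambert wt_alt_sq q - lambert wt_alt q.
Proof.
have FM n : nrm (sgnsq n) <= n%:R ^+ 2 by rewrite nrmM nrm_sgn mul1r nrmX nrm_nat.
have F0 : sgnsq 0 = 0 by rewrite /sgnsq expr0n mulr0.
have [W1 sW1] := csum_window1; have [W2 sW2] := csum_window2.
have [sV1 sV2] := csummable_odd_pairs_geo.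
(* With [u = q ^+ b], [v = q ^+ x] and [w = q ^+ (b * x)], the two windows differ by
   [w / (1 - u) - w / (1 - v)]. *)
have key : csum parity_quads (quad_weight_diff q sgnsq) - csum parity_quads (quad_weight_add q sgnsq) = lambert wt_floor q - lambert wt_bin q.
  rewrite (etrans (csum_liouville_sub q1 F0 FM) W1).
  rewrite (etrans (csum_liouville_add q1 _) W2).
  rewrite -csum_wt_floor -csum_wt_bin -!csumB//.
  apply: eq_csum => -[b x] [/= b0 xo]; have x0 := odd_gt0 xo.
  have := nrm_lt1_neq0 (qX_lt1 q1 b0); have := nrm_lt1_neq0 (qX_lt1 q1 x0).
  by move: (q ^+ b) (q ^+ x) (q ^+ (b * x)) => u v w v1 u1; field; rewrite v1 u1.
have sD : csummable parity_quads (quad_weight_diff q sgnsq) by apply: csummable_sub (csummable_quad_weight_diff q1 FM) => k [].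
have sA : csummable parity_quads (quad_weight_add q sgnsq) by apply: csummable_sub (csummable_quad_weight_add q1 FM) => k [].
pose O1 : set (nat * nat) := [set p | (0 < p.1)%N /\ odd p.2].
pose O2 : set (nat * nat) := [set p | [/\ (0 < p.1)%N, (0 < p.2)%N & ~~ odd p.2]].
have [sO1 LO1] := @lambert_set q q1 wt_alt O1 (fun p => (-1) ^+ p.1.+1 * p.1%:R) wt_alt_bound
  (fun p => ltac:(by rewrite /wt_alt => -[_ ->]))
  (fun p => ltac:(by rewrite /wt_alt; case: p => [[|a] x] /=; case: ifP => //; [rewrite mulr0|move=> ? []])).
have [sO2 LO2] := @lambert_set q q1 wt_alt_even O2 (fun p => (-1) ^+ p.1.+1 * p.1%:R) wt_alt_even_bound
  (fun p => ltac:(by rewrite /wt_alt_even => -[_ -> ->]))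
  (fun p => ltac:(by rewrite /wt_alt_even; case: p => [[|a] x] /=; case: ifP => //; [rewrite mulr0|move=> /andP[? ?] []])).
have D2E : parity_quads = O1 `*`` fun=> O2.
  apply/seteqP; split => -[[a x] [b y]].
    by move=> [[[/= ? ?] [/= ? ?]] ? ?].
  by move=> [[/= ? ?] [/= ? ? ?]]; split => //=; split; split => //=; lia.
have E : csum parity_quads (quad_weight_diff q sgnsq) - csum parity_quads (quad_weight_add q sgnsq) = -4 * (lambert wt_alt q * lambert wt_alt_even q).
  rewrite LO1 LO2 -(csum_mul sO1 sO2) -(csumZ (-4) (csummable_mul sO1 sO2)).
  rewrite -csumB// D2E; apply: eq_csum => -[[a x] [b y]] _.
  rewrite /quad_weight_diff /quad_weight_add /quad_value /= exprD -mulrBl.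
  have -> : sgnsq (dist_nat a b) - sgnsq (a + b) = - 4 * ((-1) ^+ a * (-1) ^+ b * a%:R * b%:R).
    rewrite /sgnsq; have -> : (-1) ^+ (dist_nat a b) = (-1) ^+ (a + b) :> C.
      by rewrite -signr_odd -[RHS]signr_odd; congr ((-1) ^+ _); rewrite /dist_nat; lia.
    rewrite exprD /dist_nat; case: (leqP a b) => ab.
      by rewrite (eqP ab) add0n natrB// natrD; ring.
    by rewrite (eqP (ltnW ab)) addn0 natrB ?(ltnW ab)// natrD; ring.
  by rewrite !exprS; ring.
(* For odd [x] this is [a^2 (x + 1) / 2 - a (a + 1) / 2 = (a^2 x - a) / 2], up to the sign [(-1)^a];
   for even [x] only [a^2 x / 2] is present. *)
have lin : lambert wt_floor q - lambert wt_bin q = - (1 / 2) * lambert wt_alt_sq q + 1 / 2 * lambert wt_alt q.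
  rewrite -!lambertZ//; [|exact: wt_alt_bound|exact: wt_alt_sq_bound].
  have -> : - lambert wt_bin q = -1 * lambert wt_bin q by rewrite mulN1r.
  rewrite -lambertZ//; last exact: wt_bin_bound.
  rewrite -!lambertD//; [|exact/lambert_boundZ/wt_alt_sq_bound|exact/lambert_boundZ/wt_alt_bound|exact: wt_floor_bound|exact/lambert_boundZ/wt_bin_bound].
  apply: eq_lambert => a x; rewrite /wt_floor /wt_bin /wt_alt_sq /wt_alt.
  have two : (2 : C) != 0 by rewrite pnatr_eq0.
  case: ifP => xo.
    have -> : 'C(a.+1, 2)%:R = a%:R * (a%:R + 1) / 2 :> C.
      apply: (mulIf two); rewrite divfK// -natrM -[1]/(1%:R) -natrD -natrM; congr (_%:R).
      rewrite muln2 bin2 /= -[LHS]muln2 -divn2 divnK; first by rewrite addn1 mulnC.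
      by rewrite dvdn2 oddM /=; lia.
    have -> : ((x + true)./2)%:R = (x%:R + 1) / 2 :> C.
      apply: (mulIf two); rewrite divfK// -natrM -[1]/(1%:R) -natrD; congr (_%:R); lia.
    by rewrite [(-1) ^+ a.+1]exprS; field.
  have -> : ((x + false)./2)%:R = x%:R / 2 :> C.
    apply: (mulIf two); rewrite divfK// -natrM; congr (_%:R); lia.
  by rewrite [(-1) ^+ a.+1]exprS; field.
have := key; rewrite E lin => H.
have -> : 8 * (lambert wt_alt q * lambert wt_alt_even q) = -2 * (-4 * (lambert wt_alt q * lambert wt_alt_even q)) by ring.
by rewrite H; field.
Qed.

End LambertIdentities.

(** * Power series and logarithmic derivatives *)

Section DiskSeries.
Context {R : realType}.
Local Notation C := R[i].
Implicit Types (a b z : nat -> C) (q : C).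

Definition diskcv a := forall q, nrm q < 1 -> pser_cv a q.
(** The derivation [q d/dq], on coefficients. *)
Definition euler_op a (n : nat) : C := n%:R * a n.

Lemma diskcv_cprod a b : diskcv a -> diskcv b -> diskcv (cprod a b).
Proof. by move=> ca cb q q1; exact: (pser_mul (ca q q1) (cb q q1)).1. Qed.

Lemma pser_cprod a b q : diskcv a -> diskcv b -> nrm q < 1 ->
  pser (cprod a b) q = pser a q * pser b q.
Proof. by move=> ca cb q1; rewrite (pser_mul (ca q q1) (cb q q1)).2. Qed.

Lemma diskcvD a b : diskcv a -> diskcv b -> diskcv (fun n => a n + b n).
Proof.
move=> ca cb q q1; apply: eq_csummable (csummableD (ca q q1) (cb q q1)) => n _.
by rewrite mulrDl.
Qed.

Lemma pserD a b q : pser_cv a q -> pser_cv b q ->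
  pser (fun n => a n + b n) q = pser a q + pser b q.
Proof.
by move=> ca cb; rewrite /pser -csumD//; apply: eq_csum => n _; rewrite mulrDl.
Qed.

Lemma pserZ c a q : pser_cv a q -> pser (fun n => c * a n) q = c * pser a q.
Proof. by move=> ca; rewrite /pser -csumZ//; apply: eq_csum => n _; rewrite mulrA. Qed.

Lemma diskcvZ c a : diskcv a -> diskcv (fun n => c * a n).
Proof.
move=> ca q q1; apply: eq_csummable (csummableZ c (ca q q1)) => n _.
by rewrite mulrA.
Qed.

Lemma half_lt1 : nrm (2^-1%:C : C) < 1.
Proof. by rewrite nrm_real ger0_norm ?invr_ge0// invf_lt1 ?ltr1n. Qed.

Lemma disk_uniq a b : diskcv a -> diskcv b ->
  (forall q, nrm q < 1 -> pser a q = pser b q) -> forall n, a n = b n.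
Proof.
move=> ca cb ab; apply: (@pser_uniq _ _ _ 2^-1); rewrite ?invr_gt0//.
- exact/ca/half_lt1.
- exact/cb/half_lt1.
- move=> x x0 x1; apply: ab; rewrite nrm_real gtr0_norm//; apply: lt_trans x1 _.
  by rewrite invf_lt1 ?ltr1n.
Qed.

Lemma diskcv_euler a : diskcv a -> diskcv (euler_op a).
Proof.
move=> ca q q1; pose s := (1 + nrm q) / 2.
have qs : nrm q < s by rewrite /s; have := nrm_ge0 q; lra.
have s1 : s < 1 by rewrite /s; lra.
have s0 : 0 < s by apply: le_lt_trans qs; exact: nrm_ge0.
have sE : nrm s%:C = s by rewrite nrm_real gtr0_norm.
have qs1 : 0 <= nrm q / s < 1 by rewrite divr_ge0 ?nrm_ge0 ?ltW//= ltr_pdivrMr// mul1r.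
have cs : pser_cv a s%:C by apply: ca; rewrite sE.
apply: csummable_le (rsummableZ ((1 - nrm q / s)^-1) cs) => n _.
rewrite /euler_op !nrmM !nrmX nrm_nat sE.
rewrite mulrAC mulrC [leRHS]mulrCA ler_wpM2l ?nrm_ge0//.
have -> : nrm q ^+ n = (nrm q / s) ^+ n * s ^+ n.
  by rewrite -exprMn divfK ?gt_eqF.
by rewrite mulrA ler_wpM2r ?exprn_ge0 ?(ltW s0)// natmul_geo_le.
Qed.

Lemma euler_cprod a b n : euler_op (cprod a b) n =
  cprod (euler_op a) b n + cprod a (euler_op b) n.
Proof.
rewrite /euler_op /cprod mulr_sumr -big_split; apply: eq_bigr => i _ /=.
have -> : n%:R = i%:R + (n - i)%N%:R :> C by rewrite -natrD subnKC// -ltnS.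
ring.
Qed.

(* [z] is the logarithmic derivative [q a' / a]. *)
Definition ode a z := [/\ diskcv a, diskcv z & forall n, euler_op a n = cprod a z n].

Lemma pser_ode a z q : ode a z -> nrm q < 1 ->
  pser (euler_op a) q = pser a q * pser z q.
Proof.
move=> [ca cz H] q1; rewrite -pser_cprod//; apply: eq_csum => n _; by rewrite H.
Qed.

Lemma odeP a z : diskcv a -> diskcv z ->
  (forall q, nrm q < 1 -> pser (euler_op a) q = pser a q * pser z q) -> ode a z.
Proof.
move=> ca cz H; split => //; apply: disk_uniq.
- exact: diskcv_euler.
- exact: diskcv_cprod.
- by move=> q q1; rewrite H// pser_cprod.
Qed.

Lemma pser_euler_cprod a b q : diskcv a -> diskcv b -> nrm q < 1 ->
  pser (euler_op (cprod a b)) q =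
  pser (euler_op a) q * pser b q + pser a q * pser (euler_op b) q.
Proof.
move=> ca cb q1; have ea := diskcv_euler ca; have eb := diskcv_euler cb.
rewrite -!pser_cprod// -pserD; [|exact/diskcv_cprod|exact/diskcv_cprod].
by apply: eq_csum => n _; rewrite euler_cprod.
Qed.

Lemma ode_cprod a b z y : ode a z -> ode b y ->
  ode (cprod a b) (fun n => z n + y n).
Proof.
move=> oa ob; have [ca cz _] := oa; have [cb cy _] := ob.
apply: odeP; [exact: diskcv_cprod|exact: diskcvD|move=> q q1].
rewrite pser_euler_cprod// (pser_ode oa)// (pser_ode ob)// pser_cprod// pserD; auto.
ring.
Qed.

(** This and the next three are the coefficients of [q^m], [1 - q^m], [1 / (1 - q^m)] and
    [q^m / (1 - q^m)]. *)
Definition delta m (n : nat) : C := (n == m)%:R.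
Definition one_sub m (n : nat) : C := delta 0 n - delta m n.
Definition geo m (n : nat) : C := (m %| n)%:R.
Definition geo_pos m (n : nat) : C := ((0 < n) && (m %| n))%N%:R.

Lemma pser_delta m q : pser_cv (delta m) q /\ pser (delta m) q = q ^+ m.
Proof.
have [|s E] := @csum_nat_finite R m.+1 (fun n => delta m n * q ^+ n).
  by move=> n mn; rewrite /delta gtn_eqF// mul0r.
split=> //; rewrite /pser E big_ord_recr /= /delta eqxx mul1r big1 ?add0r// => i _.
by rewrite ltn_eqF ?mul0r.
Qed.

Lemma pser_one_sub m q : pser_cv (one_sub m) q /\ pser (one_sub m) q = 1 - q ^+ m.
Proof.
have [c0 e0] := pser_delta 0 q; have [cm em] := pser_delta m q.
split; first by apply: eq_csummable (csummableB c0 cm) => n _; rewrite /one_sub mulrBl.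
rewrite -em -[1](expr0 q) -e0 /pser -csumB//.
by apply: eq_csum => n _; rewrite /one_sub mulrBl.
Qed.

Lemma natb_le1 (b : bool) : nrm (b%:R : C) <= 1.
Proof. by case: b; rewrite ?nrm0 ?nrm1. Qed.

Lemma diskcv_bool (p : nat -> bool) : diskcv (fun n => (p n)%:R).
Proof.
move=> q q1; apply: (@pser_cv_poly _ _ _ 1 0) => // n.
by rewrite expr0 mulr1 natb_le1.
Qed.

Lemma pser_geo m q : (0 < m)%N -> nrm q < 1 -> pser (geo m) q = (1 - q ^+ m)^-1.
Proof.
move=> m0 q1; have qm := qX_lt1 q1 m0.
rewrite -csum_geo//; have b : set_bij setT [set n | m %| n]%N (fun n => m * n)%N.
  apply: (@can_set_bij _ _ _ _ _ (fun n => n %/ m)%N) => //=.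
  - by move=> x _; exact: dvdn_mulr.
  - by move=> x _; rewrite mulKn.
  - by move=> y my; rewrite mulnC divnK.
apply/esym; rewrite (eq_csum (g := (fun n => q ^+ n) \o (fun n => m * n)%N)); last first.
  by move=> n _; rewrite /= exprM.
rewrite -(csum_reindex _ b); apply: csum_extend => //.
- by move=> n /= mn; rewrite /geo mn mul1r.
- by move=> n _ /= /negP /negbTE mn; rewrite /geo mn mul0r.
- by apply: csummable_sub (csummable_geo q1).
Qed.

Lemma pser_geo_pos m q : (0 < m)%N -> nrm q < 1 ->
  pser (geo_pos m) q = q ^+ m / (1 - q ^+ m).
Proof.
move=> m0 q1; have nz := nrm_lt1_neq0 (qX_lt1 q1 m0).
have E n : geo m n = delta 0 n + geo_pos m n.
  by rewrite /geo /delta /geo_pos; case: n => [|n]; rewrite ?dvdn0 ?addr0//= add0r.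
have := pser_geo m0 q1; rewrite /pser (eq_csum (g := fun n => delta 0 n * q ^+ n + geo_pos m n * q ^+ n)); last first.
  by move=> n _; rewrite E mulrDl.
have [c0 e0] := pser_delta 0 q.
rewrite csumD//; last exact: (diskcv_bool (fun n => (0 < n) && (m %| n))%N q1).
rewrite -![csum _ (fun n => _ n * _)]/(pser _ _) e0 expr0 => H.
have -> : pser (geo_pos m) q = (1 - q ^+ m)^-1 - 1 by rewrite -H addrAC subrr add0r.
by field.
Qed.

Lemma diskcv_one_sub m : diskcv (one_sub m).
Proof. by move=> q _; exact: (pser_one_sub m q).1. Qed.

Lemma ode_one_sub m : (0 < m)%N ->
  ode (one_sub m) (fun n => (- m%:R) * geo_pos m n).
Proof.
move=> m0; have cg : diskcv (geo_pos m) by exact: diskcv_bool.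
apply: odeP; [exact: diskcv_one_sub|exact: diskcvZ|move=> q q1].
have nz := nrm_lt1_neq0 (qX_lt1 q1 m0).
rewrite pserZ; last exact: cg.
rewrite (pser_one_sub m q).2 pser_geo_pos//.
have -> : pser (euler_op (one_sub m)) q = - m%:R * q ^+ m.
  rewrite -(pser_delta m q).2 -pserZ; last exact: (pser_delta m q).1.
  apply: eq_csum => n _; congr (_ * _); rewrite /euler_op /one_sub /delta.
  have [->|nm] := eqVneq n m; first by rewrite gtn_eqF//= sub0r mulrN1 mulr1.
  by case: n nm => [|n] nm /=; rewrite ?mul0r ?subr0 ?mulr0.
by field.
Qed.

(** Applying [q d/dq] to [(1 - q^m) * (1 - q^m)^-1 = 1] shows that the logarithmic derivative is the
    opposite of that of [1 - q^m]. *)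
Lemma ode_geo m : (0 < m)%N -> ode (geo m) (fun n => m%:R * geo_pos m n).
Proof.
move=> m0; have cg : diskcv (geo_pos m) by exact: diskcv_bool.
have cgm : diskcv (geo m) by exact: diskcv_bool.
have cos := diskcv_one_sub m.
apply: odeP; [exact: diskcv_bool|exact: diskcvZ|move=> q q1].
have nz := nrm_lt1_neq0 (qX_lt1 q1 m0).
have E n : cprod (one_sub m) (geo m) n = delta 0 n.
  apply: disk_uniq n; [exact: diskcv_cprod|by move=> p _; exact: (pser_delta 0 p).1|].
  move=> p p1; rewrite pser_cprod// (pser_one_sub m p).2 pser_geo// (pser_delta 0 p).2.
  by rewrite mulfV// nrm_lt1_neq0// qX_lt1.
have := pser_euler_cprod cos cgm q1.
rewrite (_ : pser (euler_op (cprod _ _)) q = 0); last first.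
  apply: csum0 => n _; rewrite /euler_op E /delta.
  by case: n => [|n]; rewrite ?mul0r// mulr0 mul0r.
rewrite (pser_ode (ode_one_sub m0) q1) pserZ; last exact: cg.
rewrite pserZ; last exact: cg.
rewrite (pser_one_sub m q).2 pser_geo_pos// pser_geo// => H.
have H2 : (1 - q ^+ m) * pser (euler_op (geo m)) q = m%:R * (q ^+ m / (1 - q ^+ m)).
  by apply/eqP; rewrite -subr_eq0; apply/eqP; rewrite [RHS]H; field.
by apply: (mulfI nz); rewrite H2; field.
Qed.

End DiskSeries.

(** * Product expansion of the odd Lambert series *)

Section ProductIdentity.
Context {R : realType}.
Local Notation C := R[i].
Local Notation l := (lambert_coef (@wt_odd R)).
Local Notation w := (lambert_coef (@wt_alt_even R)).

Lemma diskcv_lambert_coef (g : nat -> nat -> C) : lambert_bound g -> diskcv (lambert_coef g).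
Proof. by move=> gb q q1; exact: (lambert_pser gb q1).1. Qed.

Lemma pser_lambert_coef (g : nat -> nat -> C) q : lambert_bound g -> nrm q < 1 ->
  pser (lambert_coef g) q = lambert g q.
Proof. by move=> gb q1; rewrite (lambert_pser gb q1).2. Qed.

Lemma lambert_coef_wt_alt_sq n : lambert_coef wt_alt_sq n = n%:R * (lambert_coef wt_alt n + w n) :> C.
Proof.
rewrite /lambert_coef -big_split mulr_sumr; apply: eq_bigr => d /andP[n0 dn] /=.
have -> : wt_alt d (n %/ d) + wt_alt_even d (n %/ d) = (-1) ^+ d.+1 * d%:R :> C.
  have nd : (0 < n %/ d)%N by rewrite divn_gt0 ?(dvdn_gt0 n0 dn)// dvdn_leq.
  rewrite /wt_alt /wt_alt_even nd; by case: odd; rewrite ?addr0 ?add0r.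
rewrite /wt_alt_sq -[in n%:R](divnK dn) natrM; ring.
Qed.

Lemma lambert_coef_wt_alt_even_odd n : odd n -> w n = 0.
Proof.
move=> no; rewrite /lambert_coef big1// => d /andP[n0 dn]; rewrite /wt_alt_even.
have : odd (n %/ d * d)%N by rewrite divnK.
by rewrite oddM => /andP[-> _]; rewrite andbF.
Qed.

Lemma lambert_coef_wt_odd_even n : ~~ odd n -> l n = 0.
Proof.
move=> no; rewrite /lambert_coef big1// => d /andP[n0 dn]; rewrite /wt_odd.
case: ifP => // /andP[d1 d2]; have : odd (n %/ d * d)%N by rewrite oddM d1 d2.
by rewrite divnK// (negbTE no).
Qed.

Lemma lambert_coef_wt_odd_odd n : odd n -> l n = lambert_coef wt_alt n.
Proof.
move=> no; apply: eq_bigr => d /andP[n0 dn]; rewrite /wt_odd /wt_alt.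
have : odd (n %/ d * d)%N by rewrite divnK.
rewrite oddM => /andP[-> d1]; rewrite d1/=.
by rewrite -signr_odd/= d1 mul1r.
Qed.

(** As [w] is supported on even indices, the convolution at an odd [n] sees only odd coefficients of
    [wt_alt], which agree with [l], and [lambert_ode_identity] applies. At an even [n] everything
    vanishes. *)
Lemma lambert_coef_ode n : n%:R * l n - l n = 8 * cprod l w n.
Proof.
have [no|ne] := boolP (odd n); last first.
  rewrite lambert_coef_wt_odd_even// mulr0 subr0 /cprod big1 ?mulr0// => i _.
  have [io|ie] := boolP (odd i); last by rewrite lambert_coef_wt_odd_even// mul0r.
  by rewrite lambert_coef_wt_alt_even_odd ?mulr0// oddB ?io ?(negbTE ne)// -ltnS.
have -> : cprod l w n = cprod (lambert_coef wt_alt) w n.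
  apply: eq_bigr => i _; have [io|ie] := boolP (odd i); first by rewrite lambert_coef_wt_odd_odd.
  by rewrite lambert_coef_wt_alt_even_odd ?mulr0// oddB ?no ?(negbTE ie)// -ltnS.
have c2 := diskcv_lambert_coef (@wt_alt_bound R); have cW := diskcv_lambert_coef (@wt_alt_even_bound R).
have cD := diskcv_lambert_coef (@wt_alt_sq_bound R).
have -> : 8 * cprod (lambert_coef wt_alt) w n = lambert_coef wt_alt_sq n + (-1) * lambert_coef wt_alt n :> C.
  apply: (disk_uniq (a := fun n => 8 * cprod (lambert_coef wt_alt) w n)
     (b := fun n => lambert_coef wt_alt_sq n + (-1) * lambert_coef wt_alt n)).
  - exact/diskcvZ/diskcv_cprod.
  - exact/diskcvD/diskcvZ.
  - move=> q q1; rewrite pserD; [|exact: cD|exact: diskcvZ].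
    rewrite !pserZ; [|exact: c2|exact: diskcv_cprod].
    rewrite pser_cprod// (pser_lambert_coef (@wt_alt_bound R) q1) (pser_lambert_coef (@wt_alt_even_bound R) q1).
    by rewrite (pser_lambert_coef (@wt_alt_sq_bound R) q1) lambert_ode_identity// mulN1r.
by rewrite lambert_coef_wt_alt_sq lambert_coef_wt_alt_even_odd// addr0 -lambert_coef_wt_odd_odd// mulN1r.
Qed.

Definition odd_lambert_coef (n : nat) : C := l n.+1.

Lemma coef0_odd : l 0%N = 0. Proof. exact: lambert_coef_wt_odd_even. Qed.

Lemma odd_lambert_coef0 : odd_lambert_coef 0 = 1.
Proof.
rewrite /odd_lambert_coef /lambert_coef big_mkcond big_ord_recl/= big_ord1/= divnn/= /wt_odd/=.
by rewrite add0r.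
Qed.

Lemma diskcv_odd_lambert_coef : diskcv odd_lambert_coef.
Proof. by move=> q q1; exact: (pser_head (diskcv_lambert_coef (@wt_odd_bound R) q1)).1. Qed.

Lemma pser_odd_lambert_coef q : nrm q < 1 -> q * pser odd_lambert_coef q = lambert wt_odd q.
Proof.
move=> q1; rewrite -pser_lambert_coef//; last exact: wt_odd_bound.
by rewrite (pser_head (diskcv_lambert_coef (@wt_odd_bound R) q1)).2 coef0_odd add0r.
Qed.

(* The logarithmic derivative of what remains of [odd_lambert_coef] after the
   first [N] factors of the product; it starts at degree [2 N + 2], so that
   the remainder tends to 1. *)
Definition tail_logder (N n : nat) : C :=
  \sum_(d < n.+1 | (N < d)%N && (2 * d %| n)%N) (-1) ^+ d.+1 * (8 * d)%:R.

Lemma tail_logder0 n : tail_logder 0 n = 8 * w n.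
Proof.
rewrite /tail_logder /lambert_coef mulr_sumr; have [->|n0] := posnP n.
  by rewrite !big_pred0// => -[[|i] Hi]//.
rewrite big_mkcond [RHS]big_mkcond; apply: eq_bigr => d _ /=.
have [dn|dn] := boolP (d %| n)%N; last first.
  rewrite ifF//; apply/negP => /andP[_ dn2]; move/negP: dn; apply.
  by apply: dvdn_trans dn2; apply: dvdn_mull.
have d0 := dvdn_gt0 n0 dn.
have E : (2 * d %| n)%N = ~~ odd (n %/ d).
  by move: dn d0; move: (nat_of_ord d) => e dn e0; rewrite -{1}(divnK dn) dvdn_pmul2r// dvdn2.
rewrite d0 E /wt_alt_even divn_gt0// dvdn_leq//=.
by case: odd; rewrite /= ?mulr0// natrM; ring.
Qed.

Lemma tail_logderS N n : tail_logder N n = tail_logder N.+1 n + (-1) ^+ N.+2 * (8 * N.+1)%:R * geo_pos (2 * N.+1) n.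
Proof.
rewrite /tail_logder /geo_pos; have [->|n0] := posnP n.
  by rewrite !big_pred0 ?mulr0 ?addr0// => -[[|i] Hi].
have [Hn|Hn] := ltnP N.+1 n.+1; last first.
  have -> : (2 * N.+1 %| n)%N = false.
    by apply/negP => /(dvdn_leq n0); lia.
  rewrite mulr0 addr0; apply: eq_bigl => d.
  have := ltn_ord d; case: ltngtP => /=; lia.
rewrite (bigID (fun d : 'I_n.+1 => d == Ordinal Hn)) /= addrC; congr (_ + _).
  apply: eq_bigl => d; rewrite -val_eqE /=; case: (2 * d %| n)%N; rewrite ?andbF// !andbT; lia.
have [H|H] := boolP (2 * N.+1 %| n)%N.
  rewrite mulr1 (big_pred1 (Ordinal Hn))// => d /=; rewrite -!val_eqE/=.
  by case: eqVneq => [->|_]; rewrite ?H ?ltnSn ?andbF.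
rewrite mulr0 big_pred0// => d; rewrite -val_eqE /=; case: eqVneq => [->|_].
  by rewrite (negbTE H) andbF.
by rewrite andbF.
Qed.

(** Dividing the series by [q] lowers exponents by one, so [n * l n - l n] becomes the Euler
    derivative of the quotient. *)
Lemma ode_odd_lambert_coef : ode odd_lambert_coef (tail_logder 0).
Proof.
have cw := diskcv_lambert_coef (@wt_alt_even_bound R).
split; [exact: diskcv_odd_lambert_coef| |move=> n].
  by move=> q q1; apply: eq_csummable (diskcvZ 8 cw q1) => n _; rewrite tail_logder0.
have := lambert_coef_ode n.+1; rewrite /euler_op -natr1 mulrDl mul1r addrK => ->.
rewrite /cprod big_ord_recl coef0_odd mul0r add0r mulr_sumr; apply: eq_bigr => i _.
by rewrite /= /odd_lambert_coef /bump/= add1n subSS tail_logder0; ring.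
Qed.

(** Up to a fourth power, the inverse of the [d]-th factor of [L(q) / q]: that factor is
    [(1 - q^(2d))^4] for even [d] and [(1 - q^(2d))^-4] for odd [d]. *)
Definition factor_series (d : nat) : nat -> C := if odd d then one_sub (2 * d) else geo (2 * d).
Definition factor_value (d : nat) (q : C) : C := if odd d then 1 - q ^+ (2 * d) else (1 - q ^+ (2 * d))^-1.

Lemma factor_seriesP d : (0 < d)%N -> ode (factor_series d) (fun n => (-1) ^+ d * (2 * d)%:R * geo_pos (2 * d) n).
Proof.
move=> d0; rewrite -signr_odd /factor_series; have d20 : (0 < 2 * d)%N by lia.
case: ifP => _.
  by rewrite expr1 mulN1r; exact: ode_one_sub.
by rewrite expr0 mul1r; exact: ode_geo.
Qed.

Lemma factor_series_val d q : (0 < d)%N -> nrm q < 1 -> pser (factor_series d) q = factor_value d q.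
Proof.
move=> d0 q1; rewrite /factor_series /factor_value; case: ifP => _.
  exact: (pser_one_sub _ _).2.
by rewrite pser_geo//; lia.
Qed.

Lemma eq_ode a z y : ode a z -> (forall n, z n = y n) -> ode a (y : nat -> C).
Proof. by move=> oa zy; have <- : z = y by apply/funext. Qed.

Fixpoint tail_quotient (N : nat) : nat -> C :=
  if N is M.+1 then
    cprod (tail_quotient M) (cprod (cprod (factor_series N) (factor_series N)) (cprod (factor_series N) (factor_series N)))
  else odd_lambert_coef.

Lemma tail_quotientP N : ode (tail_quotient N) (tail_logder N).
Proof.
elim: N => [|N IH]; first exact: ode_odd_lambert_coef.
have of_ := factor_seriesP (ltn0Sn N); have o2 := ode_cprod of_ of_.
apply: eq_ode (ode_cprod IH (ode_cprod o2 o2)) _ => n /=.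
rewrite tail_logderS !exprS !natrM; ring.
Qed.

Lemma tail_quotient_val N q : nrm q < 1 ->
  pser (tail_quotient N) q = pser odd_lambert_coef q * \prod_(1 <= d < N.+1) factor_value d q ^+ 4.
Proof.
move=> q1; elim: N => [|N IH]; first by rewrite big_nil mulr1.
have [cf _ _] := factor_seriesP (ltn0Sn N); have [cx _ _] := tail_quotientP N.
have c2 := diskcv_cprod cf cf.
rewrite big_nat_recr//= pser_cprod//; last exact: diskcv_cprod.
rewrite (pser_cprod c2 c2 q1) (pser_cprod cf cf q1) IH factor_series_val//; ring.
Qed.

Lemma cprod0 (a b : nat -> C) : cprod a b 0 = a 0%N * b 0%N.
Proof. by rewrite /cprod big_ord1. Qed.

Lemma tail_quotient0 N : tail_quotient N 0%N = 1.
Proof.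
elim: N => [|N IH]; first exact: odd_lambert_coef0.
rewrite /= !cprod0 IH; have -> : factor_series N.+1 0%N = 1; last by rewrite !mulr1.
by rewrite /factor_series; case: ifP => _; rewrite /one_sub /geo /delta ?dvdn0//= subr0.
Qed.

Lemma tail_logder_small N n : (n <= N.*2.+1)%N -> tail_logder N n = 0.
Proof.
move=> nN; rewrite /tail_logder big1// => d /andP[Nd dn].
have n0 : (0 < n)%N by have := ltn_ord d; lia.
by have := dvdn_leq n0 dn; lia.
Qed.

Lemma tail_logder_bound N n : nrm (tail_logder N n) <= 8 * n%:R ^+ 2.
Proof.
apply: le_trans (nrm_sum _ _ _) _.
apply: (@le_trans _ _ (\sum_(d < n.+1) 8 * (if d == 0 :> nat then 0 else n%:R) : R)).
  rewrite big_mkcond; apply: ler_sum => d _; case: ifP => [/andP[Nd _]|_].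
    rewrite nrmM nrm_sgn mul1r nrm_nat natrM ler_wpM2l// ifF; last by lia.
    by rewrite ler_nat -ltnS.
  by case: ifP; rewrite ?mulr0// mulr_ge0.
rewrite big_ord_recl /= mulr0 add0r.
by rewrite sumr_const card_ord -mulr_natl expr2; lra.
Qed.

Lemma tail_quotient_small N n : (0 < n)%N -> (n <= N.*2.+1)%N -> tail_quotient N n = 0.
Proof.
move=> n0 nN; have [_ _ /(_ n)] := tail_quotientP N; rewrite /euler_op /cprod big1; last first.
  by move=> i _; rewrite tail_logder_small ?mulr0//; lia.
by move=> /eqP; rewrite mulf_eq0 pnatr_eq0 => /orP[|/eqP//]; rewrite gtn_eqF.
Qed.

(** Strong induction on the recursion [n * x n = \sum x i * z (n - i)], with [x] the quotient and
    [z] its logarithmic derivative: the right-hand side is at most [rho^-n] times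
    [B = 8 * \sum m^2 rho^m]. Only [n > 2 * N + 1] matters, since lower coefficients are 0 or 1;
    there [n >= B] as soon as [N >= N0]. The bound is uniform in [N]. *)
Lemma tail_quotient_bound (rho : R) : 0 < rho < 1 -> exists N0, forall N, (N0 <= N)%N ->
  forall n, nrm (tail_quotient N n) <= (rho ^+ n)^-1.
Proof.
move=> /andP[r0 r1].
have sr : rsummable setT (fun n => n%:R ^+ 2 * rho ^+ n) by apply: rsummable_polygeo; rewrite (ltW r0).
pose B := 8 * possum setT (fun n => n%:R ^+ 2 * rho ^+ n).
have partial n : \sum_(j < n) 8 * j%:R ^+ 2 * rho ^+ j <= B.
  under eq_bigr do rewrite -mulrA; rewrite -mulr_sumr ler_wpM2l//.
  have nn i : 0 <= i%:R ^+ 2 * rho ^+ i by rewrite mulr_ge0// exprn_ge0// ltW.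
  rewrite -lee_fin -possumE// -nneseries_esumT; last by move=> i; rewrite lee_fin.
  rewrite -sumEFin -(big_mkord xpredT (fun i => (i%:R ^+ 2 * rho ^+ i)%:E)).
  by apply: nneseries_lim_ge => i _ _; rewrite lee_fin.
have [N0 HN0] : exists N0 : nat, B <= N0%:R.
  exists (Num.bound B); have := archi_boundP (_ : 0 <= B) => H; apply/ltW/H.
  by have := partial 0%N; rewrite big_ord0.
exists N0 => N NN0 n; have [k] := ubnP n; elim: k n => // k IH n; rewrite ltnS => nk.
have [->|n0] := posnP n; first by rewrite tail_quotient0 nrm1 expr0 invr1.
have [nN|Nn] := leqP n N.*2.+1.
  by rewrite tail_quotient_small// nrm0 invr_ge0 exprn_ge0// ltW.
have nR : 0 < n%:R :> R by rewrite ltr0n.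
rewrite -(ler_pM2l nR) -[X in X * nrm _]nrm_nat -nrmM.
have [_ _ /(_ n)] := tail_quotientP N; rewrite /euler_op => ->.
rewrite /cprod; apply: le_trans (nrm_sum _ _ _) _.
apply: (@le_trans _ _ (\sum_(i < n.+1) (rho ^+ n)^-1 * (8 * (n - i)%N%:R ^+ 2 * rho ^+ (n - i)))).
  apply: ler_sum => i _; rewrite nrmM.
  have [->|ni] := eqVneq (i : nat) n.
    by rewrite subnn tail_logder_small// nrm0 mulr0 expr0n/= !mulr0 mul0r mulr0.
  have li : (i < n)%N by have := ltn_ord i; lia.
  have Hi : nrm (tail_quotient N i) <= (rho ^+ i)^-1 by apply: IH; lia.
  have -> : (rho ^+ n)^-1 = (rho ^+ i)^-1 * (rho ^+ (n - i))^-1.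
    by rewrite -invfM -exprD subnKC// ltnW.
  rewrite (_ : _ * _ * (_ * _) = (rho ^+ i)^-1 * (8 * (n - i)%N%:R ^+ 2)); last first.
    have : rho ^+ (n - i) != 0 by rewrite expf_neq0 ?gt_eqF.
    have : rho ^+ i != 0 by rewrite expf_neq0 ?gt_eqF.
    by move: (rho ^+ i) (rho ^+ (n - i)) => A D A0 D0; field; rewrite A0.
  by apply: ler_pM; rewrite ?nrm_ge0// tail_logder_bound.
rewrite -mulr_sumr mulrC ler_wpM2r ?invr_ge0 ?exprn_ge0 ?(ltW r0)//.
apply: (@le_trans _ _ B); last by apply: le_trans HN0 _; rewrite ler_nat; lia.
apply: le_trans (partial n.+1).
rewrite (reindex_inj rev_ord_inj)/= le_eqVlt; apply/orP; left; apply/eqP.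
by apply: eq_bigr => i _; rewrite subSS subKn// -ltnS.
Qed.

Lemma tail_quotient_cvg q (e : R) : nrm q < 1 -> 0 < e -> exists N0, forall N, (N0 <= N)%N ->
  nrm (pser (tail_quotient N) q - 1) < e.
Proof.
move=> q1 e0; pose rho := (1 + nrm q) / 2.
have r0 : 0 < rho by rewrite divr_gt0// ltr_wpDr ?nrm_ge0.
have r1 : rho < 1 by rewrite /rho; lra.
have qr : nrm q < rho by rewrite /rho; lra.
have r01 : 0 < rho < 1 by rewrite r0.
have [N1 HN1] := tail_quotient_bound r01.
pose t := nrm q / rho.
have t0 : 0 <= t by rewrite divr_ge0 ?nrm_ge0// ltW.
have t1 : t < 1 by rewrite ltr_pdivrMr// mul1r.
have t01 : 0 <= t < 1 by rewrite t0.
pose B := rsum setT (fun n => t ^+ n).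
have B0 : 0 <= B.
  by rewrite /B possum_rsum ?possum_ge0//; [move=> n; exact: exprn_ge0|move=> n; exact: exprn_ge0|exact: rsummable_geo].
(* The tail is at most [t ^+ m * B] with [m = N.*2.+2], and [m * t ^+ m <= (1 - t)^-1] by
   [natmul_geo_le]; so it is below [e] once [m] exceeds [K]. *)
pose K := (1 - t)^-1 * B / e.
have K0 : 0 <= K.
  by apply: divr_ge0; [apply: mulr_ge0 => //; rewrite invr_ge0 subr_ge0 ltW|exact: ltW].
exists (maxn N1 (Num.bound K)) => N; rewrite geq_max => /andP[N1N KN].
have M0 : (0 < N.*2.+2)%N by [].
have [cx _ _] := tail_quotientP N.
rewrite /pser (csum_split_nat N.*2.+2 (cx q q1)) big_ord_recl/= tail_quotient0 expr0 mulr1.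
rewrite big1 ?addr0; last first.
  by move=> i _; rewrite tail_quotient_small ?mul0r//; have := ltn_ord i; rewrite /bump/=; lia.
rewrite addrAC subrr add0r.
have sN := csummable_shift N.*2.+2 (cx q q1).
have st := rsummableZ (t ^+ N.*2.+2) (rsummable_geo t01).
apply: le_lt_trans (nrm_csum_le sN) _.
apply: (@le_lt_trans _ _ (t ^+ N.*2.+2 * B)).
  rewrite -rsumZ; last exact: rsummable_geo.
  apply: le_rsum => // n _.
  rewrite nrmM nrmX -exprD expr_div_n mulrC ler_wpM2l ?exprn_ge0 ?nrm_ge0//.
  exact: HN1.
have NR : 0 < (N.*2.+2)%:R :> R by rewrite ltr0n.
rewrite -(ltr_pM2l NR) mulrA.
apply: (@le_lt_trans _ _ ((1 - t)^-1 * B)); first by rewrite ler_wpM2r// natmul_geo_le.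
rewrite -ltr_pdivrMr//; apply: lt_le_trans (archi_boundP K0) _.
rewrite ler_nat; apply: leq_trans KN _; by rewrite -addnn -!addnS leq_addr.
Qed.

Lemma prod_factor_value M q : \prod_(1 <= d < M.*2.+1) factor_value d q ^+ 4 =
  (\prod_(1 <= n < M.+1) ((1 - (q ^+ 2) ^+ (2 * n)) ^+ 4 / (1 - (q ^+ 2) ^+ (2 * n - 1)) ^+ 4))^-1.
Proof.
elim: M => [|M IH]; first by rewrite !big_nil invr1.
rewrite doubleS 2?big_nat_recr//= IH [in RHS]big_nat_recr//= invfM -mulrA; congr (_ * _).
rewrite /factor_value /= odd_double /= invfM invrK mulrC -!exprVn.
rewrite -!(exprM q) (_ : 2 * M.*2.+2 = 2 * (2 * M.+1))%N; last by lia.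
by rewrite (_ : 2 * M.*2.+1 = 2 * (2 * M.+1 - 1))%N //; lia.
Qed.

Lemma odd_productX k (Q : C) N : odd_product k (Q : C^o) N = (odd_product 1 (Q : C^o) N) ^+ k.
Proof.
rewrite /odd_product -prodrXl; apply: eq_bigr => n _.
by rewrite expr_div_n -!exprM muln1.
Qed.

Lemma cvg_expn (K : numFieldType) (T : Type) (F : set_system T) {FF : Filter F}
    (f : T -> K^o) (l : K^o) k :
  f x @[x --> F] --> l -> (f x ^+ k : K^o) @[x --> F] --> (l ^+ k : K^o).
Proof.
move=> fl; elim: k => [|k IH].
  by rewrite expr0 (_ : (fun x => f x ^+ 0) = (cst 1))//; exact: cvg_cst.
rewrite exprS (_ : (fun x => f x ^+ k.+1) = (fun x => f x * f x ^+ k : K^o)).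
  by apply: cvgM; [exact: fl|exact: IH].
by apply/funext => x; rewrite exprS.
Qed.

(** [y N] is a value at [q] of what remains of [L(q) / q] after division by a partial product in
    [Q]; it tends to 1, so the partial products tend to [U]. *)
Lemma odd_product_cvg k (q Q : C) : nrm Q < 1 -> q ^+ 2 = Q ->
  odd_product k (Q : C^o) @ \oo --> ((pser odd_lambert_coef q) ^+ k : C^o).
Proof.
move=> Q1 qQ; have q1 : nrm q < 1.
  by rewrite ltNge; apply/negP => H; move: Q1; rewrite -qQ nrmX ltNge exprn_ege1.
set U := pser odd_lambert_coef q.
pose y N : C^o := U / odd_product 1 (Q : C^o) N.+1.
have yE M : y M = pser (tail_quotient M.*2) q.
  rewrite tail_quotient_val// prod_factor_value /y /odd_product -qQ; congr (_ / _).
have y1 : y @ \oo --> (1 : C^o).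
  apply/cvgC_nrm => e e0; have [N0 HN] := tail_quotient_cvg q1 e0.
  exists N0 => // N /= N0N; rewrite -/(y N) yE; apply: HN.
  by rewrite -addnn; apply: leq_trans N0N (leq_addr _ _).
have P0 N : odd_product 1 (Q : C^o) N != 0.
  rewrite /odd_product prodf_seq_neq0; apply/allP => n; rewrite mem_index_iota => /andP[n0 _] /=.
  by rewrite mulf_neq0 ?invr_eq0 ?expf_neq0 ?nrm_lt1_neq0 ?qX_lt1//; lia.
(* If [U] were 0, [y] would be identically 0, against its limit 1. This is what allows partial
   products to be recovered as [U / y]. *)
have U0 : U != 0.
  apply/eqP => U0; have /cvgC_nrm /(_ 2^-1) := y1; rewrite invr_gt0 => /(_ (ltr0n _ 2)) [N _ /(_ N)].
  by rewrite /= leqnn /y U0 mul0r sub0r nrmN nrm1 => /(_ isT); rewrite ltNge invf_le1 ?ler1n.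
have P1 : odd_product 1 (Q : C^o) @ \oo --> (U : C^o).
  rewrite -(cvg_shiftn 1).
  have -> : [sequence odd_product 1 (Q : C^o) (n + 1)]_n = fun N => U * (y N)^-1 : C^o.
    apply/funext => N /=; rewrite /y addn1 invfM invrK mulrA mulfV ?mul1r//.
  have H : (fun N => U * (y N)^-1 : C^o) @ \oo --> (U * 1^-1 : C^o).
    apply: cvgM; first exact: cvg_cst.
    by apply: cvgV => //; exact: oner_neq0.
  by move: H; rewrite invr1 mulr1.
rewrite (_ : odd_product k (Q : C^o) = fun N => odd_product 1 (Q : C^o) N ^+ k); last first.
  by apply/funext => N; rewrite odd_productX.
refine (@cvg_expn (R[i]) nat _ _ (odd_product 1 (Q : C^o)) (U : C^o) k P1).
Qed.

(** The even exponent turns [q ^+ (2 * j)] into [Q ^+ j], and [L(q)^2] is a series in [Q]: the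
    choice of the square root [q] does not matter. *)
Lemma odd_product_lambert j (q Q : C) : nrm Q < 1 -> q ^+ 2 = Q ->
  Q ^+ j * (pser odd_lambert_coef q) ^+ (2 * j) = lambert wt_cube Q ^+ j.
Proof.
move=> Q1 qQ; have q1 : nrm q < 1.
  by rewrite ltNge; apply/negP => H; move: Q1; rewrite -qQ nrmX ltNge exprn_ege1.
by rewrite -qQ -lambert_sq_identity// -pser_odd_lambert_coef// exprM -exprMn -exprMn.
Qed.

End ProductIdentity.

(** * The complex exponential and its power series *)

Section ComplexExp.
Context {R : realType}.
Local Notation C := R[i].
Implicit Types z w : C.

Lemma expCD z w : expC (z + w : C^o) = expC (z : C^o) * expC (w : C^o) :> C.
Proof.
case: z w => [a b] [c d]; rewrite /expC /= expRD cosD sinD; simpc.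
by congr (_ +i* _); ring.
Qed.

Lemma expC0 : expC (0 : C^o) = 1 :> C.
Proof. by rewrite /expC /= expR0 cos0 sin0 mulr1 mulr0. Qed.

Lemma expCN z : expC (- z : C^o) * expC (z : C^o) = 1 :> C.
Proof. by rewrite -expCD addNr expC0. Qed.

Lemma nrm_expC z : nrm (expC (z : C^o)) = expR (complex.Re z).
Proof.
apply: (@pexpIrn _ 2) => //; rewrite ?nnegrE ?nrm_ge0 ?expR_ge0//.
by rewrite nrm_sqr /expC /= !exprMn -mulrDr cos2Dsin2 mulr1.
Qed.

Lemma expC_neq0 z : expC (z : C^o) != 0 :> C.
Proof. by rewrite -nrm_gt0 nrm_expC expR_gt0. Qed.

Lemma expCMn z n : expC (n%:R * z : C^o) = expC (z : C^o) ^+ n :> C.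
Proof.
elim: n => [|n IH]; first by rewrite mul0r expC0.
by rewrite -natr1 mulrDl mul1r expCD IH exprSr.
Qed.

Definition expser z : C := csum setT (fun n => z ^+ n / n`!%:R).

Lemma rsummable_exp (x : R) : 0 <= x -> rsummable setT (fun n => x ^+ n / n`!%:R).
Proof.
move=> x0; apply: (@rsummable_bounded _ _ (expR x)) => n.
under eq_bigr do rewrite ger0_norm ?divr_ge0 ?exprn_ge0//.
rewrite -[leLHS]/(series (exp_coeff x) n); apply: nondecreasing_cvgn_le.
  by apply: nondecreasing_series => k _ _; rewrite /exp_coeff divr_ge0 ?exprn_ge0.
exact: is_cvg_series_exp_coeff.
Qed.

Lemma csummable_exp z : csummable setT (fun n => z ^+ n / n`!%:R).
Proof.
apply: csummable_le (rsummable_exp (nrm_ge0 z)) => n _.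
by rewrite nrmM nrmX nrmV nrm_nat.
Qed.

Lemma expserD z w : expser (z + w) = expser z * expser w.
Proof.
have cv u : pser_cv (fun n => u ^+ n / n`!%:R) (1 : C).
  by apply: eq_csummable (csummable_exp u) => n _; rewrite expr1n mulr1.
have E u : expser u = pser (fun n => u ^+ n / n`!%:R) 1.
  by apply: eq_csum => n _; rewrite expr1n mulr1.
rewrite !E (pser_mul (cv z) (cv w)).2; apply: eq_csum => n _; congr (_ * _).
rewrite /cprod exprDn mulr_suml; rewrite (reindex_inj rev_ord_inj)/=.
apply: eq_bigr => i _; rewrite subSS subKn -1?ltnS//.
have fn : (n`!%:R : C) != 0 by rewrite pnatr_eq0 -lt0n fact_gt0.
have fi : (i`!%:R : C) != 0 by rewrite pnatr_eq0 -lt0n fact_gt0.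
have fni : ((n - i)`!%:R : C) != 0 by rewrite pnatr_eq0 -lt0n fact_gt0.
have : (n`!%:R : C) = 'C(n, i)%:R * (i`!%:R * (n - i)`!%:R).
  by rewrite -!natrM bin_fact// -ltnS.
move=> H; have cn : ('C(n, i)%:R : C) != 0.
  by rewrite pnatr_eq0 -lt0n bin_gt0 -ltnS.
rewrite -mulr_natr bin_sub -1?ltnS// H; field.
by rewrite fi fni cn.
Qed.

Lemma csum_re_lim (f : nat -> C) (g h : R^nat) a b : csummable setT f ->
  (forall n, f n = g n +i* h n) -> series g @ \oo --> a -> series h @ \oo --> b ->
  csum setT f = a +i* b.
Proof.
move=> sf fgh ga hb.
have Rg := cvg_series_rsum (csummable_Re sf).
have Ih := cvg_series_rsum (csummable_Im sf).
rewrite /csum; congr (_ +i* _).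
  apply: (cvg_unique _ Rg) => //.
  by rewrite (_ : (fun i => complex.Re (f i)) = g)//; apply/funext => n; rewrite fgh.
apply: (cvg_unique _ Ih) => //.
by rewrite (_ : (fun i => complex.Im (f i)) = h)//; apply/funext => n; rewrite fgh.
Qed.

(** The addition formula reduces this to real and to purely imaginary arguments, where the real
    series of the exponential, cosine and sine apply. *)
Lemma expserE z : expser z = expC (z : C^o).
Proof.
have -> : z = (complex.Re z)%:C + (0 +i* complex.Im z).
  by case: z => a b; simpc.
rewrite expserD expCD; case: z => x y /=; congr (_ * _).
  rewrite /expC /= cos0 sin0 mulr1 mulr0.
  apply: (csum_re_lim (g := exp_coeff x) (h := fun=> 0) (csummable_exp _)).
  - by move=> n; rewrite -rmorphXn -(rmorph_nat (real_complex R)) -fmorphV -rmorphM.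
  - by rewrite /expR; exact: is_cvg_series_exp_coeff.
  - rewrite (_ : series (fun=> 0) = cst 0); first exact: cvg_cst.
    by apply/funext => n; rewrite /series/= big1.
rewrite /expC /= expR0 !mul1r.
apply: (csum_re_lim (g := cos_coeff y) (h := sin_coeff y) (csummable_exp _)).
- move=> n; have -> : 0 +i* y = 'i%C * y%:C by simpc.
  rewrite exprMn -rmorphXn -(rmorph_nat (real_complex R)) -mulrA -fmorphV -rmorphM.
  have iE : 'i%C ^+ n = (~~ odd n)%:R * (-1) ^+ n./2 +i* ((odd n)%:R * (-1) ^+ n.-1./2) :> C.
    rewrite -[in LHS](odd_double_half n) exprD -muln2 mulnC exprM sqr_i.
    have s1 m : (-1 : C) ^+ m = ((-1) ^+ m)%:C by rewrite rmorphXn rmorphN rmorph1.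
    rewrite s1; case: n => [|n] /=; first by rewrite mulr1 mul0r; simpc.
    case: (boolP (odd n)) => no /=.
      by rewrite [X in X * _](_ : _ = 1)// !mul1r mul0r.
    by rewrite uphalf_half (negbTE no) [X in X * _](_ : _ = 'i%C)// mul0r mul1r add0n; simpc.
  rewrite iE /cos_coeff /sin_coeff; simpc.
  by congr (_ +i* _); rewrite mulrA.
- by rewrite unlock; exact: is_cvg_series_cos_coeff.
- by rewrite unlock; exact: is_cvg_series_sin_coeff.
Qed.

(** The remainder is dominated by [nrm z ^+ N] times the exponential series, since
    [(N + n)! >= n!]. *)
Lemma expC_taylor z N :
  nrm (expC (z : C^o) - \sum_(i < N) z ^+ i / i`!%:R) <= nrm z ^+ N * expR (nrm z).
Proof.
rewrite -expserE /expser (csum_split_nat N (csummable_exp z)) addrAC subrr add0r.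
have sN := csummable_shift N (csummable_exp z).
apply: le_trans (nrm_csum_le sN) _.
have sr := rsummable_exp (nrm_ge0 z).
have -> : expR (nrm z) = rsum setT (fun n => nrm z ^+ n / n`!%:R).
  have H1 : series (exp_coeff (nrm z)) @ \oo --> expR (nrm z).
    exact: is_cvg_series_exp_coeff.
  exact: (cvg_unique _ H1 (cvg_series_rsum sr)).
rewrite -rsumZ//; apply: le_rsum => //.
  exact: rsummableZ.
move=> n _; rewrite nrmM nrmX nrmV nrm_nat exprD -mulrA !ler_wpM2l ?exprn_ge0 ?nrm_ge0//.
rewrite lef_pV2 ?posrE ?ltr0n ?fact_gt0// ler_nat.
by elim: N {sN} => // N IH; rewrite addSn factS (leq_trans IH)// leq_pmull.
Qed.

End ComplexExp.

(** * Partial fractions and Lipschitz' formula *)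

Section IntegerSums.
Context {R : realType}.
Local Notation C := R[i].

Lemma bij_Posz : set_bij setT [set r : int | 0 <= r] Posz.
Proof.
apply: (@can_set_bij _ _ _ _ _ (fun r : int => `|r|%N)) => //=; by [case].
Qed.

Lemma bij_Negz : set_bij setT [set r : int | ~ 0 <= r] Negz.
Proof.
by apply: (@can_set_bij _ _ _ _ _ (fun r : int => `|r|%N.-1)) => //= -[].
Qed.

Lemma rsummable_int (f : int -> R) : rsummable setT (f \o Posz) ->
  rsummable setT (f \o Negz) -> rsummable setT f.
Proof.
move=> /(rsummable_reindex f bij_Posz) fP /(rsummable_reindex f bij_Negz) fN.
rewrite /rsummable (esumID [set r : int | 0 <= r])//.
by rewrite !setTI; apply: lte_add_pinfty.
Qed.

Lemma rsummable_nat_invsq : rsummable setT (fun n : nat => (1 + n%:R ^+ 2)^-1 : R).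
Proof.
apply: (@rsummable_bounded _ _ 4) => n.
(* A telescoping majorant: [(i + 1) (i + 2) <= 4 (1 + i^2)]. *)
apply: (@le_trans _ _ (\sum_(0 <= i < n) 4 * ((i.+1%:R)^-1 - (i.+2%:R)^-1))).
  apply: ler_sum => i _; have i0 : 0 <= i%:R :> R by [].
  have p : 0 < 1 + i%:R ^+ 2 :> R by rewrite ltr_wpDr// sqr_ge0.
  rewrite gtr0_norm ?invr_gt0// -[i.+2]addn2 -[i.+1]addn1 !natrD.
  have -> : 4 * ((i%:R + 1)^-1 - (i%:R + 2)^-1) = 4 / ((i%:R + 1) * (i%:R + 2)) :> R.
    by field; apply/andP; split; apply: lt0r_neq0; lra.
  rewrite ler_pdivlMr; last by rewrite mulr_gt0; lra.
  rewrite mulrC ler_pdivrMr//.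
  have := sqr_ge0 (i%:R - 2^-1 : R); nra.
rewrite -mulr_sumr -[leRHS]mulr1 ler_wpM2l//.
have -> : \sum_(0 <= i < n) ((i.+1%:R)^-1 - (i.+2%:R)^-1) = 1 - (n.+1%:R)^-1 :> R.
  elim: n => [|n IH]; first by rewrite big_nil invr1 subrr.
  by rewrite big_nat_recr//= IH; ring.
by rewrite gerBl invr_ge0.
Qed.

Lemma rsummable_int_invsq : rsummable setT (fun r : int => (1 + r%:~R ^+ 2)^-1 : R).
Proof.
apply: rsummable_int; first exact: rsummable_nat_invsq.
apply: rsummable_le rsummable_nat_invsq => n _ /=.
rewrite NegzE mulrNz sqrrN ger0_norm ?invr_ge0 ?addr_ge0 ?sqr_ge0//.
rewrite lef_pV2 ?posrE ?ltr_wpDr ?sqr_ge0// lerD2l.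
by rewrite -natrX -[leRHS]natrX ler_nat leq_exp2r.
Qed.

Lemma Re_addz (s : C) (r : int) : complex.Re (s + r%:~R) = complex.Re s + r%:~R.
Proof. by rewrite -(rmorph_int (real_complex R)); case: s. Qed.

Lemma Im_addz (s : C) (r : int) : complex.Im (s + r%:~R) = complex.Im s.
Proof. by rewrite -(rmorph_int (real_complex R)); case: s => a b /=; rewrite addr0. Qed.

Lemma uhp_neq0 (s : C) : 0 < complex.Im s -> s != 0.
Proof. by move=> s0; apply: contraTneq s0 => ->; rewrite ltxx. Qed.

Lemma Im_le_nrm_uhp (s : C) : complex.Im s <= nrm s.
Proof. exact: le_trans (ler_norm _) (Im_le_nrm s). Qed.

(** With [x], [y] the two parts of [s], this comes from [1 + t^2 <= 2 (x + t)^2 + (2 x^2 + 1)],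
    where the last bracket is written as a multiple of [y^2]. *)
Lemma invsq_le_shift (s : C) (r : int) : 0 < complex.Im s ->
  (nrm (s + r%:~R) ^+ 2)^-1 <=
  (2 + (2 * complex.Re s ^+ 2 + 1) / complex.Im s ^+ 2) * (1 + r%:~R ^+ 2)^-1.
Proof.
move=> s0; set x := complex.Re s; set y := complex.Im s; rewrite -/y in s0.
have y2 : 0 < y ^+ 2 by rewrite exprn_gt0.
rewrite nrm_sqr Re_addz Im_addz -/x -/y; set t : R := r%:~R.
have p1 : 0 < (x + t) ^+ 2 + y ^+ 2 by rewrite ltr_wpDl// sqr_ge0.
have p2 : 0 < 1 + t ^+ 2 by rewrite ltr_wpDr// sqr_ge0.
rewrite ler_pdivlMr// mulrC ler_pdivrMr//.
set K := (2 * x ^+ 2 + 1) / y ^+ 2.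
have KE : K * y ^+ 2 = 2 * x ^+ 2 + 1 by rewrite divfK// gt_eqF.
have K0 : 0 <= K by rewrite divr_ge0 ?(ltW y2)// addr_ge0// mulr_ge0// sqr_ge0.
have := mulr_ge0 K0 (sqr_ge0 (x + t)); have := sqr_ge0 (t + 2 * x); nra.
Qed.

Definition row_sum (w : nat) (s : C) : C := csum setT (fun r : int => ((s + r%:~R) ^+ w)^-1).

Lemma csummable_row_sum w (s : C) : (2 <= w)%N -> 0 < complex.Im s ->
  csummable setT (fun r : int => ((s + r%:~R) ^+ w)^-1).
Proof.
move=> w2 s0; pose K := 2 + (2 * complex.Re s ^+ 2 + 1) / complex.Im s ^+ 2.
apply: csummable_le (rsummableZ ((complex.Im s ^+ (w - 2))^-1 * K) rsummable_int_invsq).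
move=> r _; rewrite nrmV nrmX -{1}(subnK w2) exprD invfM -mulrA.
have p : 0 < nrm (s + r%:~R) by rewrite nrm_gt0 uhp_neq0// Im_addz.
apply: ler_pM; rewrite ?invr_ge0 ?exprn_ge0 ?(ltW p)//; last exact: invsq_le_shift.
rewrite lef_pV2 ?posrE ?exprn_gt0// lerXn2r ?nnegrE ?(ltW s0) ?(ltW p)//.
by rewrite -(Im_addz s r) Im_le_nrm_uhp.
Qed.

Lemma bij_addz (n : int) : set_bij setT setT (fun r : int => n + r).
Proof.
apply: (@can_set_bij _ _ _ _ _ (fun r => r - n)) => //= x _; ring.
Qed.

Lemma row_sum_period w (s : C) (n : int) : row_sum w (s + n%:~R) = row_sum w s.
Proof.
rewrite /row_sum [RHS](csum_reindex _ (bij_addz n)); apply: eq_csum => r _ /=.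
by rewrite rmorphD addrA.
Qed.

(** Even and odd [r] give the two terms on the left, each scaled by [2^2]. *)
Lemma row_sum_dup (s : C) : 0 < complex.Im s -> row_sum 2 (s / 2) + row_sum 2 ((s + 1) / 2) = 4 * row_sum 2 s.
Proof.
move=> s0; have s2 := csummable_row_sum (leqnn 2) s0.
have bE : set_bij setT [set r : int | (2 %| r)%Z] (fun r => 2 * r).
  apply: (@can_set_bij _ _ _ _ _ (fun r => (r %/ 2)%Z)) => //=.
  - by move=> x _; rewrite dvdz_mulr.
  - by move=> x _; rewrite mulKz.
  - by move=> y /= y2; rewrite mulrC divzK.
have bO : set_bij setT [set r : int | ~ (2 %| r)%Z] (fun r => 2 * r + 1).
  apply: (@can_set_bij _ _ _ _ _ (fun r => (r %/ 2)%Z)) => //=.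
  - by move=> x _; apply/negP; lia.
  - by move=> x _; lia.
  - by move=> y /negP y2; lia.
rewrite /row_sum (csumID [set r : int | (2 %| r)%Z] s2) !setTI mulrDr.
rewrite (csum_reindex _ bE) (csum_reindex _ bO).
have sE : csummable setT (fun r : int => ((s + (2 * r)%:~R) ^+ 2)^-1).
  apply/(csummable_reindex (fun r : int => ((s + r%:~R) ^+ 2)^-1) bE).
  exact: csummable_sub s2.
have sO : csummable setT (fun r : int => ((s + (2 * r + 1)%:~R) ^+ 2)^-1).
  apply/(csummable_reindex (fun r : int => ((s + r%:~R) ^+ 2)^-1) bO).
  exact: csummable_sub s2.
rewrite -!csumZ//; congr (_ + _); apply: eq_csum => r _ /=.
  have E : s / 2 + r%:~R = (s + (2 * r)%:~R) / 2 by rewrite rmorphM; field.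
  by rewrite E expr_div_n invfM invrK mulrC -natrX.
have E : (s + 1) / 2 + r%:~R = (s + (2 * r + 1)%:~R) / 2 by rewrite rmorphD rmorphM; field.
by rewrite E expr_div_n invfM invrK mulrC -natrX.
Qed.

Lemma nomeD (s t : C) : nome (s + t : C^o) = nome (s : C^o) * nome (t : C^o) :> C.
Proof. by rewrite /nome mulrDr expCD. Qed.

Lemma twopiE (s : C) : (2 * pi)%:C * 'i%C * s =
  (- (2 * pi * complex.Im s)) +i* (2 * pi * complex.Re s) :> C.
Proof. by case: s => a b; simpc => /=; congr (_ +i* _); ring. Qed.

Lemma nomeE (s : C) : nome (s : C^o) =
  (expR (- (2 * pi * complex.Im s)) * cos (2 * pi * complex.Re s)) +i*
  (expR (- (2 * pi * complex.Im s)) * sin (2 * pi * complex.Re s)) :> C.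
Proof. by rewrite /nome twopiE. Qed.

Lemma nrm_nome (s : C) : nrm (nome (s : C^o)) = expR (- (2 * pi * complex.Im s)).
Proof. by rewrite /nome nrm_expC twopiE. Qed.

Lemma nome_lt1 (s : C) : 0 < complex.Im s -> nrm (nome (s : C^o)) < 1.
Proof.
by move=> s0; rewrite nrm_nome expR_lt1 oppr_lt0 mulr_gt0// mulr_gt0// pi_gt0.
Qed.

Lemma nome_neq0 (s : C) : nome (s : C^o) != 0 :> C.
Proof. exact: expC_neq0. Qed.

Lemma nomeMn n (s : C) : nome (n%:R * s : C^o) = nome (s : C^o) ^+ n :> C.
Proof. by rewrite /nome mulrCA expCMn. Qed.

Lemma nome_half : nome (2^-1 : C^o) = -1 :> C.
Proof.
have -> : (2^-1 : C) = (2^-1)%:C by rewrite fmorphV rmorph_nat.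
rewrite nomeE /= mulr0 oppr0 expR0 !mul1r mulrAC mulfV ?pnatr_eq0// mul1r cospi sinpi.
by rewrite complexr0 rmorphN rmorph1.
Qed.

Lemma nome1 : nome (1 : C^o) = 1 :> C.
Proof.
have E : (2%:R * 2^-1 : C) = 1 by rewrite mulfV// pnatr_eq0.
by rewrite -{1}E nomeMn nome_half sqrrN expr1n.
Qed.

Lemma nome_int (n : int) : nome (n%:~R : C^o) = 1 :> C.
Proof.
have H (m : nat) : nome (m%:R : C^o) = 1 :> C.
  by rewrite -[m%:R]mulr1 nomeMn nome1 expr1n.
case: n => n; first exact: H.
rewrite NegzE mulrNz; apply: (mulIf (nome_neq0 (n.+1%:R))).
by rewrite -nomeD addNr mul1r H; exact: (H 0%N).
Qed.

Lemma nome_period (s : C) (n : int) : nome (s + n%:~R : C^o) = nome (s : C^o) :> C.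
Proof. by rewrite nomeD nome_int mulr1. Qed.

Lemma sin_lower : exists2 k : R, 0 < k & forall t, 0 <= t <= pi / 2 -> k * t <= sin t.
Proof.
have c1 := @cos1_gt0 R; have p2 := @pihalf_lt2 R; have p1 := @pihalf_ge1 R.
have pi2 := @pi_ge2 R.
have cl (c : R) : 0 <= c <= 1 -> cos 1 <= cos c.
  move=> /andP[c0 c1']; have [->//|cn] := eqVneq c 1.
  apply/ltW; rewrite ltr_cos ?in_itv/=; try lra.
have H (t : R) : 0 <= t <= 1 -> cos 1 * t <= sin t.
  move=> /andP[t0 t1]; have [c] := @MVT_segment R sin cos 0 t t0
    (fun x _ => is_derive_sin x) (continuous_subspaceT (@continuous_sin R)).
  rewrite in_itv/= sin0 !subr0 => /andP[c0 ct] ->.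
  by rewrite ler_wpM2r// cl// c0 (le_trans ct).
(* On [[0, 1]] the mean value theorem gives [sin t >= t * cos 1]. On [[1, pi / 2]] sine increases
   and [t < 2], which costs the factor [1 / 2]. *)
exists (cos 1 / 2) => [|t /andP[t0 tp]]; first by rewrite divr_gt0.
have [t1|t1] := leP t 1.
  by apply: le_trans (H t _); rewrite ?t0 ?t1//; nra.
have s1 : cos (1 : R) * 1 <= sin (1 : R) by apply: H; rewrite ler01 lexx.
rewrite mulr1 in s1.
have st : sin 1 <= sin t.
  by apply/ltW; rewrite ltr_sin// ?in_itv/=; lra.
have := @cos_le1 R 1; nra.
Qed.

(** With [rho = exp (- 2 pi y)], the square of the modulus is [(1 - rho)^2 + 4 rho sin (pi x)^2].
    The first term controls [y], the second controls [x] because [|x| <= 1/2] keeps [pi x] where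
    sine is bounded below linearly. The bound serves both near the double pole and in Stolz
    regions. *)
Lemma nome_sub1_lower : exists2 c : R, 0 < c & forall s : C,
  `|complex.Re s| <= 2^-1 -> 0 < complex.Im s <= 1 ->
  c * nrm s <= nrm (1 - nome (s : C^o)).
Proof.
have [k k0 sinl] := sin_lower.
have p0 := @pi_gt0 R; have pi2 := @pi_ge2 R.
pose r0 : R := expR (- (2 * pi)).
have r00 : 0 < r0 by exact: expR_gt0.
have r01 : r0 <= 1 by rewrite -expR0 ler_expR; lra.
pose m := Num.min 1 k.
have m0 : 0 < m by rewrite lt_min k0 ltr01.
have m1 : m <= 1 by rewrite ge_min lexx.
have mk : m <= k by rewrite ge_min lexx orbT.
exists (r0 * m); first by rewrite mulr_gt0.
move=> s; set x := complex.Re s; set y := complex.Im s => xh /andP[y0 y1].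
have rm0 : 0 <= r0 * m by apply: mulr_ge0; exact: ltW.
rewrite -(@ler_pXn2r _ 2) ?nnegrE ?nrm_ge0//; last exact: mulr_ge0 rm0 (nrm_ge0 s).
rewrite exprMn nrm_sqr -/x -/y.
pose rho := expR (- (2 * pi * y)).
have rr : r0 <= rho by rewrite /r0 /rho ler_expR lerN2 -[leRHS]mulr1 ler_wpM2l//; lra.
have rho1 : 2 * pi * y * rho <= 1 - rho.
  have := expR_ge1Dx (2 * pi * y); have : rho * expR (2 * pi * y) = 1 by rewrite /rho -expRD addNr expR0.
  have : 0 < rho by exact: expR_gt0.
  nra.
pose S := sin (pi * x).
have xS : k * (pi * `|x|) <= `|S|.
  have : k * (pi * `|x|) <= sin (pi * `|x|).
    by apply: sinl; rewrite mulr_ge0 ?(ltW p0)//= ler_wpM2l// ltW.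
  move=> /le_trans; apply; rewrite /S.
  have [x0|x0] := leP 0 x; first by rewrite ger0_norm// ler_norm.
  by rewrite ltr0_norm// mulrN sinN -normrN ler_norm.
have E : nrm (1 - nome (s : C^o)) ^+ 2 = (1 - rho) ^+ 2 + 4 * rho * S ^+ 2.
  rewrite nrm_sqr nomeE -/rho -/x -/y /=.
  have -> : 2 * pi * x = (pi * x) *+ 2 by rewrite [RHS]mulr2n; ring.
  rewrite cos_mulr2n sin_mulr2n -/S; have := cos2Dsin2 (pi * x); rewrite -/S.
  set Co := cos (pi * x) => cs.
  have -> : Co ^+ 2 = 1 - S ^+ 2 by rewrite -cs addrK.
  have E2 : (Co * S *+ 2) ^+ 2 = 4 * ((1 - S ^+ 2) * S ^+ 2).
    have -> : 1 - S ^+ 2 = Co ^+ 2 by rewrite -cs addrK.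
    by rewrite -mulr_natl; ring.
  rewrite sub0r sqrrN exprMn E2 -mulr_natl; ring.
rewrite E.
have S2 : (k * pi) ^+ 2 * x ^+ 2 <= S ^+ 2.
  rewrite -[S ^+ 2]real_normK ?num_real// -[x ^+ 2]real_normK ?num_real// -exprMn.
  rewrite lerXn2r ?nnegrE//; first by rewrite !mulr_ge0// ltW.
  by rewrite -mulrA.
have r2 : (2 * pi * y * rho) ^+ 2 <= (1 - rho) ^+ 2.
  have rp : 0 < rho by exact: expR_gt0.
  rewrite lerXn2r ?nnegrE//; first by rewrite !mulr_ge0// ltW.
  by apply: le_trans rho1; rewrite !mulr_ge0// ltW.
have rp : 0 < rho by exact: expR_gt0.
have r0m : r0 * m <= rho by apply: le_trans rr; rewrite ler_piMr// ltW.
have Y : (r0 * m) ^+ 2 * y ^+ 2 <= (2 * pi * y * rho) ^+ 2.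
  rewrite -exprMn lerXn2r ?nnegrE//; first by rewrite !mulr_ge0// ltW.
    by rewrite !mulr_ge0// ltW.
  rewrite mulrC [2 * pi * y]mulrC -mulrA ler_wpM2l ?(ltW y0)//.
  by apply: le_trans r0m _; rewrite ler_peMl ?(ltW rp)//; lra.
have X : (r0 * m) ^+ 2 <= 4 * rho * (k * pi) ^+ 2.
  rewrite exprMn; apply: ler_pM; rewrite ?sqr_ge0//.
    apply: (@le_trans _ _ r0); first by rewrite expr2 ler_piMr// ltW.
    by apply: le_trans rr _; lra.
  rewrite lerXn2r ?nnegrE ?(ltW m0)// ?mulr_ge0 ?(ltW k0) ?(ltW p0)//.
  by apply: le_trans mk _; rewrite ler_peMr ?(ltW k0)//; lra.
have X2 : (r0 * m) ^+ 2 * x ^+ 2 <= 4 * rho * S ^+ 2.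
  apply: le_trans (ler_wpM2r (sqr_ge0 x) X) _.
  rewrite -[leLHS]mulrA; apply: ler_wpM2l S2.
  by apply: mulr_ge0 => //; exact: ltW.
by rewrite mulrDr addrC lerD// (le_trans Y).
Qed.

(* Since [e^s + e^-s - 2 - s^2 = O(s^4)], this is bounded near [0]. *)
Lemma expC_double_pole_bound (s : C) :
  nrm (s ^+ 2 * expC (s : C^o) - (1 - expC (s : C^o)) ^+ 2) <=
  2 * nrm s ^+ 4 * expR (2 * nrm s).
Proof.
set e := expC (s : C^o); pose e' : C := expC (- s : C^o).
have ee : e' * e = 1 by exact: expCN.
pose P (z : C) : C := \sum_(i < 4) z ^+ i / i`!%:R.
have PE : P s + P (- s) = 2 + s ^+ 2.
  rewrite /P !big_ord_recl !big_ord0 /= !factS fact0 /bump /= !add1n !muln1.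
  by rewrite !expr0 !expr1 !sqrrN !exprS !expr0; field.
have -> : s ^+ 2 * e - (1 - e) ^+ 2 = - e * ((e - P s) + (e' - P (- s))).
  have -> : - e * ((e - P s) + (e' - P (- s))) =
    - e ^+ 2 - e' * e + e * (P s + P (- s)) by ring.
  by rewrite PE ee; ring.
rewrite nrmM nrmN.
have e1 : nrm e <= expR (nrm s).
  by rewrite nrm_expC ler_expR; apply: le_trans (ler_norm _) (Re_le_nrm _).
have b1 := expC_taylor s 4; have b2 := expC_taylor (- s) 4.
rewrite nrmN in b2.
have -> : 2 * nrm s ^+ 4 * expR (2 * nrm s) =
    expR (nrm s) * (nrm s ^+ 4 * expR (nrm s) + nrm s ^+ 4 * expR (nrm s)).
  have -> : expR (2 * nrm s) = expR (nrm s) * expR (nrm s).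
    by rewrite -expRD; congr expR; ring.
  by ring.
apply: ler_pM; rewrite ?nrm_ge0//.
by apply: le_trans (ler_nrmD _ _) _; apply: lerD.
Qed.

(** This is [(pi / sin (pi s))^2] written in the nome. *)
Definition double_pole (s : C) : C :=
  ((2 * pi)%:C * 'i%C) ^+ 2 * (nome (s : C^o) / (1 - nome (s : C^o)) ^+ 2).

Lemma double_pole_period (s : C) (n : int) : double_pole (s + n%:~R) = double_pole s.
Proof. by rewrite /double_pole nome_period. Qed.

(** With [z = nome (s / 2)], replacing [s] by [s + 1] changes [z] into [- z]; the rest is the
    identity [z / (1 - z)^2 - z / (1 + z)^2 = 4 z^2 / (1 - z^2)^2]. *)
Lemma double_pole_dup (s : C) : 0 < complex.Im s ->
  double_pole (s / 2) + double_pole ((s + 1) / 2) = 4 * double_pole s.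
Proof.
move=> s0; pose z : C := nome (s / 2 : C^o).
have z2 : nome (s : C^o) = z ^+ 2 :> C.
  by rewrite /z -nomeMn; congr (nome _); field.
have zN : nome ((s + 1) / 2 : C^o) = - z :> C.
  by rewrite mulrDl mul1r nomeD nome_half mulrN1.
have h : 0 < complex.Im (s / 2).
  have -> : s / 2 = (2^-1)%:C * s by rewrite fmorphV rmorph_nat mulrC.
  by case: s s0 {z z2 zN} => a b /= b0; rewrite mul0r addr0 mulr_gt0// invr_gt0.
have z1 : nrm z < 1 := nome_lt1 h.
have n1 := nrm_lt1_neq0 z1.
have n2 : 1 + z != 0 by rewrite -[z]opprK nrm_lt1_neq0// nrmN.
have n3 : 1 - z ^+ 2 != 0 by rewrite nrm_lt1_neq0// qX_lt1.
rewrite /double_pole z2 zN -/z opprK; field.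
by rewrite n1 n2 n3.
Qed.

Lemma nrm_2pii : nrm ((2 * pi)%:C * 'i%C : C) = 2 * pi.
Proof.
rewrite nrmM nrm_real ger0_norm ?mulr_ge0 ?pi_ge0// /nrm normc_def /=.
by rewrite expr0n add0r expr1n sqrtr1 mulr1.
Qed.

Lemma twopii_neq0 : ((2 * pi)%:C * 'i%C : C) != 0.
Proof. by rewrite -nrm_gt0 nrm_2pii mulr_gt0// pi_gt0. Qed.

(* Both sides of the identity [row_sum 2 = double_pole] have the same double poles. *)
Lemma row_sum_double_pole_bounded : exists M : R, forall s : C, 0 < complex.Im s ->
  nrm (row_sum 2 s - double_pole s) <= M.
Proof.
have [c c0 cl] := nome_sub1_lower; have p0 := @pi_gt0 R.
(* [A] bounds the terms [r != 0] of the row. For the term [r = 0] minus [double_pole], [1 + B] is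
   the bound when [Im s > 1], and [D] the bound when [Im s <= 1]. *)
pose A := rsum setT (fun r : int => 8 * (1 + r%:~R ^+ 2)^-1 : R).
pose B : R := (2 * pi) ^+ 2 * (expR (- (2 * pi)) / (1 - expR (- (2 * pi))) ^+ 2).
pose D : R := 2 * (2 * pi) ^+ 4 * expR (2 * (2 * pi * 2)) / c ^+ 2.
exists (A + (1 + B + D)) => s.
wlog xh : s / `|complex.Re s| <= 2^-1 => [H s0|s0].
  pose n := Num.floor (complex.Re s + 2^-1).
  rewrite -(row_sum_period _ _ (- n)) -(double_pole_period _ (- n)).
  apply: H; last by rewrite Im_addz.
  rewrite Re_addz mulrNz; have := floor_itv (complex.Re s + 2^-1).
  rewrite -/n => /andP[n1 n2]; rewrite ler_norml; apply/andP; split; first lra.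
  by move: n2; rewrite rmorphD /= => n2; lra.
have s2 := csummable_row_sum (leqnn 2) s0.
have snz := uhp_neq0 s0.
have E : row_sum 2 s = (s ^+ 2)^-1 + csum (~` [set 0]) (fun r : int => ((s + r%:~R) ^+ 2)^-1).
  by rewrite /row_sum (csumID [set 0] s2) !setTI csum_set1 addr0.
have tail : nrm (csum (~` [set 0]) (fun r : int => ((s + r%:~R) ^+ 2)^-1)) <= A.
  have s2' := csummable_sub (@subsetT _ (~` [set (0 : int)])) s2.
  apply: le_trans (nrm_csum_le s2') _.
  apply: (@le_trans _ _ (rsum (~` [set 0]) (fun r : int => 8 * (1 + r%:~R ^+ 2)^-1 : R))).
    apply: le_rsum => //.
      exact: rsummable_sub (@subsetT _ _) (rsummableZ 8 rsummable_int_invsq).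
    move=> r /= r0; rewrite nrmV nrmX nrm_sqr Re_addz Im_addz.
    have r1 : 1 <= `|r%:~R| :> R.
      by rewrite -intr_norm ler1z; move/eqP: r0; lia.
    have r2 : 1 <= r%:~R ^+ 2 :> R by rewrite -[r%:~R ^+ 2]real_normK ?num_real// exprn_ege1.
    have p1 : 0 < 1 + r%:~R ^+ 2 :> R by lra.
    (* Here [|Re s| <= 1/2 <= |r| / 2]; together with [1 + r^2 <= 2 r^2] this gives the constant
       8. *)
    have xr : `|r%:~R| / 2 <= `|complex.Re s + r%:~R|.
      have := ler_normD (complex.Re s + r%:~R) (- complex.Re s).
      by rewrite addrAC subrr add0r normrN; lra.
    have xr2 : r%:~R ^+ 2 / 4 <= (complex.Re s + r%:~R) ^+ 2.
      rewrite -[r%:~R ^+ 2]real_normK ?num_real// -[leRHS]real_normK ?num_real//.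
      have -> : `|r%:~R| ^+ 2 / 4 = (`|r%:~R| / 2) ^+ 2 :> R by field.
      by rewrite lerXn2r// nnegrE// divr_ge0.
    have y2 := sqr_ge0 (complex.Im s).
    rewrite -[8]invrK -invfM lef_pV2 ?posrE; [lra|lra|].
    by rewrite mulr_gt0// invr_gt0.
  rewrite /A [leRHS](rsumID [set 0] (rsummableZ 8 rsummable_int_invsq)) !setTI.
  by rewrite lerDr rsum_set1 mulr_ge0// invr_ge0 addr_ge0// sqr_ge0.
have e0 : nrm (nome (s : C^o)) = expR (- (2 * pi * complex.Im s)) := nrm_nome s.
have n1 := nrm_lt1_neq0 (nome_lt1 s0).
have rho1 : expR (- (2 * pi)) < 1 :> R by rewrite expR_lt1 oppr_lt0 mulr_gt0.
have B0 : 0 <= B.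
  apply: mulr_ge0; first exact: sqr_ge0.
  by apply: divr_ge0; [exact: expR_ge0|exact: sqr_ge0].
have D0 : 0 <= D.
  apply: divr_ge0; last exact: sqr_ge0.
  apply: mulr_ge0; last exact: expR_ge0.
  by apply: mulr_ge0 => //; apply: exprn_ge0; apply: mulr_ge0 => //; exact: ltW.
suff main : nrm ((s ^+ 2)^-1 - double_pole s) <= 1 + B + D.
  rewrite E addrAC addrC; apply: le_trans (ler_nrmD _ _) _; exact: lerD.
have [y1|y1] := leP (complex.Im s) 1; last first.
  apply: le_trans (ler_nrmB _ _) _.
  have a1 : nrm ((s ^+ 2)^-1) <= 1.
    rewrite nrmV nrmX invf_le1 ?exprn_gt0 ?nrm_gt0// exprn_ege1//.
    by apply: le_trans (Im_le_nrm_uhp s); rewrite ltW.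
  have er : nrm (nome (s : C^o)) <= expR (- (2 * pi)).
    by rewrite e0 ler_expR lerN2 ler_peMr ?mulr_ge0 ?(ltW p0)// ltW.
  have a2 : nrm (double_pole s) <= B.
    rewrite /double_pole nrmM nrmX nrm_2pii ler_wpM2l ?sqr_ge0// nrmM nrmV nrmX.
    apply: ler_pM; rewrite ?nrm_ge0 ?invr_ge0 ?sqr_ge0//.
    have L : 1 - expR (- (2 * pi)) <= nrm (1 - nome (s : C^o)).
      have := ler_dist_nrm 1 (nome (s : C^o)); rewrite nrm1 => /(le_trans (ler_norm _)); lra.
    rewrite lef_pV2 ?posrE ?exprn_gt0 ?subr_gt0 ?nrm_gt0//.
    by rewrite lerXn2r ?nnegrE ?nrm_ge0// subr_ge0 ltW.
  by lra.
have L := cl s xh; rewrite s0 y1 in L; have {}L := L isT.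
have s_le2 : nrm s <= 2.
  apply: le_trans (nrm_le_ReIm s) _; rewrite [X in _ + X]gtr0_norm//; lra.
have sp : 0 < nrm s by rewrite nrm_gt0.
have -> : (s ^+ 2)^-1 - double_pole s = - (((2 * pi)%:C * 'i%C * s) ^+ 2 * nome (s : C^o) -
   (1 - nome (s : C^o)) ^+ 2) / (s ^+ 2 * (1 - nome (s : C^o)) ^+ 2).
  by rewrite /double_pole; field; rewrite n1 snz.
rewrite nrmM nrmN nrmV nrmM !nrmX.
apply: (@le_trans _ _ D); last by lra.
have P := expC_double_pole_bound ((2 * pi)%:C * 'i%C * s).
rewrite -/(nome (s : C^o)) [nrm (_ * s)]nrmM nrm_2pii in P.
rewrite ler_pdivrMr; last by rewrite mulr_gt0 ?exprn_gt0 ?nrm_gt0.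
apply: le_trans P _.
have X1 : expR (2 * (2 * pi * nrm s)) <= expR (2 * (2 * pi * 2)).
  by rewrite ler_expR !ler_wpM2l// mulr_ge0// ltW.
apply: (@le_trans _ _ (2 * (2 * pi * nrm s) ^+ 4 * expR (2 * (2 * pi * 2)))).
  by rewrite ler_wpM2l// mulr_ge0// exprn_ge0// !mulr_ge0 ?ltW.
have X2 : c ^+ 2 * nrm s ^+ 2 <= nrm (1 - nome (s : C^o)) ^+ 2.
  by rewrite -exprMn lerXn2r ?nnegrE ?nrm_ge0// mulr_ge0 ?nrm_ge0// ltW.
have DE : D * (nrm s ^+ 2 * (c ^+ 2 * nrm s ^+ 2)) =
   2 * (2 * pi * nrm s) ^+ 4 * expR (2 * (2 * pi * 2)).
  by rewrite /D; field; rewrite gt_eqF.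
by rewrite -DE ler_wpM2l// ler_wpM2l// sqr_ge0.
Qed.

Lemma Im_half (s : C) : complex.Im (s / 2) = complex.Im s / 2.
Proof.
have -> : s / 2 = (2^-1)%:C * s by rewrite fmorphV rmorph_nat mulrC.
by case: s => a b /=; rewrite mul0r addr0 mulrC.
Qed.

(* Herglotz's trick: a bounded solution of [4 h(s) = h(s/2) + h((s+1)/2)] vanishes. *)
Lemma herglotz (h : C -> C) (M : R) :
  (forall s, 0 < complex.Im s -> nrm (h s) <= M) ->
  (forall s, 0 < complex.Im s -> h (s / 2) + h ((s + 1) / 2) = 4 * h s) ->
  forall s, 0 < complex.Im s -> h s = 0.
Proof.
(* The two values on the left are each at most the current bound, and the factor 4 on the right
   halves it. *)
move=> hM hd; have H n s : 0 < complex.Im s -> nrm (h s) <= M * 2^-1 ^+ n.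
  elim: n s => [|n IH] s s0; first by rewrite mulr1 hM.
  have i1 : 0 < complex.Im (s / 2) by rewrite Im_half divr_gt0.
  have i2 : 0 < complex.Im ((s + 1) / 2).
    by rewrite Im_half divr_gt0// -[1]/(1%:~R) Im_addz.
  have := ler_nrmD (h (s / 2)) (h ((s + 1) / 2)).
  rewrite hd// nrmM nrm_nat exprSr; have := IH _ i1; have := IH _ i2.
  set t := M * _; rewrite mulrA -/t; lra.
move=> s s0; apply/eqP; rewrite -nrm_eq0 eq_le nrm_ge0 andbT leNgt; apply/negP => hp.
have M0 : 0 <= M by apply: le_trans (hM s s0); exact: nrm_ge0.
have K0 : 0 <= 2 * M / nrm (h s) by apply: divr_ge0; [exact: mulr_ge0|exact: nrm_ge0].
have := archi_boundP K0; set n := Num.bound _ => Hn.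
have n0 : 0 < n%:R :> R by apply: le_lt_trans Hn.
have h2 : 0 <= (2^-1 : R) < 1 by rewrite invr_ge0 ler0n/= invf_lt1 ?ltr1n.
have g := natmul_geo_le n h2.
have := H n s s0; rewrite leNgt => /negP; apply.
rewrite ltr_pdivrMr// in Hn.
rewrite -(ltr_pM2l n0); apply: le_lt_trans Hn.
rewrite mulrCA [leRHS]mulrC ler_wpM2l//; apply: le_trans g _.
by rewrite (_ : 1 - 2^-1 = 2^-1) ?invrK//; field.
Qed.

Lemma row_sum2E (s : C) : 0 < complex.Im s -> row_sum 2 s = double_pole s.
Proof.
have [M HM] := row_sum_double_pole_bounded.
move=> s0; apply/eqP; rewrite -subr_eq0; apply/eqP.
apply: (@herglotz (fun s => row_sum 2 s - double_pole s) M) => // {s0}s s0.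
by rewrite mulrBr -row_sum_dup// -double_pole_dup//; ring.
Qed.

End IntegerSums.

(** * Lipschitz' formula *)

Section Lipschitz.
Context {R : realType}.
Local Notation C := R[i].
Local Notation tpi := ((2 * pi)%:C * 'i%C : C).

Lemma diskcv_nat : diskcv (fun n => n%:R : C).
Proof.
move=> q q1; apply: (@pser_cv_poly _ _ _ 1 1) => // n.
by rewrite nrm_nat expr1 mul1r.
Qed.

Lemma pser_nat (z : C) : nrm z < 1 -> pser (fun n => n%:R) z = z / (1 - z) ^+ 2.
Proof.
move=> z1; have nz := nrm_lt1_neq0 z1.
have := pser_ode (ode_geo (ltn0Sn 0)) z1.
rewrite pser_geo// pserZ; last exact: (diskcv_bool (fun n => (0 < n) && (1 %| n))%N z1).
rewrite pser_geo_pos// expr1 mul1r => H.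
transitivity (pser (euler_op (geo 1)) z); first by apply: eq_csum => n _; rewrite /euler_op /geo dvd1n mulr1.
by rewrite H; field.
Qed.

Lemma pser_nat1 (z : C) : nrm z < 1 -> pser (fun n => n.+1%:R) z = ((1 - z) ^+ 2)^-1.
Proof.
move=> z1; have nz := nrm_lt1_neq0 z1.
have c1 : pser_cv (fun=> 1) z.
  by apply: eq_csummable (csummable_geo z1) => n _; rewrite mul1r.
have -> : pser (fun n => n.+1%:R) z = pser (fun n => n%:R) z + pser (fun=> 1) z.
  rewrite -pserD//; last exact: diskcv_nat.
  by apply: eq_csum => n _; rewrite natr1.
rewrite pser_nat// (_ : pser (fun=> 1) z = (1 - z)^-1); first by field.
by rewrite -csum_geo//; apply: eq_csum => n _; rewrite mul1r.
Qed.

Lemma double_pole_series (s : C) : 0 < complex.Im s ->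
  double_pole s = tpi ^+ 2 * pser (fun n => n%:R) (nome (s : C^o)).
Proof. by move=> s0; rewrite pser_nat// nome_lt1. Qed.

(** The Taylor coefficients in [e] of the sum of [(s + e + r)^-2] over [A]. All integers serve for
    Lipschitz' formula, the nonzero ones with [s = 0] for Euler's. *)
Definition row_sum_taylor (A : set int) (s : C) (j : nat) : C :=
  (-1) ^+ j * j.+1%:R * csum A (fun r : int => ((s + r%:~R) ^+ (j + 2))^-1).

(** Each term is expanded by the binomial series of [(1 - x)^-2] at [x = - e / (s + r)]. The
    hypothesis gives [|x| <= 1/2] for all [r] at once, so the double series is dominated by a
    product and can be exchanged. *)
Lemma row_sum2_shift (A : set int) (s : C) (d : R) : 0 < d ->
  (forall r, A r -> 2 * d <= nrm (s + r%:~R)) ->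
  csummable A (fun r : int => ((s + r%:~R) ^+ 2)^-1) ->
  pser_cv (row_sum_taylor A s) d%:C /\
  forall e : C, nrm e <= d -> pser (row_sum_taylor A s) e = csum A (fun r : int => ((s + e + r%:~R) ^+ 2)^-1).
Proof.
move=> d0 As sA.
have un r : A r -> 0 < nrm (s + r%:~R).
  by move=> /As; apply: lt_le_trans; rewrite mulr_gt0.
have H (e : C) : nrm e <= d ->
   pser_cv (row_sum_taylor A s) e /\ pser (row_sum_taylor A s) e = csum A (fun r : int => ((s + e + r%:~R) ^+ 2)^-1).
  move=> ed.
  pose t (r : int) (j : nat) : C := ((s + r%:~R) ^+ 2)^-1 * (j.+1%:R * (- e / (s + r%:~R)) ^+ j).
  have z1 r : A r -> nrm (- e / (s + r%:~R)) <= 2^-1.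
    move=> Ar; rewrite nrmM nrmN nrmV ler_pdivrMr ?un//; have := As r Ar; lra.
  have h1 : 0 <= (2^-1 : R) < 1 by rewrite invr_ge0 ler0n/= invf_lt1 ?ltr1n.
  have half_lt : nrm (2^-1%:C : C) < 1 by rewrite nrm_real ger0_norm; case/andP: h1.
  have shalf : csummable setT (fun j : nat => (j.+1%:R * (2^-1%:C) ^+ j : C)).
    have c1 : pser_cv (fun=> 1) (2^-1%:C : C).
      by apply: eq_csummable (csummable_geo half_lt) => n _; rewrite mul1r.
    apply: eq_csummable (csummableD (diskcv_nat half_lt) c1) => n _.
    by rewrite -mulrDl natr1.
  have st : csummable (A `*`` fun=> setT) (fun k => t k.1 k.2).
    apply: csummable_le (csummable_mul sA shalf) => -[r j] [/= Ar _].
    rewrite /t [leLHS]nrmM [leRHS]nrmM ler_wpM2l ?nrm_ge0// [leLHS]nrmM [leRHS]nrmM ler_wpM2l ?nrm_ge0//.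
    rewrite !nrmX nrm_real ger0_norm; last by case/andP: h1.
    by rewrite lerXn2r ?nnegrE ?nrm_ge0// ?z1//; case/andP: h1.
  have E r : A r -> csum setT (t r) = ((s + e + r%:~R) ^+ 2)^-1.
    move=> Ar; have zl : nrm (- e / (s + r%:~R)) < 1.
      by apply: le_lt_trans (z1 r Ar) _; case/andP: h1.
    have c2 := pser_nat1 zl; have nz := nrm_lt1_neq0 zl.
    rewrite /t csumZ; last first.
      have c1 : pser_cv (fun=> 1) (- e / (s + r%:~R)).
        by apply: eq_csummable (csummable_geo zl) => n _; rewrite mul1r.
      apply: eq_csummable (csummableD (diskcv_nat zl) c1) => n _.
      by rewrite -mulrDl natr1.
    rewrite [csum _ _]c2 -invfM -exprMn; congr ((_ ^+ 2)^-1).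
    have : s + r%:~R != 0 by rewrite -nrm_gt0 un.
    by move=> u0; field.
  have Ej j : csum A (t^~ j) = row_sum_taylor A s j * e ^+ j.
    have sj : csummable A (fun r : int => ((s + r%:~R) ^+ (j + 2))^-1).
      apply: csummable_le (rsummableZ (((2 * d) ^+ j)^-1) sA) => r Ar.
      rewrite exprD invfM nrmM ler_wpM2r ?nrm_ge0// nrmV nrmX.
      rewrite lef_pV2 ?posrE ?exprn_gt0 ?un ?mulr_gt0// lerXn2r ?nnegrE ?nrm_ge0 ?As//.
      by rewrite mulr_ge0// ltW.
    rewrite /row_sum_taylor mulrAC -csumZ//.
    apply: eq_csum => r Ar; rewrite /t expr_div_n exprD (exprNn e).
    have u0 : s + r%:~R != 0 by rewrite -nrm_gt0 un.
    move: (expf_neq0 j u0); move: (e ^+ j) ((s + r%:~R) ^+ j) => a b b0.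
    by field; rewrite u0 b0.
  have b : set_bij (setT `*`` fun=> A) (A `*`` fun=> setT) (fun k : nat * int => (k.2, k.1)).
    by apply: (@can_set_bij _ _ _ _ _ (fun k => (k.2, k.1))) => // -[x y] [].
  have st' : csummable (setT `*`` fun=> A) (fun k => t k.2 k.1).
    exact/(csummable_reindex (fun k => t k.1 k.2) b).
  split.
    apply: eq_csummable (csummable_outer (f := fun j r => t r j) st') => j _.
    exact: Ej.
  rewrite -(eq_csum E) csum_swap//; apply: eq_csum => j _; by rewrite Ej.
split; first by apply: (H _ _).1; rewrite nrm_real gtr0_norm.
by move=> e /H[].
Qed.

Lemma rsum_exp (x : R) : 0 <= x -> rsum setT (fun n => x ^+ n / n`!%:R) = expR x.
Proof.
move=> x0; have := expserE (x%:C : C); rewrite /expser.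
rewrite (eq_csum (g := fun n => (x ^+ n / n`!%:R)%:C)); last first.
  by move=> n _; rewrite rmorphM fmorphV rmorph_nat rmorphXn.
by rewrite csum_real /expC /= sin0 cos0 mulr1 mulr0 => -[].
Qed.

Lemma csummable_swap (T T' : choiceType) (A : set T) (B : set T') (f : T -> T' -> C) :
  csummable (A `*`` fun=> B) (fun k => f k.1 k.2) ->
  csummable (B `*`` fun=> A) (fun k => f k.2 k.1).
Proof.
have b : set_bij (B `*`` fun=> A) (A `*`` fun=> B) (fun k : T' * T => (k.2, k.1)).
  by apply: (@can_set_bij _ _ _ _ _ (fun k => (k.2, k.1))) => // -[x y] [].
by move=> /(csummable_reindex _ b).
Qed.

(** The moduli of the Taylor terms of [exp (2 pi i m e)] add up to an exponential, which amounts to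
    moving [s] down to [s - i e]. This yields the summability behind the exchange in
    [lipschitz_formula]. *)
Lemma nrm_natnome_shift (s : C) (e : R) (m : nat) :
  nrm (m%:R * nome (s : C^o) ^+ m) * expR (2 * pi * (m%:R * e)) =
  nrm (m%:R * nome (s - e%:C * 'i%C : C^o) ^+ m).
Proof.
rewrite [in LHS](nrmM m%:R).
rewrite [RHS](nrmM m%:R).
rewrite -[LHS]mulrA.
apply: congr1.
rewrite [in LHS](nrmX _ m).
rewrite [RHS](nrmX _ m).
have X (x : R) : expR x ^+ m = expR (m%:R * x) by rewrite expRM_natl.
rewrite nrm_nome nrm_nome !X -expRD; apply: congr1.
by rewrite raddfB/=; simpc; rewrite /=; ring.
Qed.

Lemma natnome_shift (s e : C) (m : nat) :
  m%:R * nome (s : C^o) ^+ m * expC (tpi * (m%:R * e) : C^o) =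
  m%:R * nome (s + e : C^o) ^+ m.
Proof.
rewrite nomeD -(mulrA m%:R (nome (s : C^o) ^+ m : C)).
apply: congr1; rewrite exprMn; apply: congr1.
by rewrite -nomeMn.
Qed.

(** Both sides are the [j]-th Taylor coefficient at [s] of [row_sum 2 = double_pole]: one from
    expanding [(s + e + r)^-2], the other from expanding [exp (2 pi i m e)]. *)
Lemma lipschitz_formula (j : nat) (s : C) : 0 < complex.Im s ->
  (-1) ^+ j * j.+1%:R * row_sum (j + 2) s =
  tpi ^+ (j + 2) / j`!%:R * pser (fun m => m%:R ^+ j.+1) (nome (s : C^o)).
Proof.
move=> s0; pose d := complex.Im s / 2.
(* Every [s + r] has modulus at least [2 * d], and [s - i e] stays in the upper half-plane for
   [e <= d]. *)
have d0 : 0 < d by rewrite divr_gt0.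
have ds (r : int) : setT r -> 2 * d <= nrm (s + r%:~R).
  by move=> _; rewrite mulrC divfK// -(Im_addz s r) Im_le_nrm_uhp.
have [cv1 E1] := row_sum2_shift d0 ds (csummable_row_sum (leqnn 2) s0).
pose c (m : nat) : C := m%:R * nome (s : C^o) ^+ m.
pose t (e : C) (m i : nat) : C := c m * ((tpi * (m%:R * e)) ^+ i / i`!%:R).
pose b i := tpi ^+ (i + 2) / i`!%:R * pser (fun m => m%:R ^+ i.+1) (nome (s : C^o)).
have np : nrm tpi = 2 * pi by exact: nrm_2pii.
have st (e : R) : 0 <= e -> e <= d -> csummable (setT `*`` fun=> setT) (fun k => t e%:C k.1 k.2).
  move=> e0 ed; pose s' := s - e%:C * 'i%C.
  have s'0 : 0 < complex.Im s'.
    rewrite /s' raddfB/= /d in ed *; simpc; rewrite /=; lra.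
  apply: (csummable_pair _ (g := fun m => nrm (m%:R * nome (s' : C^o) ^+ m))).
  - by move=> m _; apply: csummableZ; exact: csummable_exp.
  - move=> m _; rewrite le_eqVlt; apply/orP; left; apply/eqP.
    rewrite (eq_rsum (g := fun i => nrm (c m) * ((2 * pi * (m%:R * e)) ^+ i / i`!%:R))); last first.
      move=> i _; rewrite nrmM [in LHS]nrmM nrmX nrmV nrm_nat nrmM np nrmM nrm_nat nrm_real ger0_norm//.
    rewrite rsumZ; last first.
      by apply: rsummable_exp; rewrite !mulr_ge0// pi_ge0.
    rewrite rsum_exp; last by rewrite !mulr_ge0// pi_ge0.
    exact: nrm_natnome_shift.
  - exact: diskcv_nat (nome_lt1 s'0).
have tE (e : R) m : csum setT (t e%:C m) = m%:R * nome (s + e%:C : C^o) ^+ m.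
  rewrite /t csumZ; last exact: csummable_exp.
  transitivity (c m * expC (tpi * (m%:R * e%:C) : C^o)).
    by congr (_ * _); apply: expserE.
  exact: natnome_shift.
have tE' (e : R) i : csum setT ((t e%:C)^~ i) = b i * e%:C ^+ i / tpi ^+ 2.
  have p := twopii_neq0 : tpi != 0.
  rewrite /b exprD; transitivity (tpi ^+ i / i`!%:R * e%:C ^+ i * pser (fun m => m%:R ^+ i.+1) (nome (s : C^o))).
    rewrite /pser -csumZ; last first.
      apply: (@pser_cv_poly _ _ _ 1 i.+1); last exact: nome_lt1.
      by move=> m; rewrite nrmX nrm_nat mul1r.
    by apply: eq_csum => m _; rewrite /t /c !exprMn exprS; ring.
  have b0 := expf_neq0 2 p; move: (tpi ^+ i) (tpi ^+ 2) b0 => P Q Q0.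
  by field; rewrite Q0 pnatr_eq0 -lt0n fact_gt0.
have cv2 : pser_cv b d%:C.
  have := csummable_outer (f := fun i m => t d%:C m i) (csummable_swap (st d (ltW d0) (lexx _))).
  move=> /(csummableZ (tpi ^+ 2)); apply: eq_csummable => i _.
  by rewrite tE' mulrC divfK// expf_neq0// twopii_neq0.
apply: (pser_uniq d0 cv1 cv2) => e e0 ed.
rewrite E1; last by rewrite nrm_real gtr0_norm// ltW.
have se0 : 0 < complex.Im (s + e%:C) by rewrite raddfD/= addr0.
rewrite [LHS](row_sum2E se0) double_pole_series// /pser -(eq_csum (fun m _ => tE e m)).
rewrite csum_swap; last by apply: st; rewrite ltW.
rewrite (eq_csum (fun i _ => tE' e i)) -csumZ; last first.
  have := csummable_outer (f := fun i m => t e%:C m i) (csummable_swap (st e (ltW e0) (ltW ed))).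
  exact: eq_csummable.
by apply: eq_csum => i _; rewrite mulrC divfK// expf_neq0// twopii_neq0.
Qed.

End Lipschitz.

(** * Euler's formula *)

Lemma size_bernoulli_seq n : size (bernoulli_seq n) = n.+1.
Proof. by elim: n => //= n IH; rewrite size_rcons IH. Qed.

Lemma nth_bernoulli_seq n j : (j <= n)%N -> (bernoulli_seq n)`_j = bernoulli j.
Proof.
elim: n => [|n IH]; first by rewrite leqn0 => /eqP->.
rewrite leq_eqVlt => /orP[/eqP->//|jn] /=.
by rewrite nth_rcons size_bernoulli_seq jn IH.
Qed.

Lemma bernoulli_sum n : \sum_(j < n.+1) 'C(n.+1, j)%:R * bernoulli j = (n == 0%N)%:R :> rat.
Proof.
case: n => [|n]; first by rewrite big_ord1 bin0 mul1r.
rewrite big_ord_recr /= {2}/bernoulli /= nth_rcons size_bernoulli_seq ltnn eqxx binSn.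
rewrite mulNr mulrN [n.+2%:R * _]mulrC divfK ?pnatr_eq0//.
rewrite (eq_bigr (fun j : 'I_n.+1 => 'C(n.+2, j)%:R * (bernoulli_seq n)`_j)) ?subrr// => j _.
by rewrite nth_bernoulli_seq// -ltnS.
Qed.

(** * Ring laws of the Cauchy product *)

Section CprodRing.
Context {R : realType}.
Local Notation C := R[i].
Implicit Types a b c : nat -> C.

Lemma eq_cprod a a' b b' n : (forall i, (i <= n)%N -> a i = a' i) ->
  (forall i, (i <= n)%N -> b i = b' i) -> cprod a b n = cprod a' b' n.
Proof.
move=> aa bb; apply: eq_bigr => i _; have := ltn_ord i; rewrite ltnS => i_n.
by rewrite aa// bb// leq_subr.
Qed.

Lemma coef_cprod (p q : {poly C}) n : (p * q)`_n = cprod (nth 0 p) (nth 0 q) n.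
Proof. by rewrite coefM. Qed.

(** The coefficient of index [n] depends only on truncations at degree [n], so the law is inherited
    from polynomials; associativity below likewise. *)
Lemma cprodC a b n : cprod a b n = cprod b a n.
Proof.
have T (c : nat -> C) i : (i <= n)%N -> c i = (\poly_(j < n.+1) c j)`_i.
  by move=> i_n; rewrite coef_poly ltnS i_n.
rewrite (eq_cprod (T a) (T b)) -coef_cprod mulrC coef_cprod.
by apply: eq_cprod => i i_n; rewrite -T.
Qed.

Lemma cprodA a b c n : cprod a (cprod b c) n = cprod (cprod a b) c n.
Proof.
have T (d : nat -> C) i : (i <= n)%N -> d i = (\poly_(j < n.+1) d j)`_i.
  by move=> i_n; rewrite coef_poly ltnS i_n.
transitivity ((\poly_(j < n.+1) a j * (\poly_(j < n.+1) b j * \poly_(j < n.+1) c j))`_n).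
  rewrite coef_cprod; apply: eq_cprod => i i_n; rewrite -?T// coef_cprod.
  by apply: eq_cprod => l li; rewrite -T// (leq_trans li).
rewrite mulrA coef_cprod; apply: eq_cprod => i i_n; rewrite -?T// coef_cprod.
by apply: eq_cprod => l li; rewrite -T// (leq_trans li).
Qed.

Lemma cprod_delta0 a n : cprod (delta 0) a n = a n.
Proof.
by rewrite /cprod big_ord_recl /delta eqxx mul1r subn0 big1 ?addr0// => i _; rewrite mul0r.
Qed.

End CprodRing.

Section Euler.
Context {R : realType}.
Local Notation C := R[i].
Local Notation m2p := (- (2 * pi)%:C : C).

(* Taylor coefficients of [(1 - e) / (2 pi t)], of [e] and of the inverse of the
   former, where [e = exp (- 2 pi t)]. *)
Definition expm1_coef (n : nat) : C := m2p ^+ n / n.+1`!%:R.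
Definition expm_coef (n : nat) : C := m2p ^+ n / n`!%:R.
Definition bern_coef (n : nat) : C := m2p ^+ n * ratr (bernoulli n) / n`!%:R.

Lemma factC_neq0 n : (n`!%:R : C) != 0.
Proof. by rewrite pnatr_eq0 -lt0n fact_gt0. Qed.

Lemma bern_coef_term (i m : nat) :
  bern_coef i * expm1_coef m =
  m2p ^+ (i + m) / (i + m).+1`!%:R * ('C((i + m).+1, i)%:R * ratr (bernoulli i)).
Proof.
have : ('C((i + m).+1, i)%:R * (i`!%:R * m.+1`!%:R) = (i + m).+1`!%:R :> C).
  have := @bin_fact (i + m).+1 i; rewrite ltnW ?ltnS ?leq_addr// => /(_ isT).
  by rewrite subSn ?leq_addr// addKn => <-; rewrite !natrM.
rewrite /bern_coef /expm1_coef exprD => <-.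
have b0 : ('C((i + m).+1, i)%:R : C) != 0.
  by rewrite pnatr_eq0 -lt0n bin_gt0 ltnW// ltnS leq_addr.
move: ((m2p) ^+ i) (m2p ^+ m) (ratr (bernoulli i)) => X Y Z.
by field; rewrite b0 !factC_neq0.
Qed.

(** The defining recursion of the Bernoulli numbers, read as the statement that [x / (e^x - 1)] is
    the inverse of [(e^x - 1) / x] at [x = - 2 pi t]. *)
Lemma cprod_bern n : cprod expm1_coef bern_coef n = delta 0 n.
Proof.
rewrite cprodC /cprod.
transitivity (m2p ^+ n / n.+1`!%:R * ratr (\sum_(j < n.+1) 'C(n.+1, j)%:R * bernoulli j)).
  rewrite rmorph_sum mulr_sumr; apply: eq_bigr => i _.
  have i_n : (i <= n)%N by rewrite -ltnS ltn_ord.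
  by rewrite rmorphM rmorph_nat bern_coef_term subnKC.
rewrite bernoulli_sum /delta rmorph_nat.
case: n => [|n]; last by rewrite mulr0.
by rewrite expr0 mulr1 invr1 mulr1.
Qed.

Lemma cprod_expm1_inj a b : (forall n, cprod expm1_coef a n = cprod expm1_coef b n) ->
  forall n, a n = b n.
Proof.
have K c n : cprod bern_coef (cprod expm1_coef c) n = c n.
  rewrite cprodA -[RHS]cprod_delta0; apply: eq_cprod => i _ //.
  by rewrite cprodC cprod_bern.
by move=> E n; rewrite -K -[RHS]K; apply: eq_cprod => i _.
Qed.

(** With [x = - 2 pi t], [a = (e^x - 1) / x] and [b = 1 / a], this is [a^2 (b - x b') = e^x]. It
    follows from differentiating [a b = 1]. *)
Lemma cprod_bern_diff n :
  cprod expm1_coef (cprod expm1_coef (fun m => (1 - m%:R) * bern_coef m)) n = expm_coef n.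
Proof.
pose a := expm1_coef; pose b := bern_coef.
have E m : cprod a (fun m => (1 - m%:R) * b m) m = delta 0 m + cprod (euler_op a) b m.
  have : euler_op (cprod a b) m = 0.
    by rewrite /euler_op cprod_bern /delta; case: m => [|m]; rewrite ?mul0r ?mulr0.
  rewrite euler_cprod => /eqP; rewrite addr_eq0 => /eqP->.
  rewrite -cprod_bern /cprod -sumrB; apply: eq_bigr => i _.
  by rewrite /euler_op -/a -/b; ring.
rewrite (eq_cprod (a' := a) (b' := fun m => delta 0 m + cprod (euler_op a) b m))//.
transitivity (cprod a (delta 0) n + cprod a (cprod (euler_op a) b) n).
  by rewrite /cprod -big_split; apply: eq_bigr => i _; rewrite mulrDr.
rewrite cprodC cprod_delta0 (eq_cprod (a' := a) (b' := cprod b (euler_op a)))//; last first.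
  by move=> i _; rewrite cprodC.
rewrite cprodA (eq_cprod (a' := delta 0) (b' := euler_op a))//; last first.
  by move=> i _; exact: cprod_bern.
rewrite cprod_delta0 /euler_op /a /expm1_coef /expm_coef factS natrM.
have f0 := factC_neq0 n; have n0 : (n.+1%:R : C) != 0 by rewrite pnatr_eq0.
rewrite -[X in X + _]mul1r -mulrDl addrC natr1; move: (n.+1%:R : C) n0 => N N0.
by field; rewrite N0 f0.
Qed.

Lemma nrm_int (r : int) : nrm (r%:~R : C) = `|r%:~R|.
Proof. by rewrite -(rmorph_int (real_complex R)) nrm_real. Qed.

Lemma int_norm_ge1 (r : int) : r != 0 -> 1 <= `|r%:~R| :> R.
Proof. by move=> r0; rewrite -intr_norm ler1z; move: r0; case: r => [[|]|]. Qed.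

Lemma nrm_i : nrm ('i%C : C) = 1.
Proof. by rewrite /nrm normc_def /= expr0n expr1n add0r sqrtr1. Qed.

Definition int_zeta (w : nat) : C := csum (~` [set 0]) (fun r : int => (r%:~R ^+ w)^-1).

Lemma csummable_int_zeta w : (2 <= w)%N ->
  csummable (~` [set 0]) (fun r : int => (r%:~R ^+ w)^-1 : C).
Proof.
move=> w2; apply: csummable_le (rsummableZ 2 (rsummable_sub (@subsetT _ _) rsummable_int_invsq)) => r /eqP r0.
have r1 : 1 <= `|r%:~R| :> R.
  exact: int_norm_ge1.
rewrite nrmV nrmX nrm_int ler_pdivlMr; last by rewrite ltr_wpDr// sqr_ge0.
rewrite mulrC ler_pdivrMr; last by rewrite exprn_gt0// (lt_le_trans _ r1).
have := @ler_weXn2l R _ r1 _ _ w2; have := @ler_weXn2l R _ r1 _ _ (leq0n 2).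
by rewrite expr0 real_normK ?num_real//; lra.
Qed.

(* Coefficients of [1 - t^2 \sum_(r != 0) (i t + r)^-2], which by [row_sum2E]
   is [4 pi^2 t^2 e / (1 - e)^2] with [e = exp (- 2 pi t)]. *)
Definition zeta_series (n : nat) : C :=
  if n is m.+2 then - (row_sum_taylor (~` [set 0]) 0 m * 'i%C ^+ m) else (n == 0%N)%:R.

Lemma zeta_seriesE n : zeta_series n = delta 0 n - cprod (delta 2) (fun m => row_sum_taylor (~` [set 0]) 0 m * 'i%C ^+ m) n.
Proof.
have D0 i : delta 2 i = (i == 2%N)%:R :> C by [].
case: n => [|[|n]]; rewrite /cprod; first by rewrite big_ord1 D0 mul0r subr0.
  by rewrite !big_ord_recl big_ord0 !D0 !mul0r !addr0 subr0.
rewrite !big_ord_recl !D0 !mul0r !add0r mul1r big1 ?addr0 ?sub0r//= => [|i _].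
  by rewrite subn2.
by rewrite D0 mul0r.
Qed.

(** Both sequences become [expm_coef] after two multiplications by the invertible [expm1_coef]. For
    [zeta_series] this is checked as an identity of functions at [0 < x < 1/2], where [i x] lies in
    the upper half-plane and [row_sum2E] applies. *)
Lemma zeta_series_coef n : zeta_series n = (1 - n%:R) * bern_coef n.
Proof.
suff H m : cprod expm1_coef (cprod expm1_coef zeta_series) m = expm_coef m.
  by apply: (@cprod_expm1_inj zeta_series (fun n => (1 - n%:R) * bern_coef n)); apply: cprod_expm1_inj => m; rewrite H cprod_bern_diff.
move: m => {}n; move: n.
have ds (r : int) : (~` [set 0]) r -> 2 * 2^-1 <= nrm (0 + r%:~R : C).
  move=> /eqP r0; rewrite mulfV ?pnatr_eq0// add0r nrm_int.
  exact: int_norm_ge1.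
have d0 : 0 < (2^-1 : R) by rewrite invr_gt0.
have s0 : csummable (~` [set 0]) (fun r : int => ((0 + r%:~R) ^+ 2)^-1 : C).
  by apply: eq_csummable (csummable_int_zeta (leqnn 2)) => r _; rewrite add0r.
have [cz Ez] := row_sum2_shift d0 ds s0.
have sE (x : R) : pser_cv expm_coef x%:C /\ pser expm_coef x%:C = expC (m2p * x%:C : C^o).
  split.
    by apply: eq_csummable (csummable_exp (m2p * x%:C)) => n _; rewrite exprMn mulrAC.
  by rewrite -expserE; apply: eq_csum => n _; rewrite exprMn mulrAC.
have sA (x : R) : pser_cv expm1_coef x%:C.
  apply: csummable_le (sE x).1 => n _; rewrite nrmM [leRHS]nrmM ler_wpM2r ?nrm_ge0//.
  rewrite nrmM [leRHS]nrmM ler_wpM2l ?nrm_ge0// !nrmV !nrm_nat.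
  by rewrite lef_pV2 ?posrE ?ltr0n ?fact_gt0// ler_nat factS leq_pmull.
have EA (x : R) : m2p * x%:C * pser expm1_coef x%:C = expC (m2p * x%:C : C^o) - 1.
  have [c1 E1] := pser_head (sE x).1.
  rewrite -(sE x).2 E1 /expm_coef expr0 fact0 invr1 mulr1 addrAC subrr add0r.
  rewrite mulrAC [RHS]mulrC; congr (_ * _).
  rewrite -[LHS](csumZ _ (sA x)); apply: eq_csum => n _; rewrite /expm1_coef exprS.
  by move: (m2p) (x%:C : C) (n.+1`!%:R : C) => P X F; ring.
have tl (x : R) : 0 <= x -> x <= 2^-1 ->
    pser_cv (fun m => row_sum_taylor (~` [set 0]) 0 m * 'i%C ^+ m) x%:C /\
    pser (fun m => row_sum_taylor (~` [set 0]) 0 m * 'i%C ^+ m) x%:C = pser (row_sum_taylor (~` [set 0]) 0) ('i%C * x%:C : C).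
  move=> x0 x1; split.
    apply: eq_csummable (pser_cv_le (q := 'i%C * x%:C) _ cz) => [m _|].
      by rewrite exprMn mulrA.
    by rewrite nrmM nrm_i mul1r !nrm_real !ger0_norm// invr_ge0.
  by apply: eq_csum => m _; rewrite exprMn mulrA.
have tD (x : R) : 0 <= x -> x <= 2^-1 -> pser_cv zeta_series x%:C /\ pser zeta_series x%:C =
    1 - x%:C ^+ 2 * pser (row_sum_taylor (~` [set 0]) 0) ('i%C * x%:C : C).
  move=> x0 x1; have [c1 E1] := tl x x0 x1.
  have [c2 E2] := pser_mul (pser_delta 2 x%:C).1 c1.
  have [c0 E0] := pser_delta 0 x%:C.
  split.
    by apply: eq_csummable (csummableB c0 c2) => m _; rewrite zeta_seriesE mulrBl.
  rewrite -E1 -(pser_delta 2 x%:C).2 E2.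
  transitivity (pser (delta 0) x%:C - pser (cprod (delta 2) (fun m => row_sum_taylor (~` [set 0]) 0 m * 'i%C ^+ m)) x%:C); last first.
    by rewrite E0 expr0.
  rewrite -[RHS](csumB c0 c2).
  by apply: eq_csum => m _; rewrite zeta_seriesE mulrBl.
apply: (@pser_uniq _ _ _ 2^-1) => //.
- apply: (pser_mul _ _).1; first exact: sA. apply: (pser_mul _ _).1; [exact: sA|].
  by apply: (tD _ _ _).1 => //; rewrite ltW.
- exact: (sE _).1.
move=> x x0 x1.
have xd : x <= 2^-1 by rewrite ltW.
have [cD ED] := tD x (ltW x0) xd.
have [c1 E1] := pser_mul (sA x) cD.
have [c2 E2] := pser_mul (sA x) c1.
rewrite -E2 -E1 ED (sE x).2 Ez; last first.
  by rewrite nrmM nrm_i mul1r nrm_real gtr0_norm.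
have ix0 : 0 < complex.Im ('i%C * x%:C : C) by simpc.
have x0' : (x%:C : C) != 0 by rewrite fmorph_eq0// gt_eqF.
have i2 : ('i%C : C) ^+ 2 = -1 by rewrite sqr_i.
(* The term [r = 0] of the full row is [(i x)^-2 = - x^-2]. *)
have -> : csum (~` [set 0]) (fun r : int => ((0 + 'i%C * x%:C + r%:~R) ^+ 2)^-1) =
    double_pole ('i%C * x%:C) + (x%:C ^+ 2)^-1.
  rewrite -row_sum2E// /row_sum (csumID [set 0] (csummable_row_sum (leqnn 2) ix0)) !setTI csum_set1.
  rewrite addr0 exprMn i2 mulN1r invrN addrAC addNr !add0r.
  exact: eq_csum.
have NE : nome ('i%C * x%:C : C^o) = expC (m2p * x%:C : C^o).
  rewrite /nome; congr expC; rewrite !mulrA -[_ * 'i%C * 'i%C]mulrA -expr2 i2.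
  by rewrite mulrN1.
have E1' := lt_eqF (nome_lt1 ix0).
have e1 : 1 - expC (m2p * x%:C : C^o) != 0 by rewrite -NE; apply: nrm_lt1_neq0; exact: nome_lt1.
have p0 : m2p * x%:C != 0.
  by apply: mulf_neq0 => //; rewrite oppr_eq0 fmorph_eq0 gt_eqF// mulr_gt0// pi_gt0.
have AE : pser expm1_coef x%:C = (expC (m2p * x%:C : C^o) - 1) / (m2p * x%:C).
  by rewrite -EA [RHS]mulrC (mulKf p0).
rewrite AE /double_pole NE; move: e1; set E : C := expC _ => e1.
rewrite exprMn i2; move: x0' p0; move: (x%:C) ((2 * pi)%:C : C) => X P X0.
rewrite mulf_eq0 (negbTE X0) orbF oppr_eq0 => P0.
by field; rewrite X0 P0 e1.
Qed.

Lemma int_zeta_even k : (0 < k)%N ->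
  int_zeta (2 * k) = (-1) ^+ k.+1 * (2 * pi)%:C ^+ (2 * k) * ratr (bernoulli (2 * k)) / (2 * k)`!%:R.
Proof.
case: k => // k _; have := zeta_series_coef (2 * k).+2.
have E : ((2 * k).+2 = 2 * k.+1)%N by rewrite mulnS.
rewrite /= /bern_coef E /row_sum_taylor -mulnSr exprM sqrrN !expr1n mul1r.
rewrite exprM sqr_i (exprM (m2p)) sqrrN -exprM -E.
rewrite (_ : csum _ _ = int_zeta (2 * k.+1)); last by apply: eq_csum => r _; rewrite add0r ?addn2 E.
have k0 : ((2 * k).+1%:R : C) != 0 by rewrite pnatr_eq0.
have -> : 1 - (2 * k).+2%:R = - (2 * k).+1%:R :> C by rewrite -[(2 * k).+2]addn1 natrD; ring.
have s2 : (-1) ^+ k * (-1) ^+ k = 1 :> C by rewrite -exprMn mulrNN mulr1 expr1n.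
rewrite mulNr => /oppr_inj H; apply: (mulfI k0).
transitivity ((2 * k).+1%:R * int_zeta (2 * k.+1) * (-1) ^+ k * (-1) ^+ k).
  by rewrite -[RHS]mulrA s2 mulr1 E.
rewrite H [(-1) ^+ k.+2]exprS [(-1) ^+ k.+1]exprS.
by move: ((-1) ^+ k : C) (_ ^+ (2 * k).+2) => S P; ring.
Qed.

Lemma rsummable_zeta w : (2 <= w)%N -> rsummable setT (fun n : nat => (n.+1%:R ^+ w)^-1 : R).
Proof.
move=> w2; apply: (rsummable_le (g := fun n => 2 * (1 + n%:R ^+ 2)^-1)) (rsummableZ 2 rsummable_nat_invsq).
move=> n _; have n0 : 0 <= n%:R :> R by [].
have n1 : 1 <= n.+1%:R :> R by rewrite ler1n.
rewrite ger0_norm ?invr_ge0 ?exprn_ge0// ler_pdivlMr; last by rewrite ltr_wpDr// sqr_ge0.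
rewrite mulrC ler_pdivrMr; last by rewrite exprn_gt0// (lt_le_trans _ n1).
have := @ler_weXn2l R _ n1 _ _ w2; rewrite -natr1; nra.
Qed.

Lemma zeta_rsum w : (2 <= w)%N -> zeta w = rsum setT (fun n : nat => (n.+1%:R ^+ w)^-1 : R).
Proof. by move=> w2; apply/cvg_lim => //; exact: cvg_series_rsum (rsummable_zeta w2). Qed.

Lemma zeta_csum w : (2 <= w)%N ->
  (zeta w)%:C = csum setT (fun n : nat => (n.+1%:R ^+ w)^-1 : C).
Proof.
move=> w2; rewrite zeta_rsum// -csum_real; apply: eq_csum => n _.
by rewrite fmorphV rmorphXn rmorph_nat.
Qed.

Lemma csum_sym_int (f : int -> C) : csummable (~` [set 0]) f -> (forall r, f (- r) = f r) ->
  csum (~` [set 0]) f = 2 * csum setT (fun n : nat => f n.+1%:Z).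
Proof.
move=> sf fN; rewrite (csumID [set r : int | 0 <= r] sf).
have b1 : set_bij setT (~` [set 0] `&` [set r : int | 0 <= r]) (fun n : nat => n.+1%:Z).
  by apply: (@can_set_bij _ _ _ _ _ (fun r : int => `|r|%N.-1)) => //=; case=> // -[|n] [].
have b2 : set_bij setT (~` [set 0] `&` ~` [set r : int | 0 <= r]) Negz.
  by apply: (@can_set_bij _ _ _ _ _ (fun r : int => `|r|%N.-1)) => //=; case=> // n [].
rewrite (csum_reindex _ b1) (csum_reindex _ b2) mulr2n mulrDl mul1r; congr (_ + _).
by apply: eq_csum => n _ /=; rewrite NegzE fN.
Qed.

Lemma int_zeta_zeta w : (2 <= w)%N -> ~~ odd w -> int_zeta w = 2 * (zeta w)%:C.
Proof.
move=> w2 wo; rewrite /int_zeta csum_sym_int; first by rewrite zeta_csum.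
- exact: csummable_int_zeta.
- by move=> r; rewrite rmorphN exprNn -signr_odd (negbTE wo) mul1r.
Qed.

Lemma euler_zeta k : (0 < k)%N -> zeta (2 * k) =
  (-1) ^+ (k + 1) * 2 ^+ (2 * k) * ratr (bernoulli (2 * k)) * pi ^+ (2 * k)
    / (2 * (2 * k)`!%:R) :> R.
Proof.
move=> k0; have := int_zeta_even k0; rewrite int_zeta_zeta ?oddM//; last by rewrite mulnC; lia.
move=> H; apply: (fmorph_inj (real_complex R)); apply: (mulfI (_ : 2%:R != 0)).
  by rewrite pnatr_eq0.
rewrite H addn1 -(fmorph_rat (real_complex R)); move: (ratr _ : R) => B.
rewrite !(rmorphM, rmorphXn, fmorphV, rmorph_nat, rmorphN, rmorph1) /=.
rewrite exprMn; have f0 := factC_neq0 (2 * k); have t0 : (2 : C) != 0 by rewrite pnatr_eq0.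
by field; rewrite f0.
Qed.

End Euler.

(** * The summand as a power series *)

Lemma ffact_prodr (A : comPzRingType) (m j : nat) :
  (m ^_ j)%:R = \prod_(i < j) (m%:R - i%:R) :> A.
Proof.
elim: j => [|j IH]; first by rewrite big_ord0 ffactn0.
rewrite big_ord_recr /= -IH ffactnSr natrM; have [jm|mj] := leqP j m; first by rewrite natrB.
by rewrite ffact_small// !mul0r.
Qed.

(** The two sides agree at all natural numbers by [expn_stirling2], and a nonzero polynomial has
    fewer roots than its size. As a polynomial identity it can be evaluated at [-1]. *)
Lemma stirling2_poly n : 'X^n =
  \sum_(j < n.+1) (stirling2 n j)%:R *: \prod_(i < j) ('X - (i%:R)%:P) :> {poly rat}.
Proof.
apply/eqP; rewrite -subr_eq0; set p := (X in X == 0); apply/negP => p0; move/negP: p0 => p0.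
have rp m : root p m%:R.
  rewrite /root hornerD hornerN horner_sum hornerXn -natrX expn_stirling2 natr_sum.
  rewrite -sumrB big1// => j _; rewrite hornerZ horner_prod natrM ffact_prodr.
  by under eq_bigr do rewrite hornerXsubC; rewrite subrr.
have := @max_poly_roots _ p [seq m%:R | m <- iota 0 (size p)] p0.
rewrite size_map size_iota ltnn => H; suff: false by [].
apply: H; first by apply/allP => _ /mapP[m _ ->].
rewrite map_inj_uniq ?iota_uniq// => x y /eqP; rewrite eqr_nat => /eqP//.
Qed.

Lemma stirling2_diag n : stirling2 n n = 1%N.
Proof.
have := congr1 (fun p : {poly rat} => p`_n) (stirling2_poly n).
have sz j : size (\prod_(i < j) ('X - (i%:R)%:P) : {poly rat}) = j.+1.
  by rewrite size_prod_XsubC /index_enum -enumT size_enum_ord.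
rewrite coefXn eqxx big_ord_recr /= coefD coef_sum big1 ?add0r => [|j _]; last first.
  by rewrite coefZ nth_default ?mulr0// sz.
have m : (\prod_(i < n) ('X - (i%:R)%:P) : {poly rat})`_n = 1.
  by have := monicP (monic_prod_XsubC (index_enum 'I_n) xpredT (fun i : 'I_n => i%:R : rat)); rewrite lead_coefE sz.
by rewrite coefZ m mulr1 => /eqP; rewrite -[1]/(1%:R) eqr_nat => /eqP.
Qed.

(** [stirling2_poly] at [-1], where the falling factorial of length [j] is [(-1)^j j!]. *)
Lemma stirling2_sign n :
  \sum_(j < n.+1) j`!%:Z * (-1) ^+ j * (stirling2 n j)%:Z = (-1) ^+ n :> int.
Proof.
apply: (@intr_inj rat); have := congr1 (fun p => p.[-1]) (stirling2_poly n).
rewrite hornerXn horner_sum => E; rewrite rmorphXn rmorphN1 E rmorph_sum.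
apply: eq_bigr => j _; rewrite hornerZ horner_prod !rmorphM rmorphXn rmorphN1 mulrC; congr (_ * _).
elim: (nat_of_ord j) => [|i IH]; first by rewrite big_ord0 expr0 mulr1.
rewrite big_ord_recr /= -IH hornerXsubC factS PoszM rmorphM exprS /=.
by rewrite -!pmulrn -natr1; ring.
Qed.

Lemma stirling20 n : (0 < n)%N -> stirling2 n 0 = 0%N.
Proof.
case: n => // n _; have := expn_stirling2 0 n.+1; rewrite exp0n// big_ord_recl /= ffactn0 muln1.
by case: (stirling2 n.+1 0).
Qed.

Lemma sum_binX (A : comNzRingType) (x : A) (j N : nat) : (j < N)%N ->
  \sum_(0 <= m < N) 'C(j, m)%:R * x ^+ m = (1 + x) ^+ j.
Proof.
move=> jN; rewrite exprDn (big_cat_nat (n := j.+1))//= big_mkord.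
rewrite [X in _ + X]big_nat [X in _ + X]big1 ?addr0.
  by apply: eq_bigr => i _; rewrite expr1n mul1r mulr_natl.
by move=> i /andP[ji _]; rewrite bin_small// mul0r.
Qed.

(** The alternating sum of the ['C(j, m)] over [m] vanishes unless [j = 0], and then the Stirling
    number does. It lets the sum over [l] in [horner_Pe] start at 0. *)
Lemma coef_b0 k : (0 < k)%N -> coef_b k 0 = 0.
Proof.
move=> k0; have s0 : stirling2 (2 * k - 1) 0 = 0%N by apply: stirling20; lia.
rewrite /coef_b (eq_bigr (fun m => \sum_(0 <= j < 2 * k) j`!%:Z * (-1) ^+ j *
  (stirling2 (2 * k - 1) j)%:Z * ((-1) ^+ m * 'C(j, m)%:Z))); last first.
  move=> m _; rewrite bin0 mulr1 mulr_sumr; apply: eq_bigr => j _.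
  by rewrite mulrCA.
rewrite exchange_big /= big_nat big1// => j /andP[_ jk]; rewrite -mulr_sumr.
have -> : \sum_(0 <= m < 2 * k) (-1) ^+ m * 'C(j, m)%:Z = (1 - 1) ^+ j :> int.
  rewrite -(sum_binX _ jk); apply: eq_bigr => m _; by rewrite mulrC natz.
by rewrite subrr; case: j {jk} => [|j]; rewrite ?s0 ?mulr0 ?mul0r// expr0n mulr0.
Qed.

Lemma coef_a0 k : (0 < k)%N -> coef_a k 0 = -1.
Proof.
move=> k0; have E : (2 * k = (2 * k - 1).+1)%N by lia.
rewrite /coef_a {1}E big_mkord.
rewrite (eq_bigr (fun j : 'I__ => j`!%:Z * (-1) ^+ j * (stirling2 (2 * k - 1) j)%:Z)).
  by rewrite stirling2_sign -signr_odd oddB ?oddM//=; lia.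
by move=> j _; rewrite bin0 mulr1.
Qed.

(** The top coefficient, at [l = 2 * k - 1], receives only the term [m = 0], and
    [coef_a k 0 = -1]. *)
Lemma size_Pe k : (0 < k)%N -> size (Pe k) = (2 * k - 2).+1.
Proof.
move=> k0; pose c l := (-1) ^+ l * coef_b k l.
have PE : Pe k = \poly_(i < (2 * k - 2).+1) c i.+1.
  rewrite /Pe poly_def -(big_mkord xpredT (fun i => c i.+1 *: 'X^i)).
  rewrite big_add1 (_ : (2 * k).-1 = (2 * k - 2).+1)%N; last by lia.
  by apply: eq_bigr => i _; rewrite subn1.
rewrite PE size_poly_eq// /c /coef_b (_ : (2 * k = (2 * k - 2).+2)%N); last by lia.
rewrite big_nat_recl//= big_nat big1 => [|i /andP[_ ik]].
  rewrite expr0 mul1r addr0 coef_a0// (_ : (2 * k - 2).+2 - 0 - 1 = ((2 * k - 2).+2 - 2).+1)%N ?binn ?mulr1; last by lia.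
  by rewrite -signr_odd; case: odd.
by rewrite bin_small ?mulr0//; lia.
Qed.

Section Summand.
Context {R : realType}.
Local Notation C := R[i].

Lemma diskcv_bin j : diskcv (fun n => 'C(n, j)%:R : C).
Proof.
move=> q q1; apply: (@pser_cv_poly _ _ _ 1 j) => // n; rewrite nrm_nat mul1r -natrX ler_nat.
elim: j n => [|j IH] n; first by rewrite bin0.
elim: n => [|n IHn]; first by rewrite bin0n.
rewrite binS (leq_trans (leq_add IHn (IH n)))// [in leqRHS]expnS mulSn.
have h : (n ^ j <= n.+1 ^ j)%N by case: (j) => // i; rewrite leq_exp2r.
by rewrite addnC leq_add// expnS leq_mul.
Qed.

Lemma pser_bin j (z : C) : nrm z < 1 -> pser (fun n => 'C(n, j)%:R) z = z ^+ j / (1 - z) ^+ j.+1.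
Proof.
move=> z1; have nz := nrm_lt1_neq0 z1.
elim: j => [|j IH].
  rewrite expr0 expr1 mul1r -csum_geo//; apply: eq_csum => n _.
  by rewrite bin0 mul1r.
have [c1 E1] := pser_head (diskcv_bin j.+1 z1).
have E : pser (fun n => 'C(n.+1, j.+1)%:R) z = pser (fun n => 'C(n, j.+1)%:R) z + pser (fun n => 'C(n, j)%:R) z.
  rewrite -pserD; [|exact: diskcv_bin..].
  by apply: eq_csum => n _; rewrite binS natrD.
have H : (1 - z) * pser (fun n => 'C(n, j.+1)%:R) z = z * (z ^+ j / (1 - z) ^+ j.+1).
  by rewrite mulrBl mul1r {1}E1 E IH bin0n add0r mulrDr addrAC subrr add0r.
apply: (mulfI nz); rewrite H !exprS; move: (expf_neq0 j nz) => nj.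
by move: ((1 - z) ^+ j) (z ^+ j) nj => X Y nX; field; rewrite nX nz.
Qed.

Lemma pser_pow n (z : C) : nrm z < 1 -> pser (fun m => m%:R ^+ n) z =
  \sum_(j < n.+1) (j`!%:R * (stirling2 n j)%:R) * (z ^+ j / (1 - z) ^+ j.+1).
Proof.
move=> z1; transitivity (csum setT (fun m =>
    \sum_(j < n.+1) (j`!%:R * (stirling2 n j)%:R) * ('C(m, j)%:R * z ^+ m))).
  apply: eq_csum => m _; rewrite -natrX expn_stirling2 natr_sum mulr_suml.
  by apply: eq_bigr => j _; rewrite -bin_ffact !natrM; ring.
rewrite (csum_sum _ _).2 => [|j _]; last by apply: csummableZ; exact: diskcv_bin.
apply: eq_bigr => j _; rewrite csumZ; last exact: diskcv_bin.
by rewrite -pser_bin.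
Qed.

(** The sum over [l] is the binomial expansion of a power of [1 - z]: the [coef_b] arise from the
    [coef_a] by passing from powers of [1 - z] to powers of [z]. *)
Lemma horner_Pe k (z : C) : (0 < k)%N -> z * (map_poly intr (Pe k)).[z] =
  \sum_(0 <= m < 2 * k) (-1) ^+ m * (coef_a k m)%:~R * (1 - z) ^+ (2 * k - m - 1).
Proof.
move=> k0; pose a m : C := (coef_a k m)%:~R.
transitivity (\sum_(0 <= l < 2 * k) (-1) ^+ l * (coef_b k l)%:~R * z ^+ l).
  rewrite big_ltn; last by lia.
  rewrite coef_b0// mulr0 mul0r add0r /Pe rmorph_sum horner_sum mulr_sumr.
  apply: eq_big_nat => l /andP[l0 _].
  rewrite /= map_polyZ map_polyXn hornerZ hornerXn rmorphM rmorphXn rmorphN1 mulrCA -exprS.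
  by rewrite -subSn// subn1.
transitivity (\sum_(0 <= l < 2 * k) \sum_(0 <= m < 2 * k) (-1) ^+ m * a m * ((- z) ^+ l *+ 'C(2 * k - m - 1, l))).
  apply: eq_bigr => l _; rewrite /coef_b rmorph_sum mulr_sumr mulr_suml.
  apply: eq_bigr => m _; rewrite !rmorphM rmorphXn rmorphN1 /= -pmulrn (exprNn z) -mulr_natr /a.
  by move: ((-1) ^+ l : C) ((-1) ^+ m : C) => S S'; ring.
rewrite exchange_big /=; apply: eq_big_nat => m /andP[_ mk].
rewrite -mulr_sumr; congr (_ * _).
rewrite -(@sum_binX _ _ _ (2 * k)); last by lia.
by apply: eq_bigr => i _; rewrite mulr_natl.
Qed.

Lemma summandE k (z : C) : (0 < k)%N -> nrm z < 1 ->
  summand k (z : C^o) = 2 ^+ (2 * k - 1) * pser (fun m => m%:R ^+ (2 * k - 1)) z.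
Proof.
move=> k0 z1; have nz := nrm_lt1_neq0 z1.
have k1 : (2 * k = (2 * k - 1).+1)%N by lia.
rewrite /summand -!mulrA; congr (_ * _); rewrite pser_pow// mulrA.
pose a m : C := (coef_a k m)%:~R.
rewrite horner_Pe// mulr_suml.
transitivity (\sum_(0 <= m < 2 * k) \sum_(0 <= j < 2 * k) j`!%:R * (-1) ^+ j *
    (stirling2 (2 * k - 1) j)%:R * (1 - z)^-1 * ('C(j, m)%:R * (- (1 - z)^-1) ^+ m)).
  apply: eq_big_nat => m /andP[_ mk].
  rewrite /a /coef_a rmorph_sum mulr_sumr !mulr_suml; apply: eq_bigr => j _.
  rewrite !rmorphM rmorphXn rmorphN1 /= -!pmulrn.
  have -> : (1 - z) ^+ (2 * k) = (1 - z) ^+ (2 * k - m - 1) * (1 - z) ^+ m * (1 - z).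
    by rewrite -exprD -exprSr; congr (_ ^+ _); lia.
  rewrite (exprNn (1 - z)^-1) exprVn; move: (expf_neq0 m nz) (expf_neq0 (2 * k - m - 1) nz) (nz).
  move: ((1 - z) ^+ m) ((1 - z) ^+ (2 * k - m - 1)) (1 - z) => X Y Z X0 Y0 Z0.
  by move: ((-1) ^+ j : C) ((-1) ^+ m : C) => S S'; field; rewrite X0 Y0 Z0.
rewrite exchange_big /= -(big_mkord xpredT (fun j => j`!%:R * (stirling2 (2 * k - 1) j)%:R *
  (z ^+ j / (1 - z) ^+ j.+1))) -k1.
apply: eq_big_nat => j /andP[_ jk]; rewrite -mulr_sumr sum_binX//.
(* The sum over [m] has produced the [j]-th power of this number, which restores the terms of
   [pser_pow]. *)
have -> : 1 - (1 - z)^-1 = - z / (1 - z) by field.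
rewrite expr_div_n (exprNn z); move: (expf_neq0 j nz) (nz).
have : (-1) ^+ j * (-1) ^+ j = 1 :> C by rewrite -exprMn mulrNN mulr1 expr1n.
rewrite exprSr; move: ((-1) ^+ j : C) (1 - z) ((1 - z) ^+ j) (z ^+ j) => S Y X Z S2 X0 Y0.
transitivity (S * S * (j`!%:R * (stirling2 (2 * k - 1) j)%:R * (Z / (X * Y)))); last by rewrite S2 mul1r.
by field; rewrite X0 Y0.
Qed.

(** At [z = 1] only [m = 2 * k - 1] survives in [horner_Pe], and then only [j = 2 * k - 1] in
    [coef_a]. This is the factorial of [normalization]. *)
Lemma Pe1 k : (0 < k)%N -> (map_poly intr (Pe k)).[1 : C] = (2 * k - 1)`!%:R.
Proof.
move=> k0; have := horner_Pe 1 k0; rewrite mul1r subrr => ->.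
have k1 : (2 * k = (2 * k - 1).+1)%N by lia.
rewrite [X in \sum_(0 <= _ < X) _]k1 big_nat_recr//= big_nat big1 ?add0r => [|m /andP[_ mk]]; last first.
  by rewrite expr0n (_ : (_ == 0)%N = false) ?mulr0//; lia.
rewrite (_ : (2 * k - (2 * k - 1) - 1 = 0)%N) ?expr0 ?mulr1; last by lia.
rewrite /coef_a [X in \sum_(0 <= _ < X) _]k1 big_nat_recr//= big_nat big1 ?add0r => [|j /andP[_ jk]]; last first.
  by rewrite bin_small ?mulr0.
rewrite binn stirling2_diag !mulr1 rmorphM rmorphXn rmorphN1 mulrCA -exprMn mulrNN mulr1 expr1n mulr1.
by rewrite /= -pmulrn.
Qed.

End Summand.

(** * Both sides of the identity as functions of the nome *)

Section OddSums.
Context {R : realType}.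
Local Notation C := R[i].

(** The summand is a power series without constant term. The linear bound gives convergence of the
    odd series and, later, exponential decay at the cusps. *)
Lemma summand_bound k (rho : R) : (0 < k)%N -> 0 <= rho < 1 -> exists2 B : R, 0 <= B &
  forall z : C, nrm z <= rho -> nrm (summand k (z : C^o)) <= B * nrm z.
Proof.
move=> k0 r01; have [r0 r1] := andP r01; pose w := (2 * k - 1)%N.
have rhoC : nrm (rho%:C : C) < 1 by rewrite nrm_real ger0_norm.
have cw (q : C) : nrm q < 1 -> pser_cv (fun m => m%:R ^+ w) q.
  move=> q1; apply: (@pser_cv_poly _ _ _ 1 w) => // m.
  by rewrite nrmX nrm_nat mul1r.
have cw1 (q : C) : nrm q < 1 -> pser_cv (fun m => m.+1%:R ^+ w) q.
  move=> q1; exact: (pser_head (cw q q1)).1.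
exists (2 ^+ w * rsum setT (fun n => nrm (n.+1%:R ^+ w : C) * rho ^+ n)).
  rewrite mulr_ge0 ?exprn_ge0// possum_rsum ?possum_ge0// => [n|n|].
  - by rewrite mulr_ge0 ?nrm_ge0 ?exprn_ge0.
  - by rewrite mulr_ge0 ?nrm_ge0 ?exprn_ge0.
  - apply: rsummable_le (cw1 _ rhoC) => n _.
    rewrite nrmM (nrmX (rho%:C)) nrm_real (ger0_norm r0) ger0_norm//.
    by rewrite mulr_ge0 ?nrm_ge0 ?exprn_ge0.
move=> z zr; have z1 := le_lt_trans zr r1.
rewrite summandE// nrmM nrmX nrm_nat -mulrA ler_wpM2l ?exprn_ge0//.
rewrite (pser_head (cw z z1)).2 expr0n (_ : (2 * k - 1 == 0)%N = false) ?add0r; last by lia.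
by rewrite nrmM mulrC ler_wpM2r ?nrm_ge0// nrm_pser_le//; exact: cw1.
Qed.

Definition odd_sum k (Q : C) : C := csum setT (fun n => summand k (Q ^+ (2 * n + 1) : C^o)).

Lemma csummable_odd_sum k (Q : C) : (0 < k)%N -> nrm Q < 1 ->
  csummable setT (fun n => summand k (Q ^+ (2 * n + 1) : C^o)).
Proof.
move=> k0 Q1; have Q01 : 0 <= nrm Q < 1 by rewrite nrm_ge0.
have [B B0 HB] := summand_bound k0 Q01.
apply: csummable_le (rsummableZ B (rsummable_geo Q01)) => n _.
have le1 m : (n <= m)%N -> nrm Q ^+ m <= nrm Q ^+ n.
  by move=> nm; rewrite ler_wiXn2l ?nrm_ge0// ltW.
apply: le_trans (HB _ _) _.
  by rewrite nrmX addn1 exprS ler_piMr ?nrm_ge0// exprn_ile1 ?nrm_ge0// ltW.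
by rewrite ler_wpM2l// nrmX le1//; lia.
Qed.

Lemma odd_series_cvg k (Q : C) : (0 < k)%N -> nrm Q < 1 ->
  odd_series k (Q : C^o) @ \oo --> (odd_sum k Q : C^o).
Proof. by move=> k0 Q1; apply: cvg_series_csum; exact: csummable_odd_sum. Qed.

Lemma odd_series_lim k (Q : C) : (0 < k)%N -> nrm Q < 1 ->
  limn (odd_series k (Q : C^o)) = odd_sum k Q.
Proof. by move=> k0 Q1; apply/cvg_lim => //; exact: odd_series_cvg. Qed.

Lemma T_seriesE k (q Q : C) : q ^+ 2 = Q -> T_series k (q : C^o) = odd_series k (Q : C^o).
Proof.
move=> qQ; have E n : q ^+ (4 * n + 2) = Q ^+ (2 * n + 1).
  by rewrite -qQ -exprM; congr (q ^+ _); lia.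
by rewrite /T_series /odd_series; apply: congr1; apply/funext => n; rewrite E.
Qed.

Lemma T_productE k (q Q : C) : q ^+ 2 = Q -> T_product k (q : C^o) = odd_product k (Q : C^o).
Proof.
move=> qQ; apply/funext => N; apply: eq_big_nat => n /andP[n0 _].
have E m : q ^+ (2 * m) = Q ^+ m by rewrite -qQ -exprM.
by rewrite -!E; congr ((1 - q ^+ _) ^+ _ / (1 - q ^+ _) ^+ _); lia.
Qed.

Lemma odd_sum2 (Q : C) : nrm Q < 1 -> odd_sum 2 Q = 8 * lambert wt_cube Q.
Proof.
move=> Q1; pose A : set (nat * nat) := [set p | odd p.2].
have b : set_bij (setT `*`` fun=> setT) A (fun p : nat * nat => (p.2, (2 * p.1 + 1)%N)).
  apply: (@can_set_bij _ _ _ _ _ (fun p => (p.2./2, p.1))) => // -[a x] /=; first by rewrite /A /=; lia.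
    by move=> _; congr pair; lia.
  by rewrite /A /= => xo; congr pair; lia.
have [|| sA ->] := lambert_set Q1 (A := A) (f := fun p => p.1%:R ^+ 3) (@wt_cube_bound R).
- by move=> [a x]; rewrite /A /wt_cube /= => ->.
- by move=> [a x]; rewrite /A /wt_cube /= => /negP /negbTE ->.
- move: sA => /(csummable_reindex _ b) sA; rewrite (csum_reindex _ b).
  rewrite (csum_pair (f := fun n a => a%:R ^+ 3 * Q ^+ (a * (2 * n + 1))))//.
  rewrite -csumZ; last exact: (csummable_outer (f := fun n a => a%:R ^+ 3 * Q ^+ (a * (2 * n + 1)))).
  apply: eq_csum => n _; rewrite summandE//; last by apply: qX_lt1 => //; rewrite addn1.
  congr (_ * _); first by ring.
  by apply: eq_csum => a _; rewrite -exprM mulnC.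
Qed.

(** [T_nome] as a function of the square of its argument, with the product already replaced by a
    power of the weight 4 series. *)
Definition odd_diff k (Q : C) : C := odd_sum k Q - ratr (coef_d k) * (odd_sum 2 Q / 8) ^+ k./2.

Lemma product_side k (Q : C) : ~~ odd k -> nrm Q < 1 ->
  cvgn (odd_product k (Q : C^o)) /\
  Q ^+ k./2 * ratr (coef_d k) * limn (odd_product k (Q : C^o)) =
    ratr (coef_d k) * (odd_sum 2 Q / 8) ^+ k./2.
Proof.
move=> ke Q1; have qQ := sqrtCK Q.
have H := odd_product_cvg (k := k) Q1 qQ.
split; first by apply: cvgP H.
have -> : limn (odd_product k (Q : C^o)) = (pser odd_lambert_coef (sqrtC Q)) ^+ k by apply/cvg_lim.
rewrite odd_sum2// [8 * _]mulrC mulfK ?pnatr_eq0// -(odd_product_lambert _ Q1 qQ) mulrAC mulrC.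
by rewrite mul2n halfK (negbTE ke) subn0.
Qed.

Lemma T_nomeE k (q : C) : (0 < k)%N -> ~~ odd k -> nrm q < 1 ->
  [/\ cvgn (T_series k (q : C^o)), cvgn (T_product k (q : C^o)) &
      T_nome k (q : C^o) = odd_diff k (q ^+ 2)].
Proof.
move=> k0 ke q1; have : nrm (q ^+ 2) < 1 by apply: qX_lt1.
have := erefl (q ^+ 2); move: {2 3 4}(q ^+ 2) => Q qQ Q1.
have [cp Ep] := product_side ke Q1.
have c1 : cvgn (odd_series k (Q : C^o)) by apply: cvgP (odd_series_cvg k0 Q1).
have e1 := T_seriesE k qQ; have e2 := T_productE k qQ.
split; first by rewrite e1; exact: c1.
  by rewrite e2; exact: cp.
rewrite /T_nome /odd_diff; apply: (f_equal2 (fun a b => a - b)).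
  by rewrite e1; exact: odd_series_lim.
have qk : q ^+ k = Q ^+ k./2 by rewrite -qQ -exprM mul2n halfK (negbTE ke) subn0.
by rewrite e2 qk; exact: Ep.
Qed.

End OddSums.

(** * Lattice sums *)

Section Lattice.
Context {R : realType}.
Local Notation C := R[i].
Local Notation tpi := ((2 * pi)%:C * 'i%C : C).

(* [T k] is a combination of powers of the sums of [(c tau + d)^-w] over the
   rows [(c, d)] with [c = 2 mod 4]. *)
Definition lin_form (tau : C) (p : int * int) : C := p.1%:~R * tau + p.2%:~R.

Definition lattice_sum (X : set (int * int)) (w : nat) (tau : C) : C :=
  csum X (fun p => (lin_form tau p ^+ w)^-1).

Lemma Im_lin_form tau p : complex.Im (lin_form tau p) = p.1%:~R * complex.Im tau.
Proof.
rewrite /lin_form Im_addz -(rmorph_int (real_complex R)); case: tau => a b /=.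
by rewrite mul0r addr0.
Qed.

Lemma Re_lin_form tau p : complex.Re (lin_form tau p) = p.1%:~R * complex.Re tau + p.2%:~R.
Proof.
rewrite /lin_form Re_addz -(rmorph_int (real_complex R)); case: tau => a b /=.
by rewrite mul0r subr0.
Qed.

Lemma int_sq_ge1 (r : int) : r != 0 -> 1 <= r%:~R ^+ 2 :> R.
Proof.
move=> r0; rewrite -real_normK ?num_real//; have := @int_norm_ge1 R r r0.
by move=> h; rewrite exprn_ege1.
Qed.

Lemma lin_form_lower (tau : C) : 0 < complex.Im tau -> exists2 d : R, 0 < d &
  forall p, p != 0 -> d <= nrm (lin_form tau p).
Proof.
move=> t0; exists (Num.min 1 (complex.Im tau)); first by rewrite lt_min ltr01.
move=> [c d] p0; have [c0|c0] := eqVneq c 0.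
  have d0 : d != 0 by apply: contra_neq p0 => ->; rewrite c0.
  by rewrite /lin_form c0 mul0r add0r nrm_int ge_min int_norm_ge1.
apply: le_trans (Im_le_nrm _); rewrite Im_lin_form normrM ge_min; apply/orP; right.
by rewrite (gtr0_norm t0) ler_peMl ?(ltW t0)// int_norm_ge1.
Qed.

(** Each of [1 + c^2] and [1 + d^2] is at most a constant times [|c tau + d|^2]. This separates the
    variables, so that from weight 4 on the lattice sums are dominated by a product of two single
    sums. *)
Lemma lin_form_quad (tau : C) : 0 < complex.Im tau -> exists2 K : R, 0 < K &
  forall p, p != 0 -> (1 + p.1%:~R ^+ 2) * (1 + p.2%:~R ^+ 2) <= K * nrm (lin_form tau p) ^+ 4.
Proof.
move=> t0; set x := complex.Re tau; set y := complex.Im tau; rewrite -/y in t0.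
have y2 : 0 < y ^+ 2 by rewrite exprn_gt0.
exists ((2 / y ^+ 2 + 1) * ((2 * x ^+ 2 + 1) / y ^+ 2 + 2)).
  by rewrite mulr_gt0// ltr_wpDl// divr_ge0 ?(ltW y2)// ?addr_ge0// mulr_ge0// sqr_ge0.
move=> [c d] p0; rewrite (_ : nrm _ ^+ 4 = nrm (lin_form tau (c, d)) ^+ 2 * nrm (lin_form tau (c, d)) ^+ 2); last by rewrite -exprD.
rewrite mulrACA nrm_sqr Im_lin_form Re_lin_form -/x -/y /=.
set N := (X in _ * X * _); move: p0 @N.
have x2 := sqr_ge0 x; have [->|c0] := eqVneq c 0 => p0.
  have d0 : d != 0 by apply: contra_neq p0 => ->.
  have := int_sq_ge1 d0; set D : R := d%:~R => D1.
  rewrite !mul0r !add0r !expr0n !addr0 /=.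
  have a0 : 0 <= (2 / y ^+ 2) by rewrite divr_ge0// ltW.
  have b0 : 0 <= (2 * x ^+ 2 + 1) / y ^+ 2 by rewrite divr_ge0 ?(ltW y2)// addr_ge0// mulr_ge0.
  apply: ler_pM => //; rewrite ?addr_ge0 ?sqr_ge0//; nra.
have := int_sq_ge1 c0; set c' : R := c%:~R; set D : R := d%:~R => C1 N.
have aE : (2 / y ^+ 2) * y ^+ 2 = 2 by rewrite divfK// gt_eqF.
have bE : ((2 * x ^+ 2 + 1) / y ^+ 2) * y ^+ 2 = 2 * x ^+ 2 + 1 by rewrite divfK// gt_eqF.
move: (2 / y ^+ 2) ((2 * x ^+ 2 + 1) / y ^+ 2) aE bE => a b aE bE.
have a0 : 0 <= a by rewrite -(pmulr_lge0 _ y2) aE.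
have b0 : 0 <= b by rewrite -(pmulr_lge0 _ y2) bE addr_ge0// mulr_ge0.
have NE : N = (c' * x + D) ^+ 2 + c' ^+ 2 * y ^+ 2 by rewrite /N exprMn.
have N0 : 0 <= N by rewrite addr_ge0 ?sqr_ge0.
have M0 : 0 <= (c' * x + D) ^+ 2 by exact: sqr_ge0.
apply: ler_pM; rewrite ?addr_ge0 ?sqr_ge0//.
  have -> : (a + 1) * N = a * (c' * x + D) ^+ 2 + c' ^+ 2 * (a * y ^+ 2) + N by rewrite NE; ring.
  have := mulr_ge0 a0 M0; rewrite aE; have := mulr_ge0 (sqr_ge0 c') (ltW y2).
  by move: NE; nra.
have -> : (b + 2) * ((c' * x + D) ^+ 2 + (c' * y) ^+ 2) =
    b * (c' * x + D) ^+ 2 + c' ^+ 2 * (b * y ^+ 2) + 2 * ((c' * x + D) ^+ 2 + c' ^+ 2 * y ^+ 2) by ring.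
rewrite bE.
have : D ^+ 2 <= 2 * (c' * x + D) ^+ 2 + 2 * x ^+ 2 * c' ^+ 2.
  have := sqr_ge0 (2 * (c' * x) + D); nra.
have := mulr_ge0 (sqr_ge0 c') (ltW y2); have := mulr_ge0 b0 M0.
by have := mulr_ge0 (sqr_ge0 c') x2; nra.
Qed.

Lemma rsummable_lattice : rsummable setT
  (fun p : int * int => ((1 + p.1%:~R ^+ 2) * (1 + p.2%:~R ^+ 2))^-1 : R).
Proof.
have E : [set: int * int] = setT `*`` (fun=> setT) by apply/seteqP; split.
rewrite E; have s : csummable setT (fun r : int => ((1 + r%:~R ^+ 2)^-1)%:C : C).
  apply: rsummable_le rsummable_int_invsq => r _; rewrite nrm_real normr_id ger0_norm//.
  by rewrite invr_ge0 addr_ge0 ?sqr_ge0.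
apply: rsummable_le (csummable_mul s s) => -[c d] _ /=.
by rewrite nrmM !nrm_real invfM normrM.
Qed.

Lemma csummable_lattice_sum X w (tau : C) : (4 <= w)%N -> 0 < complex.Im tau ->
  csummable X (fun p => (lin_form tau p ^+ w)^-1).
Proof.
move=> w4 t0; have [d d0 Hd] := lin_form_lower t0; have [K K0 HK] := lin_form_quad t0.
apply: csummable_sub (@subsetT _ _) _.
apply: csummable_le (rsummableZ ((d ^+ (w - 4))^-1 * K) rsummable_lattice) => p _.
have q0 : 0 < (1 + p.1%:~R ^+ 2) * (1 + p.2%:~R ^+ 2) :> R.
  by rewrite mulr_gt0// ltr_wpDr// sqr_ge0.
have [->|p0] := eqVneq p 0.
  rewrite /lin_form mul0r add0r expr0n gtn_eqF ?(leq_trans _ w4)// invr0 nrm0.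
  by rewrite !mulr_ge0 ?invr_ge0 ?exprn_ge0 ?(ltW d0) ?(ltW K0) ?mulr_ge0 ?addr_ge0 ?sqr_ge0.
have n0 : 0 < nrm (lin_form tau p) by apply: lt_le_trans (Hd p p0).
rewrite nrmV nrmX -{1}(subnK w4) exprD invfM -mulrA.
apply: ler_pM; rewrite ?invr_ge0 ?exprn_ge0 ?(ltW n0)//.
  by rewrite lef_pV2 ?posrE ?exprn_gt0// lerXn2r ?nnegrE ?(ltW d0) ?(ltW n0) ?Hd.
rewrite ler_pdivlMr// mulrC ler_pdivrMr ?exprn_gt0//; exact: HK.
Qed.

Definition lipschitz_const k : C := 2 ^+ (2 * k - 1) * (2 * k - 1)`!%:R / tpi ^+ (2 * k).

Lemma lipschitz_const_neq0 k : lipschitz_const k != 0.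
Proof.
by rewrite !mulf_neq0 ?invr_eq0 ?expf_neq0 ?twopii_neq0 ?factC_neq0 ?pnatr_eq0.
Qed.

Lemma summand_nome k (s : C) : (0 < k)%N -> 0 < complex.Im s ->
  summand k (nome (s : C^o)) = lipschitz_const k * row_sum (2 * k) s.
Proof.
move=> k0 s0; rewrite [LHS]summandE ?nome_lt1//.
have E : (2 * k = 2 * k - 2 + 2)%N by lia.
have := lipschitz_formula (2 * k - 2) s0; rewrite -E -signr_odd oddB ?oddM//=; last by lia.
rewrite (_ : (2 * k - 2).+1 = 2 * k - 1)%N; last by lia.
rewrite expr0 mul1r => H.
have p := expf_neq0 (2 * k) (@twopii_neq0 R).
have f0 := @factC_neq0 R (2 * k - 2)%N.
have -> : pser (fun m => m%:R ^+ (2 * k - 1)) (nome (s : C^o)) =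
    (2 * k - 2)`!%:R / tpi ^+ (2 * k) * ((2 * k - 1)%:R * row_sum (2 * k) s).
  rewrite H; move: p f0; move: (tpi ^+ (2 * k)) => P p f0.
  by field; rewrite p f0.
rewrite /lipschitz_const (_ : (2 * k - 1)`! = (2 * k - 1) * (2 * k - 2)`!)%N.
  by rewrite natrM; move: p; move: (tpi ^+ (2 * k)) => P p; field.
by rewrite (_ : (2 * k - 1 = (2 * k - 2).+1)%N) ?factS//; lia.
Qed.

(** The rows that occur in [T (tau / 2)]; those of [two_row] occur in [T tau]. *)
Definition odd_row : set (int * int) := [set p | (p.1 %% 2)%Z = 1].
Definition two_row : set (int * int) := [set p | (p.1 %% 4)%Z = 2].

(** For even [w] the rows [c] and [- c] contribute equally, whence the factor 2. *)
Lemma lattice_sum_odd_row w (tau : C) : (4 <= w)%N -> ~~ odd w -> 0 < complex.Im tau ->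
  lattice_sum odd_row w tau = 2 * csum setT (fun n : nat => row_sum w ((2 * n + 1)%:R * tau)).
Proof.
move=> w4 we t0; have s := csummable_lattice_sum odd_row w4 t0.
rewrite /lattice_sum (csumID [set p : int * int | 0 <= p.1] s).
have b1 : set_bij (setT `*`` fun=> setT) (odd_row `&` [set p : int * int | 0 <= p.1])
    (fun p : nat * int => (Posz (2 * p.1 + 1), p.2)).
  apply: (@can_set_bij _ _ _ _ _ (fun p : int * int => (`|p.1|%N./2, p.2))) => -[a c] /=.
  - by rewrite /odd_row /=; lia.
  - by [].
  - by move=> _; congr pair; lia.
  - by rewrite /odd_row /= => -[a1 a0]; congr pair; lia.
have b2 : set_bij (setT `*`` fun=> setT) (odd_row `&` ~` [set p : int * int | 0 <= p.1])
    (fun p : nat * int => (- Posz (2 * p.1 + 1), - p.2)).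
  apply: (@can_set_bij _ _ _ _ _ (fun p : int * int => (`|p.1|%N./2, - p.2))) => -[a c] /=.
  - by rewrite /odd_row /=; lia.
  - by [].
  - by move=> _; congr pair; lia.
  - by rewrite /odd_row /= => -[a1 a0]; congr pair; lia.
rewrite (csum_reindex _ b1) (csum_reindex _ b2) mulr2n mulrDl mul1r.
have E : csum (setT `*`` fun=> setT) ((fun p => (lin_form tau p ^+ w)^-1) \o (fun p : nat * int => (Posz (2 * p.1 + 1), p.2))) =
    csum setT (fun n : nat => row_sum w ((2 * n + 1)%:R * tau)).
  rewrite (csum_pair (f := fun (n : nat) (d : int) => (lin_form tau (Posz (2 * n + 1), d) ^+ w)^-1)).
    by apply: eq_csum => n _; apply: eq_csum => d _; rewrite /lin_form /= -pmulrn.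
  apply: (csummable_reindex (fun p => (lin_form tau p ^+ w)^-1) b1).1; exact: csummable_lattice_sum.
rewrite -E; apply: congr1; apply: eq_csum => -[n d] _ /=.
by rewrite /lin_form /= !rmorphN mulNr -opprD exprNn -signr_odd (negbTE we) mul1r.
Qed.

Lemma odd_sum_lattice_sum k (tau : C) : (2 <= k)%N -> 0 < complex.Im tau ->
  odd_sum k (nome (tau : C^o)) = lipschitz_const k / 2 * lattice_sum odd_row (2 * k) tau.
Proof.
move=> k2 t0; have k0 : (0 < k)%N by lia.
have u n : 0 < complex.Im ((2 * n + 1)%:R * tau).
  rewrite -(rmorph_nat (real_complex R)); case: (tau) t0 => a b /= b0.
  by rewrite mul0r addr0 mulr_gt0// ltr0n addn1.
have E n : summand k (nome (tau : C^o) ^+ (2 * n + 1) : C^o) = lipschitz_const k * row_sum (2 * k) ((2 * n + 1)%:R * tau).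
  by rewrite -nomeMn summand_nome.
rewrite lattice_sum_odd_row ?oddM//; last by lia.
rewrite mulrA divfK ?pnatr_eq0// -csumZ; first by apply: eq_csum => n _; exact: E.
have := csummable_odd_sum k0 (nome_lt1 t0) => /(csummableZ (lipschitz_const k)^-1).
by apply: eq_csummable => n _; rewrite E mulKf ?lipschitz_const_neq0.
Qed.

(** [T] with its rows as a parameter, so that the modular group acts on [X] alone. In the power,
    [16 = 2 * 8]: the 2 for the rows [c] and [- c], the 8 from [odd_diff]. *)
Definition lattice_form (X : set (int * int)) k (tau : C) : C :=
  lipschitz_const k / 2 * lattice_sum X (2 * k) tau - ratr (coef_d k) * (lipschitz_const 2 / 16 * lattice_sum X 4 tau) ^+ k./2.

Lemma odd_diff_lattice_form k (tau : C) : (2 <= k)%N -> 0 < complex.Im tau ->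
  odd_diff k (nome (tau : C^o)) = lattice_form odd_row k tau.
Proof.
move=> k2 t0; rewrite /odd_diff (odd_sum_lattice_sum k2 t0) (odd_sum_lattice_sum (leqnn 2) t0) /lattice_form.
by rewrite [lipschitz_const 2 / 2 * _ / 8]mulrAC -[lipschitz_const 2 / 2 / 8]mulrA -invfM -natrM.
Qed.

Lemma lattice_sum_two_row w (tau : C) : lattice_sum two_row w tau = lattice_sum odd_row w (2 * tau).
Proof.
have b : set_bij odd_row two_row (fun p : int * int => (2 * p.1, p.2)).
  apply: (@can_set_bij _ _ _ _ _ (fun p : int * int => ((p.1 %/ 2)%Z, p.2))) => -[a c] /=.
  - by rewrite /odd_row /two_row /=; lia.
  - by rewrite /odd_row /two_row /=; lia.
  - by move=> _; congr pair; lia.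
  - by rewrite /two_row /= => H; congr pair; lia.
rewrite /lattice_sum (csum_reindex _ b); apply: eq_csum => p _ /=.
rewrite /lin_form (_ : (2 * p.1, p.2).1%:~R = 2 * p.1%:~R); last by rewrite rmorphM.
by rewrite [2 * p.1%:~R]mulrC -mulrA.
Qed.

Lemma T_lattice_form k (tau : C) : (2 <= k)%N -> ~~ odd k -> 0 < complex.Im tau ->
  T k (tau : C^o) = lattice_form two_row k tau.
Proof.
move=> k2 ke t0; rewrite /T; have k0 : (0 < k)%N by lia.
have [_ _ ->] := T_nomeE k0 ke (nome_lt1 t0).
have t20 : 0 < complex.Im (2 * tau).
  rewrite -[2](rmorph_nat (real_complex R) 2); case: (tau) t0 => a b /= b0.
  by rewrite mul0r addr0 mulr_gt0.
rewrite -(nomeMn 2) (odd_diff_lattice_form k2 t20) /lattice_form.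
apply: (f_equal2 (fun a b => lipschitz_const k / 2 * a - ratr (coef_d k) * (lipschitz_const 2 / 16 * b) ^+ k./2)).
  exact/esym/lattice_sum_two_row.
exact/esym/lattice_sum_two_row.
Qed.

End Lattice.

(** * Behaviour at the cusps *)

Section Decay.
Context {R : realType}.
Local Notation C := R[i].

Definition four_periodic (D : set int) := forall d e, D d -> D (d + 4 * e).

Lemma nrm_csum_lt4 (E : set nat) (f : nat -> C) (b : R) : 0 <= b -> E `<=` `I_4 ->
  (forall r, E r -> nrm (f r) <= b) -> nrm (csum E f) <= 4 * b.
Proof.
move=> b0 E4 fb; rewrite (csum_extend (g := fun r => if r \in E then f r else 0) E4).
- rewrite csum_II; apply: le_trans (nrm_sum _ _ _) _.
  apply: (@le_trans _ _ (\sum_(r < 4) b)); last by rewrite sumr_const card_ord mulr_natl.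
  by apply: ler_sum => r _; case: ifPn => [/set_mem/fb//|_]; rewrite nrm0.
- by move=> r Er; rewrite mem_set.
- by move=> r _ Er; rewrite memNset.
- by apply: csummable_finite; apply: sub_finite_set E4 _; exact: finite_II.
Qed.

(** Split into residue classes modulo 4: over the class of [r] the sum is [4^(-2k)] times a
    [row_sum] at [s = (u + r) / 4], hence a multiple of [summand] at [nome s], whose modulus is
    [exp (- pi / 2 * Im u)]. *)
Lemma periodic_row_bound k : (0 < k)%N -> exists2 B : R, 0 <= B & forall (D : set int) (u : C),
  four_periodic D -> 1 <= complex.Im u ->
  nrm (csum D (fun d => ((u + d%:~R) ^+ (2 * k))^-1)) <= B * expR (- (pi / 2 * complex.Im u)).
Proof.
move=> k0; pose rho : R := expR (- (pi / 2)).
have pi0 := pi_gt0 R.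
have r01 : 0 <= rho < 1 by rewrite expR_ge0 expR_lt1 oppr_lt0 divr_gt0.
have [B B0 HB] := summand_bound k0 r01.
exists (4 * (4 ^- (2 * k) * (nrm (lipschitz_const k)^-1 * B))).
  by rewrite !mulr_ge0 ?nrm_ge0// invr_ge0 exprn_ge0.
move=> D u pD u1; have u0 : 0 < complex.Im u by apply: lt_le_trans u1.
pose E : set nat := [set r : nat | (r < 4)%N /\ D r%:Z].
have b : set_bij (E `*`` fun=> setT) D (fun p : nat * int => p.1%:Z + 4 * p.2).
  apply: (@can_set_bij _ _ _ _ _ (fun d : int => (`|(d %% 4)%Z|%N, (d %/ 4)%Z))) => /=.
  - by move=> [r e] [[/= r4 Dr] _]; apply: pD.
  - move=> d Dd; do 2!split => //=; first by lia.
    have := pD d (- (d %/ 4)%Z) Dd; congr D; lia.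
  - by move=> [r e] [[/= r4 Dr] _]; congr pair; lia.
  - by move=> d Dd; lia.
pose f (r : nat) (e : int) : C := ((u + (r%:Z + 4 * e)%:~R) ^+ (2 * k))^-1.
rewrite (csum_reindex _ b) (csum_pair (f := f)); last first.
  apply: (csummable_reindex (fun d : int => ((u + d%:~R) ^+ (2 * k))^-1) b).1.
  by apply: csummable_sub (csummable_row_sum _ u0); [exact: subsetT|lia].
rewrite -[leRHS]mulrA; apply: (nrm_csum_lt4 (E := E)); first by rewrite !mulr_ge0 ?nrm_ge0 ?expR_ge0 ?invr_ge0 ?exprn_ge0.
  by move=> r [].
move=> r [r4 Dr]; pose s := (u + r%:R) / 4.
have ImS : complex.Im s = complex.Im u / 4.
  rewrite /s -[r%:R](rmorph_nat (real_complex R)) -[4](rmorph_nat (real_complex R) 4) -fmorphV.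
  by case: (u) => a c /=; rewrite mulr0 !addr0 add0r.
have s0 : 0 < complex.Im s by rewrite ImS divr_gt0.
have -> : csum setT (f r) = 4 ^- (2 * k) * ((lipschitz_const k)^-1 * summand k (nome (s : C^o))).
  rewrite summand_nome// mulKf ?lipschitz_const_neq0// /row_sum -csumZ; last by apply: csummable_row_sum => //; lia.
  apply: eq_csum => e _; rewrite -invfM -exprMn /s /f rmorphD rmorphM /= -!pmulrn.
  by congr ((_ ^+ _)^-1); field.
have nE : nrm (nome (s : C^o)) = expR (- (pi / 2 * complex.Im u)).
  by rewrite nrm_nome ImS; congr expR; field.
rewrite [leLHS]nrmM nrmV nrmX nrm_nat -[leRHS]mulrA ler_wpM2l ?invr_ge0 ?exprn_ge0//.
rewrite [leLHS]nrmM -[leRHS]mulrA ler_wpM2l ?nrm_ge0// -nE; apply: HB.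
rewrite nE ler_expR lerN2 ler_peMr// divr_ge0// ltW//.
Qed.

Lemma rsummable_geo_int (r : R) : 0 < r < 1 -> rsummable setT (fun c : int => r ^+ (`|c|%N).-1).
Proof.
move=> /andP[r0 r1]; have r01 : 0 <= r < 1 by rewrite ltW.
apply: rsummable_int => /=; last exact: rsummable_geo.
apply: rsummable_le (rsummableZ r^-1 (rsummable_geo r01)) => -[|n] _ /=.
  by rewrite expr0 normr1 mulr1 invf_ge1// ltW.
by rewrite exprS mulKf ?gt_eqF// ger0_norm// exprn_ge0// ltW.
Qed.

(** The row [c = 0] is the constant term. A row [c != 0] is a periodic row at [|c| tau], after [d]
    is replaced by [- d] when [c < 0]. *)
Lemma lattice_sum_decay (X : set (int * int)) k : (2 <= k)%N ->
  (forall c, four_periodic [set d | X (c, d)]) ->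
  exists2 B : R, 0 <= B & forall tau : C, 1 <= complex.Im tau ->
  nrm (lattice_sum X (2 * k) tau - csum [set d | X (0, d)] (fun d : int => (d%:~R ^+ (2 * k))^-1)) <=
  B * expR (- (pi / 2 * complex.Im tau)).
Proof.
move=> k2 pX; have k0 : (0 < k)%N by lia.
have pi0 := pi_gt0 R.
have [B B0 HB] := periodic_row_bound k0.
pose rho : R := expR (- (pi / 2)).
have r01 : 0 <= rho < 1 by rewrite expR_ge0 expR_lt1 oppr_lt0 divr_gt0.
have r0 : 0 < rho < 1 by rewrite expR_gt0; case/andP: r01.
have sr := rsummable_sub (@subsetT _ (~` [set 0])) (rsummable_geo_int r0).
exists (B * rsum (~` [set 0]) (fun c : int => rho ^+ (`|c|%N).-1)).
  rewrite mulr_ge0// possum_rsum ?possum_ge0// => c; by rewrite exprn_ge0// expR_ge0.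
move=> tau t1; have t0 : 0 < complex.Im tau by apply: lt_le_trans t1.
have s := csummable_lattice_sum X (_ : (4 <= 2 * k)%N) t0.
have w4 : (4 <= 2 * k)%N by lia.
have {}s := s w4.
rewrite /lattice_sum (csumID [set p : int * int | p.1 = 0] s).
have b1 : set_bij [set d | X (0, d)] (X `&` [set p : int * int | p.1 = 0]) (fun d => (0, d)).
  by apply: (@can_set_bij _ _ _ _ _ snd) => // -[a d] /= [] // + a0; rewrite a0.
pose D c : set int := [set d | X (c, d)].
have b2 : X `&` ~` [set p : int * int | p.1 = 0] = (~` [set 0]) `*`` D.
  by apply/seteqP; split => -[a d] /= [].
rewrite (csum_reindex _ b1) addrAC.
rewrite (eq_csum (g := fun d : int => (d%:~R ^+ (2 * k))^-1)) ?subrr ?add0r; last first.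
  by move=> d _; rewrite /= /lin_form mul0r add0r.
pose f (c d : int) : C := (lin_form tau (c, d) ^+ (2 * k))^-1.
have s2 : csummable ((~` [set 0]) `*`` D) (fun p => f p.1 p.2).
  by rewrite -b2; apply: eq_csummable (csummable_sub _ s) => [[]//|]; exact: subIsetl.
rewrite b2 (eq_csum (g := fun p : int * int => f p.1 p.2)); last by case.
rewrite (csum_pair s2); apply: le_trans (nrm_csum_le (csummable_outer s2)) _.
rewrite -rsumZ// mulrC -rsumZ; last exact: rsummableZ.
apply: le_rsum; [exact: csummable_outer s2|by do 2!apply: rsummableZ|].
move=> c /eqP c0.
have H : nrm (csum (D c) (f c)) <= B * expR (- (pi / 2 * (`|c|%N%:R * complex.Im tau))).
  have Im_c (n : nat) : (0 < n)%N -> complex.Im (n%:R * tau) = n%:R * complex.Im tau.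
    rewrite -(rmorph_nat (real_complex R)); case: (tau) => a d /= _.
    by rewrite mul0r addr0.
  have c1 : (0 < `|c|)%N by lia.
  have Im1 : 1 <= complex.Im ((`|c|%N)%:R * tau).
    rewrite Im_c// -[leLHS]mul1r; apply: ler_pM => //; by rewrite ler1n.
  rewrite -Im_c//; have [cp|cn] := leP 0 c.
    apply: le_trans (HB (D c) _ (pX c) Im1); rewrite le_eqVlt; apply/orP; left; apply/eqP; apply: congr1.
    by apply: eq_csum => d _; rewrite /f /lin_form /= -{1}(gez0_abs cp) -pmulrn.
  pose D' : set int := [set d | X (c, - d)].
  have pD' : four_periodic D'.
    by move=> d e; rewrite /D' /= opprD -mulrN; exact: (pX c).
  have b : set_bij D' (D c) (fun d => - d).
    by apply: (@can_set_bij _ _ _ _ _ (fun d => - d)) => x //=; rewrite ?opprK// /D' /= opprK.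
  apply: le_trans (HB D' _ pD' Im1); rewrite le_eqVlt; apply/orP; left; apply/eqP; apply: congr1.
  rewrite (csum_reindex _ b); apply: eq_csum => d _; rewrite /f /lin_form /=.
  have -> : (c%:~R : C) = - (`|c|%N)%:R by rewrite pmulrn -rmorphN; congr (_%:~R); lia.
  by rewrite rmorphN mulNr -opprD exprM sqrrN -exprM.
apply: le_trans H _; rewrite mulrCA [leRHS]mulrC -[leRHS]mulrA ler_wpM2l//.
(* As [Im tau >= 1], one has [|c| Im tau >= Im tau + (|c| - 1)]: the first part is the claimed
   decay, the second makes the sum over [c] geometric. *)
rewrite /rho -expRM_natl -expRD ler_expR.
have : (`|c|%N)%:R = ((`|c|%N).-1)%:R + 1 :> R by rewrite natr1 prednK//; lia.
have : 0 <= ((`|c|%N).-1)%:R :> R by [].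
move: (_%:R) (_%:R) => m n m0 ->.
have : 0 <= pi / 2 * (n * (complex.Im tau - 1)) by rewrite !mulr_ge0 ?subr_ge0 ?divr_ge0// ltW.
nra.
Qed.

Lemma csum_odd_inv w : (2 <= w)%N ->
  csum [set d : int | (d %% 2)%Z = 1] (fun d : int => (d%:~R ^+ w)^-1 : C) =
  (1 - (2 ^+ w)^-1) * int_zeta w.
Proof.
move=> w2; have s := @csummable_int_zeta R w w2.
have b : set_bij (~` [set 0]) (~` [set 0] `&` ~` [set d : int | (d %% 2)%Z = 1]) (fun d => 2 * d).
  apply: (@can_set_bij _ _ _ _ _ (fun d => (d %/ 2)%Z)) => x /=; lia.
have E : ~` [set 0] `&` [set d : int | (d %% 2)%Z = 1] = [set d : int | (d %% 2)%Z = 1].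
  by apply/seteqP; split => d /=; [case|move=> h; split => //; lia].
have := csumID [set d : int | (d %% 2)%Z = 1] s; rewrite E (csum_reindex _ b) -/(int_zeta w).
rewrite (eq_csum (A := ~` [set 0]) (g := fun d : int => (2 ^+ w)^-1 * (d%:~R ^+ w)^-1)).
  by rewrite csumZ// -/(int_zeta w) => H; rewrite mulrBl mul1r {1}H addrK.
by move=> d _ /=; rewrite rmorphM /= exprMn invfM.
Qed.

Lemma csum_two_inv w : (2 <= w)%N ->
  csum [set d : int | (d %% 4)%Z = 2] (fun d : int => (d%:~R ^+ w)^-1 : C) =
  (2 ^+ w)^-1 * ((1 - (2 ^+ w)^-1) * int_zeta w).
Proof.
move=> w2; rewrite -csum_odd_inv// -csumZ; last first.
  apply: csummable_sub (@csummable_int_zeta R w w2) => d /=; lia.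
have b : set_bij [set d : int | (d %% 2)%Z = 1] [set d : int | (d %% 4)%Z = 2] (fun d => 2 * d).
  apply: (@can_set_bij _ _ _ _ _ (fun d => (d %/ 2)%Z)) => x /=; lia.
rewrite (csum_reindex _ b); apply: eq_csum => d _ /=.
by rewrite rmorphM /= exprMn invfM.
Qed.

Lemma lipschitz_const_int_zeta k : (0 < k)%N ->
  lipschitz_const k * int_zeta (2 * k) = - (2 ^+ (2 * k) * ratr (bernoulli (2 * k)) / (4 * k%:R)) :> C.
Proof.
move=> k0; rewrite int_zeta_even// /lipschitz_const exprMn (exprM 'i%C) sqr_i exprS.
have i2 : (-1) ^+ k * (-1) ^+ k = 1 :> C by rewrite -exprMn mulrNN mulr1 expr1n.
have p0 : ((2 * pi)%:C : C) ^+ (2 * k) != 0.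
  by rewrite expf_neq0// fmorph_eq0 gt_eqF// mulr_gt0// pi_gt0.
have s0 : (-1) ^+ k != 0 :> C by rewrite signr_eq0.
have E : (2 * k = (2 * k - 1).+1)%N by lia.
have -> : ((2 * k)`!%:R : C) = 2 * k%:R * (2 * k - 1)`!%:R.
  by rewrite -natrM -natrM {1}E factS -E.
have -> : (2 ^+ (2 * k) : C) = 2 * 2 ^+ (2 * k - 1) by rewrite {1}E exprS.
have f0 := @factC_neq0 R (2 * k - 1).
have k0' : (k%:R : C) != 0 by rewrite pnatr_eq0 -lt0n.
move: i2 p0 s0; move: ((-1) ^+ k : C) (((2 * pi)%:C : C) ^+ (2 * k)) => S P S2 P0 S0.
move: (ratr _ : C) f0 k0' => B; move: ((2 * k - 1)`!%:R : C) (k%:R : C) (2 ^+ (2 * k - 1) : C) => F K Z F0 K0.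
by field; rewrite F0 K0 P0 S0.
Qed.

Lemma bernoulli4 : bernoulli 4 = - 30%:R^-1.
Proof.
have := bernoulli_sum 4; have := bernoulli_sum 3; have := bernoulli_sum 2; have := bernoulli_sum 1.
have := bernoulli_sum 0; rewrite !big_ord_recr !big_ord0 /= !add0r.
rewrite !binE /=.
move: (bernoulli 0) (bernoulli 1) (bernoulli 2) (bernoulli 3) (bernoulli 4) => a b c d e.
rewrite !natrD; lra.
Qed.

(* The constant terms of the two pieces of [T] at a cusp cancel. *)
Lemma cusp_constant k : (0 < k)%N -> ~~ odd k ->
  lipschitz_const k / 2 * ((1 - (2 ^+ (2 * k))^-1) * int_zeta (2 * k)) =
  ratr (coef_d k) * (lipschitz_const 2 / 16 * ((1 - (2 ^+ 4)^-1) * int_zeta 4)) ^+ k./2 :> C.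
Proof.
move=> k0 ke.
(* Its power [k / 2] is [16^-k], which cancels the [(- 16)^k] of [coef_d]. *)
have -> : lipschitz_const 2 / 16 * ((1 - (2 ^+ 4)^-1) * int_zeta 4) = (16 ^+ 2)^-1 :> C.
  transitivity ((1 - (2 ^+ 4)^-1) / 16 * (lipschitz_const 2 * int_zeta (2 * 2)) : C); first by ring.
  rewrite lipschitz_const_int_zeta// bernoulli4 rmorphN fmorphV rmorph_nat; by field.
have -> : ((16 ^+ 2)^-1 ^+ k./2 : C) = (16 ^+ k)^-1.
  by rewrite exprVn -exprM mul2n halfK (negbTE ke) subn0.
transitivity ((1 - (2 ^+ (2 * k))^-1) / 2 * (lipschitz_const k * int_zeta (2 * k)) : C); first by ring.
rewrite lipschitz_const_int_zeta// /coef_d.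
have k0' : (k%:R : C) != 0 by rewrite pnatr_eq0 -lt0n.
have E4 : (2 ^+ (2 * k) : C) = 4 ^+ k by rewrite exprM -natrX.
rewrite E4 exprNn -signr_odd (negbTE ke) mul1r.
rewrite !(rmorphN, rmorphM, fmorphV, rmorphB, rmorphXn, rmorph_nat, rmorph1) /=.
have p4 : (4 ^+ k : C) != 0 by rewrite expf_neq0// pnatr_eq0.
have p16 : (16 ^+ k : C) != 0 by rewrite expf_neq0// pnatr_eq0.
move: (4 ^+ k : C) (16 ^+ k : C) (k%:R : C) (ratr _) p4 p16 k0' => X Y K B X0 Y0 K0.
by field; rewrite X0 Y0 K0.
Qed.

Lemma pow_lipschitz m (a : C) (d : R) : exists2 B : R, 0 <= B & forall x,
  nrm (x - a) <= d -> nrm (x ^+ m - a ^+ m) <= B * nrm (x - a).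
Proof.
elim: m => [|m [B B0 HB]].
  by exists 0 => // x _; rewrite subrr nrm0 mul0r.
exists ((nrm a + `|d|) * B + nrm a ^+ m).
  by rewrite addr_ge0 ?exprn_ge0 ?nrm_ge0// mulr_ge0// addr_ge0 ?nrm_ge0.
move=> x xd; have -> : x ^+ m.+1 - a ^+ m.+1 = x * (x ^+ m - a ^+ m) + a ^+ m * (x - a).
  by rewrite !exprS; ring.
apply: le_trans (ler_nrmD _ _) _; rewrite mulrDl !nrmM nrmX lerD2r -mulrA.
apply: ler_pM; rewrite ?nrm_ge0//; last exact: HB.
have -> : x = a + (x - a) by ring.
apply: le_trans (ler_nrmD _ _) _; by rewrite lerD2l (le_trans xd)// ler_norm.
Qed.

Definition zero_row (X : set (int * int)) w : C :=
  csum [set d | X (0, d)] (fun d : int => (d%:~R ^+ w)^-1).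

(** The last hypothesis is the cancellation of the two constant terms; what is left decays because
    the lattice sums do and taking a power is Lipschitz on bounded sets. *)
Lemma lattice_form_decay (X : set (int * int)) k : (2 <= k)%N ->
  (forall c, four_periodic [set d | X (c, d)]) ->
  lipschitz_const k / 2 * zero_row X (2 * k) = ratr (coef_d k) * (lipschitz_const 2 / 16 * zero_row X 4) ^+ k./2 ->
  exists2 B : R, 0 <= B & forall tau : C, 1 <= complex.Im tau ->
  nrm (lattice_form X k tau) <= B * expR (- (pi / 2 * complex.Im tau)).
Proof.
move=> k2 pX KE; pose K := zero_row X.
have [B1 B10 H1] := lattice_sum_decay k2 pX; have [B2 B20 H2] := lattice_sum_decay (leqnn 2) pX.
rewrite -/(zero_row X _) -/K in H1; rewrite -/(zero_row X _) -/K in H2; rewrite -/K in KE.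
have [B3 B30 H3] := pow_lipschitz k./2 (lipschitz_const 2 / 16 * K 4%N) (nrm (lipschitz_const 2 / 16 : C) * B2).
exists (nrm (lipschitz_const k / 2 : C) * B1 + nrm (ratr (coef_d k) : C) * (B3 * (nrm (lipschitz_const 2 / 16 : C) * B2))).
  by rewrite addr_ge0 ?mulr_ge0 ?nrm_ge0.
move=> tau t1; set e := expR _.
have e1 : e <= 1.
  by rewrite expR_le1 oppr_le0 mulr_ge0 ?divr_ge0 ?pi_ge0// (le_trans _ t1).
have h2 : nrm (lipschitz_const 2 / 16 * lattice_sum X 4 tau - lipschitz_const 2 / 16 * K 4%N) <= nrm (lipschitz_const 2 / 16 : C) * B2 * e.
  by rewrite -mulrBr [leLHS]nrmM -[leRHS]mulrA ler_wpM2l ?nrm_ge0//; exact: H2.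
have h3 : nrm (lipschitz_const 2 / 16 * lattice_sum X 4 tau - lipschitz_const 2 / 16 * K 4%N) <= nrm (lipschitz_const 2 / 16 : C) * B2.
  by apply: le_trans h2 _; rewrite ler_piMr// mulr_ge0 ?nrm_ge0.
have -> : lattice_form X k tau = lipschitz_const k / 2 * (lattice_sum X (2 * k) tau - K (2 * k)%N) -
    ratr (coef_d k) * ((lipschitz_const 2 / 16 * lattice_sum X 4 tau) ^+ k./2 - (lipschitz_const 2 / 16 * K 4%N) ^+ k./2).
  by rewrite mulrBr [in RHS]mulrBr KE /lattice_form; ring.
apply: le_trans (ler_nrmB _ _) _; rewrite mulrDl lerD//.
  by rewrite [leLHS]nrmM -[leRHS]mulrA ler_wpM2l ?nrm_ge0//; exact: H1.
rewrite [leLHS]nrmM -[leRHS]mulrA ler_wpM2l ?nrm_ge0//; apply: le_trans (H3 _ h3) _.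
by rewrite -[leRHS]mulrA ler_wpM2l.
Qed.

End Decay.

(** * Action of the modular group on rows *)

Section Modular.
Context {R : realType}.
Local Notation C := R[i].

(** The image of [two_row] under right multiplication by [g]: the condition bears on the first entry
    of the row [p * g^-1]. *)
Definition two_row_act (g : 'M[int]_2) : set (int * int) :=
  [set p | ((p.1 * g 1%R 1%R - p.2 * g 1%R 0%R) %% 4)%Z = 2].

Lemma det_mx22 (g : 'M[int]_2) : \det g = g 0 0 * g 1 1 - g 0 1 * g 1 0.
Proof.
rewrite (expand_det_row _ 0) !big_ord_recl big_ord0 /cofactor !det_mx11 !mxE /=.
have e1 : lift ord0 ord0 = 1 :> 'I_2 by apply/val_inj.
have e0 : lift (1 : 'I_2) ord0 = 0 by apply/val_inj.
by rewrite e1 e0 expr0 /bump /= expr1 addr0 mul1r mulN1r mulrN.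
Qed.

Lemma SL2Z_det (g : 'M[int]_2) : SL2Z g -> g 0 0 * g 1 1 - g 0 1 * g 1 0 = 1.
Proof. by rewrite /SL2Z /= det_mx22. Qed.

Lemma bij_two_row_act (g : 'M[int]_2) : SL2Z g ->
  set_bij (two_row_act g) two_row
    (fun p : int * int => (p.1 * g 1 1 - p.2 * g 1 0, p.2 * g 0 0 - p.1 * g 0 1)).
Proof.
move=> /SL2Z_det D.
apply: (@can_set_bij _ _ _ _ _ (fun p : int * int => (p.1 * g 0 0 + p.2 * g 1 0, p.1 * g 0 1 + p.2 * g 1 1))) => -[c d] //=.
- rewrite /two_row_act /two_row /= => H; rewrite -[RHS]H; congr (_ %% _)%Z.
  by rewrite -[RHS]mulr1 -D; ring.
- move=> _; congr pair.
    by rewrite -[RHS]mulr1 -D; ring.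
  by rewrite -[RHS]mulr1 -D; ring.
- move=> _; congr pair.
    by rewrite -[RHS]mulr1 -D; ring.
  by rewrite -[RHS]mulr1 -D; ring.
Qed.

Lemma autfactor_lin_form (g : 'M[int]_2) (tau : C) : autfactor g (tau : C^o) = lin_form tau (g 1 0, g 1 1).
Proof. by []. Qed.

Lemma autfactor_neq0 (g : 'M[int]_2) (tau : C) : SL2Z g -> 0 < complex.Im tau ->
  autfactor g (tau : C^o) != 0.
Proof.
move=> /SL2Z_det D t0; rewrite autfactor_lin_form -nrm_gt0.
have [d d0 Hd] := lin_form_lower t0; apply: lt_le_trans (Hd _ _) => //.
by apply/eqP => -[g10 g11]; move: D; rewrite g10 g11 !mulr0 subr0.
Qed.

Lemma Im_mobius (g : 'M[int]_2) (tau : C) : SL2Z g -> 0 < complex.Im tau ->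
  0 < complex.Im (mobius g (tau : C^o)).
Proof.
move=> gS t0; have D := SL2Z_det gS; have j0 := autfactor_neq0 gS t0.
have n2 : 0 < nrm (autfactor g (tau : C^o)) ^+ 2 by rewrite exprn_gt0// nrm_gt0.
suff -> : complex.Im (mobius g (tau : C^o)) = complex.Im tau / nrm (autfactor g (tau : C^o)) ^+ 2.
  exact: divr_gt0.
apply: (mulIf (lt0r_neq0 n2)); rewrite divfK ?lt0r_neq0//.
rewrite autfactor_lin_form nrm_sqr Re_lin_form Im_lin_form /mobius autfactor_lin_form /=.
have E : lin_form tau (g 0 0, g 0 1) / lin_form tau (g 1 0, g 1 1) * lin_form tau (g 1 0, g 1 1) = lin_form tau (g 0 0, g 0 1).
  by rewrite divfK// -autfactor_lin_form.
have DR : (g 0 0)%:~R * (g 1 1)%:~R - (g 0 1)%:~R * (g 1 0)%:~R = 1 :> R.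
  by rewrite -!rmorphM -rmorphB D.
have := congr1 (@complex.Re R) E; have := congr1 (@complex.Im R) E.
rewrite Re_lin_form Im_lin_form.
have -> z : complex.Re (z * lin_form tau (g 1 0, g 1 1)) = complex.Re z * complex.Re (lin_form tau (g 1 0, g 1 1)) - complex.Im z * complex.Im (lin_form tau (g 1 0, g 1 1)).
  by case: z (lin_form _ _) => [a b] [c d].
have -> z : complex.Im (z * lin_form tau (g 1 0, g 1 1)) = complex.Re z * complex.Im (lin_form tau (g 1 0, g 1 1)) + complex.Im z * complex.Re (lin_form tau (g 1 0, g 1 1)).
  by case: z (lin_form _ _) => [a b] [c d].
rewrite Re_lin_form Im_lin_form /=; set z := lin_form _ _ / lin_form _ _.
move: (complex.Re z) (complex.Im z) (complex.Re tau) (complex.Im tau) => a b x y e1 e2.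
move: (g 0 0)%:~R (g 0 1)%:~R (g 1 0)%:~R (g 1 1)%:~R DR e1 e2 => A B G H DR e1 e2.
transitivity ((A * y) * (G * x + H) - (A * x + B) * (G * y)); first by rewrite -e1 -e2; ring.
by rewrite -[RHS]mul1r -DR; ring.
Qed.

Lemma lin_form_mobius (g : 'M[int]_2) (tau : C) p : SL2Z g -> 0 < complex.Im tau ->
  lin_form (mobius g (tau : C^o)) (p.1 * g 1 1 - p.2 * g 1 0, p.2 * g 0 0 - p.1 * g 0 1) =
  lin_form tau p / autfactor g (tau : C^o).
Proof.
move=> gS t0; have j0 := autfactor_neq0 gS t0.
have D : (g 0 0)%:~R * (g 1 1)%:~R - (g 0 1)%:~R * (g 1 0)%:~R = 1 :> C.
  by rewrite -!rmorphM -rmorphB SL2Z_det.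
apply: (mulIf j0); rewrite divfK// /lin_form /= mulrDl /mobius mulrA.
rewrite [X in X + _](_ : _ = (p.1 * g 1 1 - p.2 * g 1 0)%:~R * ((g 0 0)%:~R * tau + (g 0 1)%:~R)); last first.
  by rewrite divfK.
rewrite /autfactor !(rmorphB, rmorphM) /=.
transitivity ((p.1%:~R * tau + p.2%:~R) * ((g 0 0)%:~R * (g 1 1)%:~R - (g 0 1)%:~R * (g 1 0)%:~R)); last first.
  by rewrite D mulr1.
ring.
Qed.

Lemma lattice_sum_mobius w (g : 'M[int]_2) (tau : C) : SL2Z g -> 0 < complex.Im tau -> (4 <= w)%N ->
  lattice_sum two_row w (mobius g (tau : C^o)) = autfactor g (tau : C^o) ^+ w * lattice_sum (two_row_act g) w tau.
Proof.
move=> gS t0 w4; rewrite /lattice_sum (csum_reindex _ (bij_two_row_act gS)).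
rewrite -csumZ; last exact: csummable_lattice_sum.
by apply: eq_csum => p _ /=; rewrite lin_form_mobius// expr_div_n invfM invrK mulrC.
Qed.

(** As [k] is even, [4 * k./2 = 2 * k]: both terms of [lattice_form] scale by the same power of the
    automorphy factor. *)
Lemma slash_T k (g : 'M[int]_2) (tau : C) : (2 <= k)%N -> ~~ odd k -> SL2Z g ->
  0 < complex.Im tau -> slash (2 * k) g (T k : C^o -> C^o) (tau : C^o) = lattice_form (two_row_act g) k tau.
Proof.
move=> k2 ke gS t0; have j0 := autfactor_neq0 gS t0.
rewrite /slash T_lattice_form ?Im_mobius// /lattice_form lattice_sum_mobius//; last by lia.
rewrite lattice_sum_mobius//.
have E : autfactor g (tau : C^o) ^+ (2 * k) = (autfactor g (tau : C^o) ^+ 4) ^+ k./2.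
  by rewrite -exprM; congr (_ ^+ _); lia.
have jk : (autfactor g (tau : C^o) ^+ 4) ^+ k./2 != 0 by rewrite !expf_neq0.
have X0 (a b d x y J : C) : J != 0 -> J^-1 * (a * (J * x) - d * (J * y)) = a * x - d * y.
  by move=> J0; field.
rewrite [lipschitz_const 2 / 16 * (_ * _)]mulrCA exprMn E; exact: X0.
Qed.

Lemma odd_unit_mod4 (a b d e : int) : a * d - b * (e * 4) = 1 -> exists f, d = 2 * f + 1.
Proof.
move=> D; have [q [dE|dE]] : exists q, d = 2 * q \/ d = 2 * q + 1 by exists (d %/ 2)%Z; lia.
  by move: D; rewrite dE; lia.
by exists q.
Qed.

(** As 4 divides [g 1 0], the condition on [(c, d)] modulo 4 reads [c * g 1 1 = 2], and [g 1 1] is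
    odd. *)
Lemma two_row_act_Gamma0 (g : 'M[int]_2) : Gamma0 4 g -> two_row_act g = two_row.
Proof.
move=> [/SL2Z_det D /dvdzP[e g10]]; move: D; rewrite g10 => /odd_unit_mod4[f gf].
apply/seteqP; split => -[c d]; rewrite /two_row_act /two_row /= g10 gf.
  have [q [->|->]] : exists q, c = 2 * q \/ c = 2 * q + 1 by exists (c %/ 2)%Z; lia.
    lia.
  lia.
move=> c2; have [q ->] : exists q, c = 4 * q + 2 by exists (c %/ 4)%Z; lia.
lia.
Qed.

Lemma four_periodic_two_row_act (g : 'M[int]_2) c : four_periodic [set d | two_row_act g (c, d)].
Proof.
move=> d e; rewrite /two_row_act /=; move: (g _ _) (g _ _) => a b.
by rewrite !mulrDl; lia.
Qed.

(** There are three kinds of cusps, according to [g 1 0] modulo 4. If it is 0, the row [c = 0] is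
    empty. If it is 2, that row consists of the odd [d], which is [cusp_constant]. If it is odd, the
    row consists of [d = 2] modulo 4, and the two constants are scaled by [2^(-2k)] and by the
    [k / 2] power of [2^-4], which are equal. *)
Lemma lattice_form_two_row_act_decay k (g : 'M[int]_2) : (2 <= k)%N -> ~~ odd k ->
  exists2 B : R, 0 <= B & forall tau : C, 1 <= complex.Im tau ->
  nrm (lattice_form (two_row_act g) k tau) <= B * expR (- (pi / 2 * complex.Im tau)).
Proof.
move=> k2 ke; apply: lattice_form_decay => //; first exact: four_periodic_two_row_act.
have k0 : (0 < k)%N by lia.
have CC := @cusp_constant R k k0 ke.
have w2 : (2 <= 2 * k)%N by lia.
have dq (d : int) : exists q, d = 2 * q \/ d = 2 * q + 1 by exists (d %/ 2)%Z; lia.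
have [e gE] : exists e, [\/ g 1 0 = 4 * e, g 1 0 = 4 * e + 2 | g 1 0 = 2 * e + 1].
  move: (g 1 0) => c; have [|] : (c %% 2)%Z = 0 \/ (c %% 2)%Z = 1 by lia.
    have [|] : (c %% 4)%Z = 0 \/ (c %% 4)%Z != 0 by lia.
      by exists (c %/ 4)%Z; apply: Or31; lia.
    by exists (c %/ 4)%Z; apply: Or32; lia.
  by exists (c %/ 2)%Z; apply: Or33; lia.
case: gE => gE.
- have E : [set d | two_row_act g (0, d)] = set0.
    by apply/seteqP; split => d; rewrite /two_row_act /= gE; lia.
  rewrite /zero_row E !csum_set0 !mulr0 expr0n (_ : (k./2 == 0)%N = false) ?mulr0//; lia.
- have E : [set d | two_row_act g (0, d)] = [set d : int | (d %% 2)%Z = 1].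
    by apply/seteqP; split => d; rewrite /two_row_act /= gE; have [q [->|->]] := dq d; lia.
  by rewrite /zero_row E !csum_odd_inv.
- have E : [set d | two_row_act g (0, d)] = [set d : int | (d %% 4)%Z = 2].
    apply/seteqP; split => d; rewrite /two_row_act /= gE.
      by have [q [->|->]] := dq d; lia.
    by have [q [->|->]] := dq d; have [p [->|->]] := dq q; lia.
  have scale (A L d' B M s t : C) h : A * L = d' * (B * M) ^+ h -> s = t ^+ h ->
      A * (s * L) = d' * (B * (t * M)) ^+ h.
    by move=> ALM ->; rewrite mulrCA ALM (mulrCA B) [in RHS](exprMn _ t) mulrCA.
  rewrite /zero_row E !csum_two_inv//; apply: scale => //.
  by rewrite exprVn; congr (_^-1); rewrite -exprM; congr (_ ^+ _); lia.
Qed.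

End Modular.

(** * Holomorphy of the lattice sums *)

Section Holomorphy.
Context {R : realType}.
Local Notation C := R[i].

Lemma nbhs_nrm (a : C) (e : R) : 0 < e -> \forall x \near (a : C^o), nrm (x - a) < e.
Proof. have H := (cvgC_nrm (nbhs_filter (a : C^o)) (id : C^o -> C^o) a).2 (@cvg_id _ (nbhs (a : C^o))).
exact: H. Qed.

Lemma geo_taylor w : exists2 B : R, 0 <= B & forall x : C, nrm x <= 2^-1 ->
  nrm (((1 + x) ^+ w)^-1 - 1 + w%:R * x) <= B * nrm x ^+ 2.
Proof.
elim: w => [|w [B B0 HB]].
  by exists 0 => // x _; rewrite expr0 invr1 subrr add0r !mul0r nrm0.
exists (2 * (B + w.+1%:R)); first by rewrite mulr_ge0// addr_ge0.
move=> x x2; have lo : 2^-1 <= nrm (1 + x).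
  have := ler_dist_nrm 1 (- x); rewrite nrm1 nrmN opprK => H.
  have := ler_norm (1 - nrm x); lra.
have x0 : 1 + x != 0 by rewrite -nrm_gt0; apply: lt_le_trans lo.
have -> : ((1 + x) ^+ w.+1)^-1 - 1 + w.+1%:R * x =
    (1 + x)^-1 * ((((1 + x) ^+ w)^-1 - 1 + w%:R * x) + w.+1%:R * x ^+ 2).
  move: (expf_neq0 w x0); rewrite exprS -[w.+1]addn1 natrD; move: ((1 + x) ^+ w) => X X0.
  by field; rewrite X0 x0.
rewrite nrmM -mulrA; apply: ler_pM; rewrite ?nrm_ge0//.
  by rewrite nrmV -[2]invrK lef_pV2 ?posrE ?invr_gt0// nrm_gt0.
apply: le_trans (ler_nrmD _ _) _; rewrite mulrDl lerD ?HB//.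
by rewrite nrmM nrmX nrm_nat.
Qed.

Lemma derivable_quad (f : C -> C) (a l : C) (d M : R) : 0 < d ->
  (forall h, nrm h <= d -> nrm (f (a + h) - f a - h * l) <= M * nrm h ^+ 2) ->
  derivable (f : C^o -> C^o) (a : C^o) 1.
Proof.
move=> d0 H; apply: cvgP (l : C^o) _; apply/cvgC_nrm => e e0.
have M0 : 0 <= M.
  have /H : nrm (d%:C : C) <= d by rewrite nrm_real gtr0_norm.
  move=> /(le_trans (nrm_ge0 _)); rewrite pmulr_lge0// exprn_gt0//.
  by rewrite nrm_real gtr0_norm.
have d1 : 0 < Num.min d (e / (M + 1)) by rewrite lt_min d0 divr_gt0// ltr_wpDl.
have nb : \forall h \near (0 : C^o)^', nrm h < Num.min d (e / (M + 1)).
  by apply: nbhs_dnbhs; apply: filterS (nbhs_nrm 0 d1) => h; rewrite subr0.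
have nz : \forall h \near (0 : C^o)^', h != 0 by exact: nbhs_dnbhs_neq.
apply: filterS2 nb nz => h; rewrite lt_min => /andP[h1 h2] h0.
have -> : ((f : C^o -> C^o) \o shift (a : C^o)) (h *: (1 : C^o)) = f (a + h).
  by rewrite /shift /= addrC; apply: congr1; apply: congr1; exact: mulr1.
have -> : h^-1 *: (f (a + h) - f a : C^o) - l = h^-1 * (f (a + h) - f a - h * l).
  by rewrite [RHS]mulrBr mulKf.
have nh : 0 < nrm h by rewrite nrm_gt0.
rewrite nrmM nrmV mulrC ltr_pdivrMr//; apply: le_lt_trans (H _ (ltW h1)) _.
rewrite expr2 mulrA ltr_pM2r//; move: h2; rewrite ltr_pdivlMr ?ltr_wpDl//.
by apply: le_lt_trans; rewrite mulrC ler_wpM2l ?nrm_ge0// lerDl.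
Qed.

(** Termwise differentiation: the relative increment [x = c h / (c tau + d)] is at most
    [|h| / Im tau] for all rows at once, so the Taylor remainders of the terms add up to
    [O(|h|^2)]. *)
Lemma lattice_sum_derivable (X : set (int * int)) w (tau : C) : (4 <= w)%N -> 0 < complex.Im tau ->
  derivable (lattice_sum X w : C^o -> C^o) (tau : C^o) 1.
Proof.
move=> w4 t0; have [B B0 HB] := geo_taylor w; set y := complex.Im tau in t0.
have s := csummable_lattice_sum X w4 t0.
have ratio p : nrm (lin_form tau p) != 0 -> `|p.1%:~R| / nrm (lin_form tau p) <= y^-1 :> R.
  move=> u0; have u0' : 0 < nrm (lin_form tau p) by rewrite lt_neqAle eq_sym u0 nrm_ge0.
  rewrite ler_pdivrMr// mulrC ler_pdivlMr//; apply: le_trans (Im_le_nrm _).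
  by rewrite Im_lin_form normrM (gtr0_norm t0).
pose dt (p : int * int) : C := - (w%:R * p.1%:~R * (lin_form tau p ^+ w.+1)^-1).
have sd : csummable X dt.
  apply: csummable_le (rsummableZ (w%:R * y^-1) s) => p _.
  rewrite nrmN exprSr invfM !nrmM nrm_nat nrm_int !nrmV -!mulrA ler_wpM2l//.
  have [u0|u0] := eqVneq (nrm (lin_form tau p)) 0.
    by rewrite u0 invr0 !mulr0 mulr_ge0 ?invr_ge0 ?nrm_ge0// ltW.
  rewrite mulrCA mulrC ler_wpM2r ?invr_ge0 ?nrm_ge0//; exact: ratio.
pose S := rsum X (fun p => nrm ((lin_form tau p ^+ w)^-1)).
have S0 : 0 <= S by rewrite /S possum_rsum ?possum_ge0// => p; exact: nrm_ge0.
have main (h : C) : nrm h <= y / 2 ->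
    nrm (lattice_sum X w (tau + h) - lattice_sum X w tau - h * csum X dt) <= B * nrm h ^+ 2 / y ^+ 2 * S.
  move=> hy; have th0 : 0 < complex.Im (tau + h).
    rewrite raddfD/= -/y; have := Im_le_nrm h; have := ler_norm (- complex.Im h).
    by rewrite normrN; lra.
  have sh := csummable_lattice_sum X w4 th0.
  have s1 : csummable X (fun p => (lin_form (tau + h) p ^+ w)^-1 - (lin_form tau p ^+ w)^-1 - h * dt p).
    by apply: csummableB; [exact: csummableB|exact: csummableZ].
  rewrite /lattice_sum -csumZ// -csumB// -csumB//; [|exact: csummableB|exact: csummableZ].
  apply: le_trans (nrm_csum_le s1) _; rewrite /S -rsumZ; last exact: s.
  apply: le_rsum; [exact: s1|exact: rsummableZ _ s|].
  (* [X] may contain the row [(0, 0)]; its terms are 0 because the inverse of 0 is 0. *)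
  move=> p _; have [u0|u0] := eqVneq (lin_form tau p) 0.
    have p0 : p = 0.
      apply/eqP/negP => /negP p0; have [d d0 Hd] := lin_form_lower t0.
      by have := Hd p p0; rewrite u0 nrm0 leNgt d0.
    rewrite /dt p0 /lin_form !mul0r !add0r expr0n gtn_eqF ?(leq_trans _ w4)// invr0 subrr sub0r.
    by rewrite mulr0 mul0r oppr0 mulr0 oppr0 nrm0 mulr0.
  have nu0 : nrm (lin_form tau p) != 0 by rewrite nrm_eq0.
  pose x := p.1%:~R * h / lin_form tau p.
  have xh : nrm x <= nrm h / y.
    by rewrite /x nrmM nrmV nrmM nrm_int mulrAC mulrC ler_wpM2l ?nrm_ge0// ratio.
  have x2 : nrm x <= 2^-1.
    by apply: le_trans xh _; rewrite ler_pdivrMr// mulrC.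
  have uE : lin_form (tau + h) p = lin_form tau p * (1 + x).
    rewrite mulrDr mulr1 /x [_ * (_ / _)]mulrC divfK// /lin_form; ring.
  have -> : (lin_form (tau + h) p ^+ w)^-1 - (lin_form tau p ^+ w)^-1 - h * dt p =
      (lin_form tau p ^+ w)^-1 * (((1 + x) ^+ w)^-1 - 1 + w%:R * x).
    rewrite uE exprMn invfM /dt /x exprS; move: (lin_form tau p) u0 (((1 + _) ^+ w)^-1) => u u0 Z.
    move: (expf_neq0 w u0); move: (u ^+ w) => U U0.
    by field; rewrite u0 U0.
  rewrite nrmM mulrC ler_wpM2r ?nrm_ge0//; apply: le_trans (HB _ x2) _.
  rewrite -mulrA ler_wpM2l// -expr_div_n lerXn2r ?nnegrE ?nrm_ge0//.
  by rewrite divr_ge0 ?nrm_ge0// ltW.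
apply: (@derivable_quad _ _ (csum X dt) (y / 2) (B / y ^+ 2 * S)); first by rewrite divr_gt0.
move=> h /main; rewrite (_ : B * nrm h ^+ 2 / y ^+ 2 * S = B / y ^+ 2 * S * nrm h ^+ 2)//.
by ring.
Qed.

Lemma lattice_form_derivable (X : set (int * int)) k (tau : C) : (2 <= k)%N -> 0 < complex.Im tau ->
  derivable (lattice_form X k : C^o -> C^o) (tau : C^o) 1.
Proof.
move=> k2 t0; have w4 : (4 <= 2 * k)%N by lia.
have d1 := @lattice_sum_derivable X _ _ w4 t0; have d2 := @lattice_sum_derivable X _ _ (leqnn 4) t0.
have d3 := @derivableZ _ _ _ _ (lipschitz_const k / 2 : C) _ _ d1.
have d4 := @derivableZ _ _ _ _ (ratr (coef_d k) : C) _ _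
  (@derivableX _ _ _ k./2 _ _ (@derivableZ _ _ _ _ (lipschitz_const 2 / 16 : C) _ _ d2)).
have -> : lattice_form X k = ((lipschitz_const k / 2 : C) \*: (lattice_sum X (2 * k) : C^o -> C^o)) -
    ((ratr (coef_d k) : C) \*: ((lipschitz_const 2 / 16 : C) \*: (lattice_sum X 4 : C^o -> C^o)) ^+ k./2).
  by apply/funext => z; rewrite exprfctE.
exact: derivableB d3 d4.
Qed.

Lemma T_derivable k (tau : C) : (2 <= k)%N -> ~~ odd k -> 0 < complex.Im tau ->
  derivable (T k : C^o -> C^o) (tau : C^o) 1.
Proof.
move=> k2 ke t0; apply: near_eq_derivable (@lattice_form_derivable two_row _ _ k2 t0).
apply: filterS (nbhs_nrm tau t0) => z zt; rewrite T_lattice_form//.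
have : complex.Im z = complex.Im tau + complex.Im (z - tau) by rewrite raddfB/=; lra.
have := Im_le_nrm (z - tau); have := ler_norm (- complex.Im (z - tau)); rewrite normrN; lra.
Qed.

End Holomorphy.

(** * Decay of [T (tau / 2)] in a Stolz region *)

Section Stolz.
Context {R : realType}.
Local Notation C := R[i].

(** From [exp (a x) >= (a x / (n + 1))^(n + 1)], which has one power of [x] more than has to be
    absorbed. *)
Lemma pow_exp_decay n (a B e : R) : 0 < a -> 0 <= B -> 0 < e -> exists2 X : R, 0 <= X &
  forall x, X < x -> x ^+ n * (B * expR (- (a * x))) < e.
Proof.
move=> a0 B0 e0; pose D := B * (n.+1%:R / a) ^+ n.+1.
have D0 : 0 <= D by rewrite mulr_ge0// exprn_ge0// divr_ge0// ltW.
exists (D / e) => [|x xX]; first by rewrite divr_ge0// ltW.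
have x0 : 0 < x by apply: le_lt_trans xX; rewrite divr_ge0// ltW.
have ax0 : 0 < a * x / n.+1%:R by rewrite divr_gt0 ?mulr_gt0.
have lo : (a * x / n.+1%:R) ^+ n.+1 <= expR (a * x).
  rewrite -[in leRHS](divfK (_ : n.+1%:R != 0) (a * x)) ?pnatr_eq0// [_ * n.+1%:R]mulrC expRM_natl.
  rewrite lerXn2r ?nnegrE ?expR_ge0 ?(ltW ax0)//.
  by apply: le_trans (expR_ge1Dx _); rewrite lerDr.
rewrite expRN; apply: (@le_lt_trans _ _ (D / x)); last first.
  by rewrite ltr_pdivrMr// mulrC -ltr_pdivrMr.
rewrite mulrA ler_pdivrMr ?expR_gt0//.
apply: le_trans (ler_wpM2l _ lo); last by rewrite divr_ge0// ltW.
rewrite /D !expr_div_n [(a * x) ^+ _]exprMn le_eqVlt; apply/orP; left; apply/eqP.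
have an : a ^+ n.+1 != 0 by rewrite expf_neq0// gt_eqF.
have nn : (n.+1%:R : R) ^+ n.+1 != 0 by rewrite expf_neq0// pnatr_eq0.
move: an nn; rewrite [x ^+ n.+1]exprS; move: (a ^+ n.+1) (n.+1%:R ^+ n.+1) (x ^+ n) => A N X A0 N0.
by field; rewrite A0 N0 gt_eqF.
Qed.

Definition inversion_mx : 'M[int]_2 := \matrix_(i, j) (if (i == 0) && (j == 1) then -1 else if (i == 1) && (j == 0) then 1 else 0).

Lemma inversion_mx_SL2Z : SL2Z inversion_mx.
Proof. by rewrite /SL2Z /= det_mx22 !mxE /=. Qed.

Lemma T_half k (tau : C) : (2 <= k)%N -> ~~ odd k -> 0 < complex.Im tau ->
  T k (tau / 2 : C^o) = odd_diff k (nome (tau : C^o)).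
Proof.
move=> k2 ke t0; have k0 : (0 < k)%N by lia.
have h0 : 0 < complex.Im (tau / 2).
  rewrite -[2](rmorph_nat (real_complex R) 2) -fmorphV; case: (tau) t0 => a b /= b0.
  by rewrite mulr0 add0r divr_gt0.
have [_ _] := T_nomeE k0 ke (nome_lt1 h0); rewrite /T => ->.
by rewrite -nomeMn [2 * _]mulrC divfK// pnatr_eq0.
Qed.

(** With [s = - 2 / tau] one has [- 1 / s = tau / 2], so the decay at the cusp 0 is read at [s]; the
    second hypothesis says that [Im s >= 1]. *)
Lemma T_half_bound k : (2 <= k)%N -> ~~ odd k -> exists2 B : R, 0 <= B & forall tau : C,
  0 < complex.Im tau -> nrm tau ^+ 2 <= 2 * complex.Im tau ->
  nrm (T k (tau / 2 : C^o)) <= (2 / nrm tau) ^+ (2 * k) *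
    (B * expR (- (pi * (complex.Im tau / nrm tau ^+ 2)))).
Proof.
move=> k2 ke; have [B B0 HB] := @lattice_form_two_row_act_decay R k inversion_mx k2 ke.
exists B => // tau t0 t2; have tn : 0 < nrm tau by rewrite nrm_gt0 uhp_neq0.
pose s := - 2 / tau.
have tn0 := uhp_neq0 t0.
have ImS : complex.Im s = 2 * complex.Im tau / nrm tau ^+ 2.
  have : s * tau = - 2 by rewrite /s divfK.
  have n2 : 0 < nrm tau ^+ 2 by rewrite exprn_gt0.
  move: n2; rewrite nrm_sqr; case: (s) (tau) => a b [x y] /= n2.
  rewrite -[2](rmorph_nat (real_complex R) 2); simpc => -[e1 e2].
  apply: (mulIf (lt0r_neq0 n2)); rewrite divfK ?lt0r_neq0//.
  have -> : b * (x ^+ 2 + y ^+ 2) = x * (b * x + a * y) - (a * x - b * y) * y by ring.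
  by rewrite e1 (addrC (b * x)) e2; ring.
have s0 : 0 < complex.Im s by rewrite ImS divr_gt0 ?mulr_gt0// exprn_gt0.
have aE : autfactor inversion_mx (s : C^o) = s by rewrite /autfactor !mxE /= mul1r addr0.
have mE : mobius inversion_mx (s : C^o) = tau / 2.
  rewrite /mobius aE !mxE /= mul0r add0r /s; field.
  by rewrite tn0.
have := slash_T k2 ke inversion_mx_SL2Z s0; rewrite /slash aE mE => H.
have sn0 : s ^+ (2 * k) != 0 by rewrite expf_neq0// uhp_neq0.
have -> : T k (tau / 2 : C^o) = s ^+ (2 * k) * lattice_form (two_row_act inversion_mx) k s.
  by rewrite -H mulVKf.
rewrite nrmM nrmX (_ : nrm s = 2 / nrm tau); last by rewrite /s nrmM nrmN nrmV nrm_nat.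
rewrite ler_wpM2l ?exprn_ge0 ?divr_ge0 ?nrm_ge0//.
have -> : pi * (complex.Im tau / nrm tau ^+ 2) = pi / 2 * complex.Im s.
  by rewrite ImS; field; rewrite gt_eqF.
by apply: HB; rewrite ImS ler_pdivlMr ?mul1r// exprn_gt0.
Qed.

(** [T (tau / 2)] depends only on the nome, so [tau] may be shifted to [t] with [|Re t| <= 1/2].
    Then [c |t| <= |1 - q| <= M' (1 - |q|) <= 2 pi M' Im t]: the Stolz region becomes a cone
    [Im t >= c1 |t|] at 0, where [Im t / |t|^2] tends to infinity. *)
Lemma stolz_T k (M e : R) : (2 <= k)%N -> ~~ odd k -> 0 < e ->
  \forall q \near (stolz M : set_system C^o), forall tau : C^o, q = nome tau ->
    `|T k (tau / 2)| < e%:C.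
Proof.
move=> k2 ke e0; have [B B0 HB] := T_half_bound k2 ke.
have [c c0 Hc] := @nome_sub1_lower R; have pi0 := pi_gt0 R.
pose M' : R := `|M| + 1; have M'0 : 0 < M' by rewrite ltr_wpDl.
pose c1 := c / (2 * pi * M'); have c10 : 0 < c1 by rewrite divr_gt0// !mulr_gt0.
have a0 : 0 < pi * c1 / 2 by rewrite divr_gt0// mulr_gt0.
have [X X0 HX] := pow_exp_decay (2 * k) a0 B0 e0.
(* The three bounds ensure, in this order, [Im t <= 1], then [|t| < 2 * c1] (hence
   [|t|^2 <= 2 Im t]), and [2 / |t| > X]. *)
pose d := Num.min (1 - expR (- (2 * pi))) (Num.min (c * (2 * c1)) (c * (2 / (X + 1)))).
have d0 : 0 < d.
  have h1 : 0 < 1 - expR (- (2 * pi)) :> R by rewrite subr_gt0 expR_lt1 oppr_lt0 mulr_gt0.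
  have h2 : 0 < c * (2 * c1) by apply: mulr_gt0 => //; apply: mulr_gt0.
  have h3 : 0 < c * (2 / (X + 1)) by rewrite mulr_gt0// divr_gt0// ltr_wpDl.
  by rewrite /d !lt_min h1 h2 h3.
apply: filterS (nbhs_nrm 1 d0) => q qd [q1 qM] tau qE.
have {q1} t0 : 0 < complex.Im tau.
  move: q1; rewrite nrmE -[1]/(1%:C) ltcR qE nrm_nome expR_lt1 oppr_lt0.
  by rewrite pmulr_rgt0// mulr_gt0.
pose n := Num.floor (complex.Re tau + 2^-1); pose t := tau + (- n)%:~R.
have qt : q = nome (t : C^o) by rewrite qE nome_period.
have tt0 : 0 < complex.Im t by rewrite Im_addz.
have tx : `|complex.Re t| <= 2^-1.
  rewrite Re_addz mulrNz; have := floor_itv (complex.Re tau + 2^-1).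
  rewrite -/n => /andP[n1 n2]; rewrite ler_norml; apply/andP; split; first lra.
  by move: n2; rewrite rmorphD /= => n2; lra.
have -> : T k (tau / 2) = T k (t / 2 : C^o).
  transitivity (odd_diff k q); first by rewrite qE; exact: T_half.
  by rewrite qt; exact/esym/T_half.
rewrite nrmE ltcR; set y := complex.Im t in tt0.
have nq : nrm q = expR (- (2 * pi * y)) by rewrite qt nrm_nome.
have {}qM : nrm (1 - q) <= M' * (2 * pi * y).
  have : nrm (1 - q) <= M * (1 - nrm q).
    by move: qM; rewrite !nrmE -[1]/(1%:C) -rmorphB -rmorphM lecR.
  move=> /le_trans; apply; have q01 : 0 <= 1 - nrm q.
    by rewrite nq subr_ge0 expR_le1 oppr_le0 !mulr_ge0// ltW.
  have MM : M <= M' by rewrite /M' (le_trans (ler_norm M))// lerDl.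
  apply: le_trans (ler_wpM2r q01 MM) _; apply: ler_wpM2l; first exact: ltW.
  by rewrite nq; have := expR_ge1Dx (- (2 * pi * y)); lra.
have y1 : y <= 1.
  rewrite leNgt; apply/negP => y1; move: qd; rewrite /d lt_min => /andP[+ _].
  have := ler_dist_nrm 1 q; rewrite -(nrmN (1 - q)) opprB nrm1 nq; have := ler_norm (1 - expR (- (2 * pi * y))).
  have : expR (- (2 * pi * y)) <= expR (- (2 * pi)).
    by rewrite ler_expR lerN2 ler_peMr ?mulr_ge0// ltW.
  lra.
have ct : c * nrm t <= nrm (1 - q) by rewrite qt; apply: Hc => //; rewrite tt0.
have tn : 0 < nrm t by rewrite nrm_gt0 uhp_neq0.
have qd' : nrm (1 - q) < d by rewrite -nrmN opprB.
have t1 : nrm t < 2 * c1.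
  rewrite -(ltr_pM2l c0); apply: le_lt_trans ct (lt_le_trans qd' _).
  by rewrite /d !ge_min lexx orbT.
have t2 : nrm t < 2 / (X + 1).
  rewrite -(ltr_pM2l c0); apply: le_lt_trans ct (lt_le_trans qd' _).
  by rewrite /d !ge_min lexx !orbT.
have yt : c1 * nrm t <= y.
  rewrite /c1 mulrAC ler_pdivrMr ?mulr_gt0//; apply: le_trans ct (le_trans qM _).
  by rewrite le_eqVlt; apply/orP; left; apply/eqP; ring.
apply: le_lt_trans (HB t tt0 _) _.
  rewrite expr2; apply: le_trans (ler_wpM2r (ltW tn) (ltW t1)) _.
  by rewrite -mulrA ler_wpM2l.
have xX : X < 2 / nrm t.
  have X1 : 0 < X + 1 by rewrite ltr_wpDl.
  rewrite ltr_pdivlMr//; move: t2; rewrite ltr_pdivlMr//.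
  by apply: le_lt_trans; rewrite mulrC ler_wpM2l ?nrm_ge0// lerDl.
apply: le_lt_trans (HX _ xX); rewrite ler_wpM2l ?exprn_ge0 ?divr_ge0 ?nrm_ge0//.
rewrite ler_wpM2l// ler_expR lerN2 -/y.
have -> : pi * c1 / 2 * (2 / nrm t) = pi * (c1 * nrm t / nrm t ^+ 2) by field; rewrite gt_eqF.
by rewrite ler_wpM2l ?(ltW pi0)// ler_wpM2r// invr_ge0 exprn_ge0// nrm_ge0.
Qed.

End Stolz.

(** * The limit at 1 *)

Section Limits.
Context {R : realType}.
Local Notation C := R[i].

Lemma poly_lipschitz (p : {poly C}) : exists2 B : R, 0 <= B & forall z : C,
  nrm z <= 1 -> nrm (p.[z] - p.[1]) <= B * nrm (z - 1).
Proof.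
elim/poly_ind: p => [|p c [B B0 HB]].
  by exists 0 => // z _; rewrite !horner0 subrr nrm0 mul0r.
exists (B + nrm p.[1]) => [|z z1]; first by rewrite addr_ge0 ?nrm_ge0.
have -> : (p * 'X + c%:P).[z] - (p * 'X + c%:P).[1] = (p.[z] - p.[1]) * z + p.[1] * (z - 1).
  by rewrite !hornerE; ring.
apply: le_trans (ler_nrmD _ _) _; rewrite [leRHS]mulrDl nrmM [nrm (p.[1] * _)]nrmM lerD2r.
by apply: le_trans (HB z z1); rewrite ler_piMr ?nrm_ge0.
Qed.

Lemma poly_bounded (p : {poly C}) : exists2 B : R, 0 <= B & forall z : C, nrm z <= 1 -> nrm p.[z] <= B.
Proof.
have [B B0 HB] := poly_lipschitz p; exists (B * 2 + nrm p.[1]) => [|z z1].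
  by rewrite addr_ge0 ?mulr_ge0 ?nrm_ge0.
have -> : p.[z] = (p.[z] - p.[1]) + p.[1] by ring.
apply: le_trans (ler_nrmD _ _) _; rewrite lerD2r; apply: le_trans (HB z z1) _.
rewrite ler_wpM2l//; apply: le_trans (ler_nrmB _ _) _; rewrite nrm1; lra.
Qed.

(** Dominated convergence for series, along any filter: finitely many terms are made close, and the
    tails of both series are at most that of [g]. *)
Lemma tannery T (F : set_system T) (FF : Filter F) (f : T -> nat -> C) (l : nat -> C) (g : nat -> R) :
  rsummable setT g -> (\forall x \near F, forall n, nrm (f x n) <= g n) ->
  (forall n, nrm (l n) <= g n) ->
  (forall n e, 0 < e -> \forall x \near F, nrm (f x n - l n) < e) ->
  forall e, 0 < e -> \forall x \near F, nrm (csum setT (f x) - csum setT l) < e.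
Proof.
move=> sg fg lg fl e e0.
have g0 n : 0 <= g n by apply: le_trans (lg n); exact: nrm_ge0.
have sl : csummable setT l by apply: csummable_le sg.
have sgC : csummable setT (fun n => (g n)%:C : C).
  by apply: rsummable_le sg => n _; rewrite nrm_real normr_id ger0_norm.
have sgN N : rsummable setT (fun n => g (N + n)%N).
  apply: rsummable_le (csummable_shift N sgC) => n _; by rewrite nrm_real.
have tailE N : rsum setT (fun n => g (N + n)%N) = rsum setT g - \sum_(i < N) g i.
  have := csum_split_nat N sgC; rewrite !csum_real -rmorph_sum -rmorphD => -[->].
  by rewrite addrAC subrr add0r.
have [N HN] : exists N, rsum setT (fun n => g (N + n)%N) < e / 4.
  have /cvgrPdist_lt /(_ (e / 4)) := cvg_series_rsum sg; rewrite divr_gt0// => /(_ isT)[N _ HN].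
  exists N; rewrite tailE; apply: le_lt_trans (ler_norm _) _.
  by have := HN N (leqnn N); rewrite /series /= big_mkord.
have e1 : 0 < e / (2 * N.+1%:R) by rewrite divr_gt0// mulr_gt0.
have near1 : \forall x \near F, forall i : 'I_N, nrm (f x i - l i) < e / (2 * N.+1%:R).
  by apply: filter_forall => i; exact: fl.
apply: filterS2 fg near1 => x xg x1.
have sf : csummable setT (f x) by apply: csummable_le sg.
rewrite -csumB// (csum_split_nat N (csummableB sf sl)).
have sh := csummable_shift N (csummableB sf sl).
apply: le_lt_trans (ler_nrmD _ _) _.
have A1 : nrm (\sum_(i < N) (f x i - l i)) <= e / 2.
  apply: le_trans (nrm_sum _ _ _) _; apply: (@le_trans _ _ (\sum_(i < N) e / (2 * N.+1%:R))).
    by apply: ler_sum => i _; exact: ltW.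
  have N0 : (0 : R) < N.+1%:R by [].
  have -> : \sum_(i < N) e / (2 * N.+1%:R) = e / 2 * (N%:R / N.+1%:R).
    by rewrite sumr_const card_ord -mulr_natr invfM; ring.
  by apply: ler_piMr; [rewrite divr_ge0// ltW|rewrite ler_pdivrMr// mul1r ler_nat].
have A2 : nrm (csum setT (fun n => f x (N + n)%N - l (N + n)%N)) <= 2 * rsum setT (fun n => g (N + n)%N).
  apply: le_trans (nrm_csum_le sh) _; rewrite -rsumZ//; apply: le_rsum; [exact: sh|exact: rsummableZ|].
  by move=> n _; apply: le_trans (ler_nrmB _ _) _; rewrite mulr_natl mulr2n lerD.
lra.
Qed.

(** The middle term is the smallest on average: the induction adds the two outer terms, and
    [1 + r^(2n + 2) >= 2 r^(n + 1)]. *)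
Lemma geo_sum_lower n (r : R) : 0 <= r -> n.*2.+1%:R * r ^+ n <= \sum_(i < n.*2.+1) r ^+ i.
Proof.
move=> r0; elim: n => [|n IH]; first by rewrite big_ord1 expr0 mulr1.
rewrite doubleS big_ord_recr big_ord_recl /= expr0.
have -> : \sum_(i < n.*2.+1) r ^+ bump 0 i = r * \sum_(i < n.*2.+1) r ^+ i.
  by rewrite mulr_sumr; apply: eq_bigr => i _; rewrite /bump add1n exprS.
have H := ler_wpM2l r0 IH.
have -> : r ^+ n.*2.+2 = r ^+ n.+1 * r ^+ n.+1 by rewrite -exprD; congr (_ ^+ _); lia.
have E : r * (n.*2.+1%:R * r ^+ n) = n.*2.+1%:R * r ^+ n.+1 by rewrite exprS; ring.
rewrite E in H; have := sqr_ge0 (1 - r ^+ n.+1).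
rewrite -[n.*2.+3]addn2 natrD; nra.
Qed.

Definition geo_poly (j : nat) : {poly C} := \sum_(i < j) 'X^i.

Lemma geo_polyE j (z : C) : 1 - z ^+ j = (1 - z) * (geo_poly j).[z].
Proof.
rewrite /geo_poly horner_sum -[1 in LHS](expr1n _ j) subrXX; congr (_ * _).
by apply: eq_bigr => i _; rewrite hornerXn expr1n mul1r.
Qed.

Lemma geo_poly1 j : (geo_poly j).[1] = j%:R.
Proof.
rewrite /geo_poly horner_sum (eq_bigr (fun=> 1)) ?sumr_const ?card_ord// => i _.
by rewrite hornerXn expr1n.
Qed.

#[local] Instance stolz_filter (M : R) : Filter (stolz M : set_system C^o).
Proof. exact: within_filter. Qed.

Lemma stolz_near (M e : R) : 0 < e -> \forall q \near (stolz M : set_system C^o),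
  [/\ nrm (q - 1) < e, nrm q < 1 & nrm (1 - q) <= M * (1 - nrm q)].
Proof.
move=> e0; apply: filterS (nbhs_nrm 1 e0) => q qe [].
rewrite !nrmE -[1]/(1%:C) ltcR -rmorphB -rmorphM lecR => q1 qM; by split.
Qed.

(** With [j = 2 n + 1], the Stolz condition bounds [(1 - q) / (1 - q^j)] by [M / S], where [S] is
    the geometric sum in [|q|]. As [S >= j |q|^n], two such factors and [|q|^(2n)] give the summable
    [j^-2]; any further factor is at most [M]. *)
Lemma tannery_bound (M : R) n (q : C) : nrm q < 1 -> nrm (1 - q) <= M * (1 - nrm q) ->
  nrm q ^+ n.*2 * nrm ((geo_poly n.*2.+1).[q]^-1) ^+ 2 <= M ^+ 2 * (n.*2.+1%:R ^+ 2)^-1 /\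
  nrm ((geo_poly n.*2.+1).[q]^-1) <= M.
Proof.
move=> q1 qM; set r := nrm q; have r0 : 0 <= r by exact: nrm_ge0.
have r1 : 0 < 1 - r by rewrite subr_gt0.
have z1 : 1 - q != 0 by exact: nrm_lt1_neq0.
have z2 : 0 < nrm (1 - q) by rewrite nrm_gt0.
set j := n.*2.+1; have j0 : 0 < j%:R :> R by rewrite ltr0n.
have qj : 1 - q ^+ j != 0 by apply: nrm_lt1_neq0; apply: qX_lt1.
have gE : (geo_poly j).[q]^-1 = (1 - q) / (1 - q ^+ j).
  by rewrite geo_polyE invfM mulrA mulfV ?mul1r.
pose S := \sum_(i < j) r ^+ i.
have SE : 1 - r ^+ j = (1 - r) * S.
  rewrite /S -[1 in LHS](expr1n _ j) subrXX; congr (_ * _).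
  by apply: eq_bigr => i _; rewrite expr1n mul1r.
have Sj : j%:R * r ^+ n <= S by exact: geo_sum_lower.
have S0 : 0 < S.
  rewrite -(pmulr_rgt0 _ r1) -SE subr_gt0 exprn_ilt1//.
have lo : (1 - r) * S <= nrm (1 - q ^+ j).
  rewrite -SE; apply: le_trans (ler_norm _) (le_trans _ (ler_dist_nrm 1 (q ^+ j))).
  by rewrite nrm1 nrmX.
have M0 : 0 <= M by rewrite -(pmulr_lge0 _ r1); apply: le_trans qM; exact: nrm_ge0.
have gS : nrm ((geo_poly j).[q]^-1) <= M / S.
  rewrite gE nrmM nrmV ler_pdivrMr ?nrm_gt0//; apply: le_trans qM _.
  rewrite -mulrA ler_wpM2l// mulrC ler_pdivlMr//.
have S1 : 1 <= S by rewrite /S big_ord_recl expr0 lerDl sumr_ge0// => i _; rewrite exprn_ge0.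
split; last by apply: le_trans gS _; rewrite ler_pdivrMr// ler_peMr.
apply: (@le_trans _ _ (r ^+ n.*2 * (M / S) ^+ 2)).
  by rewrite ler_wpM2l ?exprn_ge0// lerXn2r ?nnegrE ?nrm_ge0 ?divr_ge0// ltW.
rewrite expr_div_n mulrCA ler_wpM2l ?exprn_ge0// ler_pdivrMr ?exprn_gt0//.
rewrite mulrC ler_pdivlMr ?exprn_gt0// -muln2 exprM -exprMn.
by rewrite lerXn2r ?nnegrE ?mulr_ge0 ?exprn_ge0 ?(ltW S0) ?(ltW j0)// mulrC.
Qed.

Lemma poly_cvg (M : R) (p : {poly C}) : (p.[q] : C^o) @[q --> (stolz M : set_system C^o)] --> (p.[1] : C^o).
Proof.
have [B B0 HB] := poly_lipschitz p; apply/cvgC_nrm => e e0.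
have e1 : 0 < e / (B + 1) by rewrite divr_gt0// ltr_wpDl.
apply: filterS (stolz_near M e1) => q [qe q1 _].
apply: le_lt_trans (HB q (ltW q1)) _; move: qe; rewrite ltr_pdivlMr ?ltr_wpDl//.
by apply: le_lt_trans; rewrite mulrC ler_wpM2l ?nrm_ge0// lerDl.
Qed.

Lemma csummable_zeta w : (2 <= w)%N ->
  csummable setT (fun n : nat => (n.+1%:R ^+ w)^-1 : C).
Proof.
move=> w2; apply: csummable_le (@rsummable_zeta R w w2) => n _.
by rewrite nrmV nrmX nrm_nat.
Qed.

Lemma bij_even : set_bij setT [set n | ~~ odd n] double.
Proof. by apply: (@can_set_bij _ _ _ _ _ half) => n //=; lia. Qed.

Lemma bij_odd : set_bij setT (~` [set n | ~~ odd n]) (fun n => n.*2.+1).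
Proof. by apply: (@can_set_bij _ _ _ _ _ half) => n //=; lia. Qed.

Lemma csummable_zeta_odd w : (2 <= w)%N ->
  csummable setT (fun n : nat => (n.*2.+1%:R ^+ w)^-1 : C).
Proof.
move=> w2; apply: (csummable_reindex (fun n : nat => (n.+1%:R ^+ w)^-1 : C) bij_even).1.
exact: csummable_sub (@subsetT _ _) (csummable_zeta w2).
Qed.

Lemma zeta_odd w : (2 <= w)%N ->
  csum setT (fun n => (n.*2.+1%:R ^+ w)^-1) = (1 - (2 ^+ w)^-1) * (zeta w)%:C :> C.
Proof.
move=> w2; have s := csummable_zeta w2; rewrite zeta_csum//.
have E : csum setT ((fun n : nat => (n.+1%:R ^+ w)^-1) \o (fun n => n.*2.+1)) =
    (2 ^+ w)^-1 * csum setT (fun n : nat => (n.+1%:R ^+ w)^-1) :> C.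
  by rewrite -csumZ//; apply: eq_csum => n _ /=; rewrite -doubleS -mul2n natrM exprMn invfM.
have := csumID [set n | ~~ odd n] s; rewrite !setTI (csum_reindex _ bij_even) (csum_reindex _ bij_odd) E.
by move: (csum _ _) => Z H; rewrite mulrBl mul1r {1}H addrK.
Qed.

(** The factor [(1 - q)^(2k)] turns each term into a polynomial divided by a power of [geo_poly],
    continuous at 1 with value [(2k - 1)! / j^(2k)] up to the common factor [c]; [tannery] passes to
    the sum over odd [j]. *)
Lemma odd_sum_stolz k (M : R) : (2 <= k)%N ->
  ((1 - q) ^+ (2 * k) * odd_sum k q : C^o) @[q --> (stolz M : set_system C^o)] -->
  (2 ^+ (2 * k - 1) * ((2 * k - 1)`!%:R * (1 - (2 ^+ (2 * k))^-1)) * (zeta (2 * k))%:C : C^o).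
Proof.
move=> k2; have k0 : (0 < k)%N by lia.
have w2 : (2 * k = 2 + (2 * k - 2))%N by lia.
pose P : {poly C} := map_poly intr (Pe k).
have [B B0 HB] := poly_bounded P.
pose c : C := 2 ^+ (2 * k - 1).
pose j n := n.*2.+1.
pose f (q : C) n : C := (q ^+ j n * P.[q ^+ j n]) * (geo_poly (j n)).[q]^-1 ^+ (2 * k).
pose l n : C := (2 * k - 1)`!%:R * ((j n)%:R ^+ (2 * k))^-1.
have fE (q : C) : nrm q < 1 -> (1 - q) ^+ (2 * k) * odd_sum k q = c * csum setT (f q).
  move=> q1; have nq := nrm_lt1_neq0 q1.
  have E n : (1 - q) ^+ (2 * k) * summand k (q ^+ (2 * n + 1) : C^o) = c * f q n.
    have jE : (2 * n + 1 = j n)%N by rewrite /j; lia.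
    have nz : 1 - q ^+ j n != 0 by apply: nrm_lt1_neq0; apply: qX_lt1.
    rewrite jE /summand -/P -/c /f exprVn.
    have gE : (1 - q ^+ j n) ^+ (2 * k) = (1 - q) ^+ (2 * k) * (geo_poly (j n)).[q] ^+ (2 * k).
      by rewrite -exprMn -geo_polyE.
    have := expf_neq0 (2 * k) nz; rewrite gE mulf_eq0 negb_or => /andP[X0 Y0].
    move: X0 Y0; move: ((1 - q) ^+ (2 * k)) ((geo_poly (j n)).[q] ^+ (2 * k)) => X Y X0 Y0.
    by field; rewrite X0 Y0.
  have s := csummable_odd_sum k0 q1.
  have c0 : c != 0 by rewrite expf_neq0// pnatr_eq0.
  have sf : csummable setT (f q).
    apply: eq_csummable (csummableZ (c^-1 * (1 - q) ^+ (2 * k)) s) => n _.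
    by rewrite -[LHS]mulrA E mulKf.
  rewrite -(csumZ _ s) -(csumZ _ sf); apply: eq_csum => n _; exact: E.
have lE : csum setT l = (2 * k - 1)`!%:R * ((1 - (2 ^+ (2 * k))^-1) * (zeta (2 * k))%:C).
  rewrite -zeta_odd; last by lia.
  by rewrite -csumZ//; apply: csummable_zeta_odd; lia.
have sg : rsummable setT (fun n => ((j n)%:R ^+ 2)^-1 : R).
  apply: rsummable_le (@rsummable_zeta R 2 _) => // n _.
  rewrite ger0_norm ?invr_ge0 ?exprn_ge0// lef_pV2 ?posrE ?exprn_gt0//.
  by rewrite lerXn2r ?nnegrE// ler_nat /j; lia.
(* The first summand dominates the terms [f q n], the second their limits [l n]. *)
pose K : R := B * M ^+ (2 * k) + (2 * k - 1)`!%:R.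
have M0 : 0 <= M ^+ (2 * k) by rewrite exprM exprn_ge0// sqr_ge0.
have near1 := stolz_near M (@ltr01 R).
have fg : \forall q \near (stolz M : set_system C^o), forall n, nrm (f q n) <= K * ((j n)%:R ^+ 2)^-1.
  apply: filterS near1 => q [_ q1 qM] n; have [H1 H2] := tannery_bound n q1 qM.
  have r0 := nrm_ge0 q; have g0 := nrm_ge0 ((geo_poly (j n)).[q]^-1).
  apply: (@le_trans _ _ (B * M ^+ (2 * k) * ((j n)%:R ^+ 2)^-1)); last first.
    by rewrite ler_wpM2r ?invr_ge0 ?exprn_ge0// lerDl.
  rewrite /f !nrmM !nrmX.
  have zB : nrm P.[q ^+ j n] <= B by apply: HB; rewrite nrmX exprn_ile1// ltW.
  have rj : nrm q ^+ j n <= nrm q ^+ n.*2 by rewrite /j exprS ler_piMl ?exprn_ge0// ltW.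
  rewrite w2 !exprD.
  have M1 : 0 <= M by apply: le_trans g0 H2.
  have h1 : nrm (geo_poly (j n)).[q]^-1 ^+ (2 * k - 2) <= M ^+ (2 * k - 2) by rewrite lerXn2r ?nnegrE.
  have h2 : nrm q ^+ j n * nrm (geo_poly (j n)).[q]^-1 ^+ 2 <= M ^+ 2 / (j n)%:R ^+ 2.
    by apply: le_trans H1; rewrite ler_wpM2r ?exprn_ge0.
  move: h1 h2 zB; have := nrm_ge0 P.[q ^+ j n].
  have : 0 <= nrm (geo_poly (j n)).[q]^-1 ^+ (2 * k - 2) by rewrite exprn_ge0.
  have : 0 <= nrm q ^+ j n * nrm (geo_poly (j n)).[q]^-1 ^+ 2 by rewrite mulr_ge0 ?exprn_ge0.
  move: (nrm q ^+ j n) (nrm P.[q ^+ j n]) (nrm (geo_poly (j n)).[q]^-1 ^+ 2) => a p g2.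
  move: (nrm (geo_poly (j n)).[q]^-1 ^+ (2 * k - 2)) (M ^+ 2) (M ^+ (2 * k - 2)) ((j n)%:R ^+ 2)^-1.
  move=> g3 m2 m3 J x0 y0 p0 h1 h2 zB.
  have -> : a * p * (g2 * g3) = p * ((a * g2) * g3) by ring.
  have -> : B * (m2 * m3) * J = B * ((m2 * J) * m3) by ring.
  by apply: ler_pM => //; [rewrite mulr_ge0|apply: ler_pM].
have lg n : nrm (l n) <= K * ((j n)%:R ^+ 2)^-1.
  rewrite /l nrmM nrmV nrmX !nrm_nat; apply: ler_pM => //.
  - by rewrite lerDr mulr_ge0.
  - by rewrite lef_pV2 ?posrE ?exprn_gt0// ler_weXn2l ?ler1n//; lia.
have fl n e : 0 < e -> \forall q \near (stolz M : set_system C^o), nrm (f q n - l n) < e.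
  apply: (cvgC_nrm _ (fun q => f q n : C^o) (l n)).2.
  pose A : {poly C} := 'X^(j n) * (P \Po 'X^(j n)).
  have A1 : A.[1] = (2 * k - 1)`!%:R.
    by rewrite hornerM hornerXn horner_comp hornerXn expr1n mul1r Pe1.
  have c1 := @poly_cvg M A; rewrite A1 in c1.
  have c2 := @poly_cvg M (geo_poly (j n)); rewrite geo_poly1 in c2.
  have j0 : ((j n)%:R : C) != 0 by rewrite pnatr_eq0.
  have c3 := @cvg_expn (R[i]) _ _ _ _ _ (2 * k)%N (@cvgV (R[i]) _ _ _ _ _ j0 c2).
  have E : (fun q : C^o => f q n) = (fun q => A.[q] * ((geo_poly (j n)).[q])^-1 ^+ (2 * k)).
    by apply/funext => q; rewrite hornerM hornerXn horner_comp hornerXn.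
  have {}c3 := c3 (stolz_filter M) (stolz_filter M).
  rewrite E /l -exprVn; refine (@cvgM (R[i]) _ _ _ _ _ _ _ c1 c3).
apply/cvgC_nrm => e e0.
have c0 : 0 < nrm c by rewrite nrm_gt0 expf_neq0// pnatr_eq0.
have := tannery (stolz_filter M) (rsummableZ K sg) fg lg fl (divr_gt0 e0 c0).
apply: filterS2 near1 => q [_ q1 _] H.
by rewrite fE// -mulrA -mulrA -lE -mulrBr nrmM mulrC -ltr_pdivlMr.
Qed.

Definition zeta_factor k : C := 2 ^+ (2 * k - 1) * ((2 * k - 1)`!%:R * (1 - (2 ^+ (2 * k))^-1)).

Lemma zeta_factor_neq0 k : (0 < k)%N -> zeta_factor k != 0.
Proof.
move=> k0; rewrite !mulf_neq0 ?expf_neq0 ?pnatr_eq0 ?factC_neq0 -?lt0n ?fact_gt0//.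
rewrite -natrX subr_eq0 eq_sym invr_eq1 pnatr_eq1 gtn_eqF//.
by rewrite -[1%N]/(2 ^ 0)%N ltn_exp2l// muln_gt0 k0.
Qed.

(** [cusp_constant] multiplied by [(2 pi i)^(2k)]: the relation that cancels the constants of [T] at
    the cusps also matches the limits of the two sides at 1. *)
Lemma zeta_factor_product k : (2 <= k)%N -> ~~ odd k ->
  ratr (coef_d k) * (zeta_factor 2 * (zeta 4)%:C / 8) ^+ k./2 = zeta_factor k * (zeta (2 * k))%:C.
Proof.
move=> k2 ke; have k0 : (0 < k)%N by lia.
have := @cusp_constant R k k0 ke; rewrite !int_zeta_zeta ?oddM//; last by lia.
have p0 n : ((2 * pi)%:C * 'i%C : C) ^+ n != 0 by rewrite expf_neq0// twopii_neq0.
have pE : ((2 * pi)%:C * 'i%C : C) ^+ (2 * k) = (((2 * pi)%:C * 'i%C : C) ^+ (2 * 2)) ^+ k./2.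
  by rewrite -exprM; congr (_ ^+ _); lia.
have -> : lipschitz_const k / 2 * ((1 - (2 ^+ (2 * k))^-1) * (2 * (zeta (2 * k))%:C)) =
    zeta_factor k * (zeta (2 * k))%:C / ((2 * pi)%:C * 'i%C) ^+ (2 * k) :> C.
  rewrite /lipschitz_const /zeta_factor; move: (p0 (2 * k)%N) (_ ^+ (2 * k - 1) : C) ((1 - _) : C) => P0 X Y.
  by move: P0; move: (((2 * pi)%:C * 'i%C : C) ^+ (2 * k)) => P P0; field.
have -> : lipschitz_const 2 / 16 * ((1 - (2 ^+ 4)^-1) * (2 * (zeta 4)%:C)) =
    (zeta_factor 2 * (zeta 4)%:C / 8) / ((2 * pi)%:C * 'i%C) ^+ (2 * 2) :> C.
  rewrite /lipschitz_const /zeta_factor; move: (p0 (2 * 2)%N).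
  by move: (((2 * pi)%:C * 'i%C : C) ^+ (2 * 2)) => P P0; field.
rewrite expr_div_n -pE => H; apply: (mulIf (invr_neq0 (p0 (2 * k)%N))).
by rewrite H mulrA.
Qed.

Lemma normalizationE k (q x : C) :
  normalization k (q : C^o) * x = (zeta_factor k)^-1 * ((1 - q) ^+ (2 * k) * x).
Proof.
rewrite /normalization /zeta_factor -(mulrA (2 ^+ (2 * k - 1))).
by rewrite mulrAC [LHS]mulrC.
Qed.

Lemma cst_cvg (M : R) (c : C) : (c : C^o) @[_ --> (stolz M : set_system C^o)] --> (c : C^o).
Proof. exact: (@cvg_cst _ (c : C^o) _ _ (stolz_filter M)). Qed.

Lemma series_side_limit k (M : R) : (2 <= k)%N ->
  (normalization k (q : C^o) * odd_sum k q : C^o) @[q --> (stolz M : set_system C^o)] -->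
  ((zeta (2 * k))%:C : C^o).
Proof.
move=> k2; have k0 : (0 < k)%N by lia.
have E : (fun q : C^o => normalization k q * odd_sum k q : C^o) =
    (fun q => (zeta_factor k)^-1 * ((1 - q) ^+ (2 * k) * odd_sum k q)).
  by apply/funext => q; rewrite normalizationE.
rewrite E -[X in _ --> X](mulKf (zeta_factor_neq0 k0)).
exact: (@cvgM (R[i]) _ _ (stolz_filter M) _ _ _ _ (@cst_cvg M _) (odd_sum_stolz M k2)).
Qed.

(* The limit is that of the series for [k = 2], raised to the power [k / 2];
   [cusp_constant] identifies it. *)
Lemma product_side_limit k (M : R) : (2 <= k)%N -> ~~ odd k ->
  (normalization k (q : C^o) * (ratr (coef_d k) * (odd_sum 2 q / 8) ^+ k./2) : C^o)
    @[q --> (stolz M : set_system C^o)] --> ((zeta (2 * k))%:C : C^o).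
Proof.
move=> k2 ke; have k0 : (0 < k)%N by lia.
have FF := stolz_filter M.
have c2 := @cvgM (R[i]) _ _ FF _ _ _ _ (odd_sum_stolz M (leqnn 2)) (@cst_cvg M 8^-1).
have c3 := @cvg_expn (R[i]) _ _ FF _ _ k./2 c2.
have c4 := @cvgM (R[i]) _ _ FF _ _ _ _ (@cst_cvg M (ratr (coef_d k) / zeta_factor k)) c3.
have -> : (fun q : C^o => normalization k q * (ratr (coef_d k) * (odd_sum 2 q / 8) ^+ k./2) : C^o) =
    (fun q => ratr (coef_d k) / zeta_factor k * (((1 - q) ^+ (2 * 2) * odd_sum 2 q) * 8^-1) ^+ k./2).
  apply/funext => q; rewrite normalizationE -mulrA [in RHS]mulrCA; congr (_ * _).
  rewrite mulrCA; congr (_ * _); rewrite -[in RHS]mulrA [in RHS]exprMn -exprM.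
  by congr (_ ^+ _ * _); lia.
have <- : ratr (coef_d k) / zeta_factor k * (zeta_factor 2 * (zeta (2 * 2))%:C / 8) ^+ k./2 =
    (zeta (2 * k))%:C.
  by rewrite mulrAC zeta_factor_product// mulrC mulKf ?zeta_factor_neq0.
exact: c4.
Qed.

End Limits.

(** * Cusp form property and conclusion *)

Section Final.
Context {R : realType}.
Local Notation C := R[i].

Lemma T_cusp_form k : (2 <= k)%N -> ~~ odd k -> cusp_forms (2 * k) 4 (T k : C^o -> C^o).
Proof.
move=> k2 ke; split.
- by move=> tau t0; apply: T_derivable.
- move=> g gG tau t0; rewrite slash_T//; last by case: gG.
  by rewrite two_row_act_Gamma0// T_lattice_form.
- move=> g gS e e0.
  have [B B0 HB] := @lattice_form_two_row_act_decay R k g k2 ke.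
  have pi0 := pi_gt0 R.
  have [X X0 HX] := pow_exp_decay 0 (divr_gt0 pi0 (ltr0Sn R 1)) B0 e0.
  exists (Num.max X 1); split; first exact: num_real.
  move=> A; rewrite gt_max => /andP[XA A1] tau tA.
  have t0 : 0 < complex.Im tau by apply: lt_trans tA; apply: lt_trans A1.
  rewrite normc_lt slash_T//; apply: le_lt_trans (HB tau _) _.
    by apply: ltW; apply: lt_trans tA.
  by rewrite -[ltLHS]mul1r -[1 in ltLHS](expr0 (complex.Im tau)); apply: HX; apply: lt_trans tA.
Qed.

End Final.

Theorem theorem3p1 (R : realType) (k : nat) (hk2 : (2 <= k)%N)
  (hk : ~~ odd k) :
  let euler : R :=
    (-1) ^+ (k + 1) * 2 ^+ (2 * k) * ratr (bernoulli (2 * k)) * pi ^+ (2 * k)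
    / (2 * (2 * k)`!%:R) in
  let LHS (q : R[i]^o) : R[i]^o := limn (odd_series k q) in
  let RHS (q : R[i]^o) : R[i]^o :=
    q ^+ (k./2) * ratr (coef_d k) * limn (odd_product k q) in
  [/\ size (Pe k) = (2 * k - 2).+1,
      forall q : R[i]^o, `|q| < 1 ->
        [/\ cvgn (odd_series k q) /\ cvgn (odd_product k q),
            cvgn (T_series k q) /\ cvgn (T_product k q),
            forall tau : R[i]^o, upper_half_plane tau -> q = nome tau ->
              LHS q - T k (tau / 2) = RHS q
          & q = 0 -> LHS q - T_nome k 0 = RHS q],
      cusp_forms (2 * k) 4 (T k : R[i]^o -> R[i]^o),
      forall M e : R, 0 < e ->
        \forall q \near stolz M, forall tau : R[i]^o, q = nome tau ->
          `|T k (tau / 2)| < e%:C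
    & [/\ forall M : R,
            normalization k q * LHS q @[q --> stolz M] -->
              ((zeta (2 * k))%:C : R[i]^o),
          forall M : R,
            normalization k q * RHS q @[q --> stolz M] -->
              (euler%:C : R[i]^o)
        & zeta (2 * k) = euler]].
Proof.
move=> euler LHS RHS; have k0 : (0 < k)%N by apply: ltn_trans hk2.
have lt1 (q : R[i]^o) : `|q| < 1 -> nrm q < 1.
  by rewrite nrmE -[1]/(1%:C) ltcR.
have LE (q : R[i]^o) : nrm q < 1 -> LHS q = odd_sum k q.
  by move=> q1; exact: odd_series_lim.
have RE (q : R[i]^o) : nrm q < 1 -> RHS q = ratr (coef_d k) * (odd_sum 2 q / 8) ^+ k./2.
  by move=> q1; exact: (product_side hk q1).2.
(* [odd_diff] is the series minus the product side by construction; it remains to recognise it as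
   [T], through [T_half] at a nome and through [T_nomeE] at [q = 0]. *)
have key (q : R[i]^o) : nrm q < 1 -> LHS q - odd_diff k q = RHS q.
  by move=> q1; rewrite LE// RE// /odd_diff opprB addrC subrK.
split.
- exact: size_Pe.
- move=> q /lt1 q1; have [c3 c4 _] := T_nomeE k0 hk q1; split.
  + split; first exact: cvgP (odd_series_cvg k0 q1).
    exact: (product_side hk q1).1.
  + by split.
  + move=> tau t0 qE; rewrite -key//.
    have -> : T k (tau / 2) = odd_diff k q by rewrite qE; exact: T_half.
    by [].
  + move=> q0; rewrite -key// q0.
    have z1 : nrm (0 : R[i]) < 1 by rewrite nrm0.
    have [_ _ ->] := T_nomeE k0 hk z1.
    by rewrite expr0n.
- exact: T_cusp_form.
- by move=> M e e0; exact: stolz_T.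
- have near1 M : \forall q \near (stolz M : set_system R[i]^o), nrm q < 1.
    by apply: filterS (stolz_near M (@ltr01 R)) => q [].
  have EZ : zeta (2 * k) = euler by exact: euler_zeta.
  have FF := @stolz_filter R.
  split.
  + move=> M; apply: cvg_trans (series_side_limit M hk2).
    apply: near_eq_cvg; apply: filterS (near1 M) => q q1; by rewrite LE.
  + move=> M; rewrite -EZ; apply: cvg_trans (product_side_limit M hk2 hk).
    apply: near_eq_cvg; apply: filterS (near1 M) => q q1; by rewrite RE.
  + exact: EZ.
Qed.
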